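(* Let $\alpha$ be a fixed constant positive integer. Given a rooted WRAP instance $(G=(V,E),L,c,r,e_r)$ with a non-shortenable directed WRAP solution $\vec F_0$ and a cost function $\tilde c\colon\vec F_0\to\mathbb R_{\ge0}$, one can in polynomial time compute a maximizer of $$\max\big\{\tilde c(\mathrm{Drop}_{\vec F_0}(K))-c(K): K\subseteq L\text{ is }\alpha\text{-thin}\big\}.$$
   Context: Rooted WRAP instance: cycle $G=(V,E)$, links $L\subseteq\binom V2$, costs $c\colon L\to\mathbb R_{\ge0}$, root $r$, edge $e_r\in E$ at $r$. $\mathcal C_G=\{C\subseteq V\setminus\{r\}:|\delta_E(C)|=2\}$; $\delta_F(U)$ = elements of $F$ with exactly one endpoint in $U$. Directed link $(u,v)$ covers $C$ if $v\in C,u\notin C$; directed WRAP solution covers all $C\in\mathcal C_G$. Shortening of $(u,v)$: $(s,v)$, $s\ne v$, $s$ on the $u$-$v$ path of $(V,E\setminus\{e_r\})$ (strict if $s\neq u$). Non-shortenable: deleting or strictly shortening any link destroys feasibility; then $(V,\vec F_0)$ is an $r$-arborescence. $(u,v)\in\vec F_0$ is responsible for $C$ if it covers $C$ and no link on the $r$-$u$ path of $(V,\vec F_0)$ covers $C$; $\mathrm{Drop}_{\vec F_0}(K)$ = links $\vec\ell\in\vec F_0$ such that each $C$ for which $\vec\ell$ is responsible has $\delta_K(C)\ne\emptyset$. $K\subseteq L$ is $\alpha$-thin if some inclusion-wise maximal laminar family $\mathcal L\subseteq\mathcal C_G$ (members pairwise disjoint or nested) has $|\delta_K(C)|\le\alpha$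 for all $C\in\mathcal L$. *)

(* Defs.v *)
From HB Require Import structures.
From mathcomp Require Import all_boot all_order all_algebra.
From mathcomp Require Import boolp reals.

Set Implicit Arguments.
Unset Strict Implicit.
Unset Printing Implicit Defensive.

Import Order.TTheory GRing.Theory Num.Theory.
Local Open Scope ring_scope.


(* A multigraph on vertices V with edge set E is given by ends : E -> {set V}.
   For a set L of links, which are themselves 2-subsets of V, ends is the
   identity, so [cut] serves both for delta_E and for delta_L. *)
Definition cut (V E : finType) (ends : E -> {set V}) (F : {set E})
    (U : {set V}) : {set E} :=
  [set e in F | #|ends e :&: U| == 1]%N.

(* [ordS] is the cyclic successor on 'I_n. For n = 2 the cycle consists of two
   parallel edges; loops (n = 1) are excluded. *)
Definition is_cycle (V E : finType) (ends : E -> {set V}) : Prop :=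
  exists (n : nat) (v : 'I_n -> V) (e : 'I_n -> E),
    [/\ (1 < n)%N, bijective v, bijective e &
        forall i, ends (e i) = [set v i; v (ordS i)]].

Record rooted_wrap (R : realType) := RootedWrap {
  vertex : finType;
  edge : finType;
  ends : edge -> {set vertex};
  cycleP : is_cycle ends;
  links : {set {set vertex}};
  linksP : forall l, l \in links -> #|l| = 2%N;
  cost : {set vertex} -> R;
  cost_ge0 : forall l, l \in links -> 0 <= cost l;
  root : vertex;
  root_edge : edge;
  root_edgeP : root \in ends root_edge }.

Section Wrap.
Variables (R : realType) (I : rooted_wrap R).
Local Notation V := (vertex I).
Implicit Types (C U : {set V}) (K : {set {set V}}) (F : {set V * V}).

(* The family C_G. *)
Definition ring_cuts : {set {set V}} :=
  [set C : {set V} | (root I \notin C) && (#|cut (@ends R I) setT C| == 2)%N].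

Definition link_cut K U : {set {set V}} := cut id K U.

(* A pair l : V * V is the directed link from l.1 to l.2. *)
Definition covers (l : V * V) C : bool := (l.2 \in C) && (l.1 \notin C).

Definition covers_all F : bool :=
  [forall C in ring_cuts, [exists l in F, covers l C]].

Definition directed_solution F : Prop :=
  (forall l, l \in F -> l.1 != l.2) /\ covers_all F.

Definition path_adj : rel V :=
  [rel x y | [exists e : edge I, (e != root_edge I) && (ends e == [set x; y])]].

(* s lies on the u-v path of (V, E \ {e_r}). *)
Definition on_ring_path (u v s : V) : Prop :=
  exists p : seq V,
    [/\ path path_adj u p, last u p = v, uniq (u :: p) & s \in u :: p].

Definition shortening (l l' : V * V) : Prop :=
  [/\ l'.2 = l.2, l'.1 != l.2 & on_ring_path l.1 l.2 l'.1].

Definition strict_shortening (l l' : V * V) : Prop :=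
  shortening l l' /\ l'.1 != l.1.

Definition non_shortenable F : Prop :=
  [/\ directed_solution F,
      forall l, l \in F -> ~~ covers_all (F :\ l) &
      forall l l', l \in F -> strict_shortening l l' ->
        ~~ covers_all (l' |: (F :\ l))].

(* The directed link l lies on the directed path from the root to u in (V, F);
   [zip (root :: p) p] lists the links traversed by the path. *)
Definition on_root_path F (u : V) (l : V * V) : Prop :=
  exists p : seq V,
    [/\ path [rel x y | (x, y) \in F] (root I) p, last (root I) p = u,
        uniq (root I :: p) & l \in zip (root I :: p) p].

Definition responsible F (l : V * V) C : Prop :=
  covers l C /\ forall l', on_root_path F l.1 l' -> ~~ covers l' C.

Definition drop_links F K : {set V * V} :=
  [set l in F | `[< forall C, C \in ring_cuts -> responsible F l C ->
                      link_cut K C != set0 >]].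

Definition laminar_in (S LL : {set {set V}}) : bool :=
  (LL \subset S) &&
  [forall A in LL, forall B in LL,
     [|| [disjoint A & B], A \subset B | B \subset A]].

Definition thin (alpha : nat) K : Prop :=
  exists LL : {set {set V}},
    maxset (laminar_in ring_cuts) LL /\
    forall C, C \in LL -> (#|link_cut K C| <= alpha)%N.

Definition objective F (ct : V * V -> R) K : R :=
  \sum_(l in drop_links F K) ct l - \sum_(l in K) cost l.

Definition maximizer (alpha : nat) F (ct : V * V -> R) K : Prop :=
  [/\ K \subset links I, thin alpha K &
      forall K' : {set {set V}}, K' \subset links I -> thin alpha K' ->
        objective F ct K' <= objective F ct K].

End Wrap.


(* Programs are finite systems of first-order recursive functions over binary
   trees whose leaves are nil or a real number (Jones' language F over LISP
   data, extended with real numbers). Each operation costs one unit: with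
   shared subtrees it is a bounded number of steps of a pointer machine.
   On real numbers only addition, subtraction and comparison are available, and
   0 is the only constant. Hence T steps on rational inputs of bit length b
   only create rationals of length polynomial in T and b, so that polynomially
   many steps also amount to polynomial time on a Turing machine. *)
Inductive data (R : Type) : Type :=
| DNil
| DCons of data R & data R
| DReal of R.
Arguments DNil {R}.

Inductive expr : Type :=
| EVar of nat
| ENil
| ECons of expr & expr
| EHead of expr
| ETail of expr
| EIf of expr & expr & expr
| ELet of expr & expr
| ECall of nat & expr
| EZero
| EAdd of expr & expr
| ESub of expr & expr
| ELe of expr & expr.

(* Function f has body [nth ENil P f] and takes a single argument (tuples are
   passed as trees); function 0 is the main function. *)
Definition program := seq expr.

Section Semantics.
Variable R : realType.

Definition dhead (d : data R) := if d is DCons a _ then a else DNil.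
Definition dtail (d : data R) := if d is DCons _ b then b else DNil.
Definition dreal (d : data R) : R := if d is DReal x then x else 0.
(* nil stands for false, everything else for true *)
Definition dtrue (d : data R) : bool := if d is DNil then false else true.
Definition dbool (b : bool) : data R := if b then DCons DNil DNil else DNil.

(* [eval P env e d t]: in the environment env (de Bruijn indices), the
   expression e evaluates, call by value, to d in t steps. *)
Inductive eval (P : program) : seq (data R) -> expr -> data R -> nat -> Prop :=
| eval_var env i : eval P env (EVar i) (nth DNil env i) 1
| eval_nil env : eval P env ENil DNil 1
| eval_cons env e1 e2 d1 d2 t1 t2 :
    eval P env e1 d1 t1 -> eval P env e2 d2 t2 ->
    eval P env (ECons e1 e2) (DCons d1 d2) (t1 + t2).+1
| eval_head env e d t :
    eval P env e d t -> eval P env (EHead e) (dhead d) t.+1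
| eval_tail env e d t :
    eval P env e d t -> eval P env (ETail e) (dtail d) t.+1
| eval_if env e e1 e2 d d' t t' :
    eval P env e d t -> eval P env (if dtrue d then e1 else e2) d' t' ->
    eval P env (EIf e e1 e2) d' (t + t').+1
| eval_let env e1 e2 d1 d2 t1 t2 :
    eval P env e1 d1 t1 -> eval P (d1 :: env) e2 d2 t2 ->
    eval P env (ELet e1 e2) d2 (t1 + t2).+1
| eval_call env f e d d' t t' :
    eval P env e d t -> eval P [:: d] (nth ENil P f) d' t' ->
    eval P env (ECall f e) d' (t + t').+1
| eval_zero env : eval P env EZero (DReal 0) 1
| eval_add env e1 e2 d1 d2 t1 t2 :
    eval P env e1 d1 t1 -> eval P env e2 d2 t2 ->
    eval P env (EAdd e1 e2) (DReal (dreal d1 + dreal d2)) (t1 + t2).+1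
| eval_sub env e1 e2 d1 d2 t1 t2 :
    eval P env e1 d1 t1 -> eval P env e2 d2 t2 ->
    eval P env (ESub e1 e2) (DReal (dreal d1 - dreal d2)) (t1 + t2).+1
| eval_le env e1 e2 d1 d2 t1 t2 :
    eval P env e1 d1 t1 -> eval P env e2 d2 t2 ->
    eval P env (ELe e1 e2) (dbool (dreal d1 <= dreal d2)) (t1 + t2).+1.

Definition runs (P : program) (x y : data R) (t : nat) : Prop :=
  eval P [:: x] (nth ENil P 0) y t.

Lemma eval_det P env e d1 t1 d2 t2 :
  eval P env e d1 t1 -> eval P env e d2 t2 -> d1 = d2 /\ t1 = t2.
Proof.
move=> H; elim: H d2 t2 => {env e d1 t1}.
all: try by move=> *; match goal with H : eval _ _ _ _ _ |- _ => by inversion H end.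
all: intros; match goal with H : eval _ _ _ _ _ |- _ => inversion H; subst end.
all: repeat match goal with
  | IH : (forall d t, eval _ _ ?e d t -> _ /\ _), H : eval _ _ ?e _ _ |- _ =>
      case: (IH _ _ H) => ? ?; subst; clear H
  end.
all: by [].
Qed.

Fixpoint dsize (d : data R) : nat :=
  if d is DCons a b then (dsize a + dsize b).+1 else 1.

End Semantics.


Section Encoding.
Variable R : realType.

Definition enc_nat (n : nat) : data R := iter n (DCons DNil) DNil.

Definition enc_seq (s : seq (data R)) : data R := foldr (@DCons R) DNil s.

Definition enc_vertex (V : finType) (v : V) : data R := enc_nat (enum_rank v).

Definition enc_pair (V : finType) (p : V * V) : data R :=
  DCons (enc_vertex p.1) (enc_vertex p.2).

Definition unordered (V : finType) (p : V * V) : {set V} := [set p.1; p.2].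

(* s lists the 2-subsets in K, each exactly once, in any order and with the
   two endpoints of each in any order. *)
Definition lists_links (V : finType) (K : {set {set V}}) (s : seq (V * V)) :
    Prop :=
  uniq (map (@unordered V) s) /\ map (@unordered V) s =i K.

(* x encodes the instance I together with F and ct: the number of vertices, the
   list of edges, the root, the position of the root edge in the list of edges,
   the links with their costs, and the directed links with their costs. *)
Definition encodes (I : rooted_wrap R) (F : {set vertex I * vertex I})
    (ct : vertex I * vertex I -> R) (x : data R) : Prop :=
  exists sE sL sF : seq (vertex I * vertex I),
    [/\ map (@unordered _) sE = map (@ends R I) (enum (edge I)),
        lists_links (links I) sL,
        uniq sF /\ sF =i F &
        x = enc_seq
          [:: enc_nat #|vertex I|;
              enc_seq (map (@enc_pair _) sE);
              enc_vertex (root I);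
              enc_nat (enum_rank (root_edge I));
              enc_seq [seq DCons (enc_pair p) (DReal (cost (unordered p)))
                         | p <- sL];
              enc_seq [seq DCons (enc_pair p) (DReal (ct p)) | p <- sF]]].

Definition encodes_links (I : rooted_wrap R) (K : {set {set vertex I}})
    (y : data R) : Prop :=
  exists2 s : seq (vertex I * vertex I),
    lists_links K s & y = enc_seq (map (@enc_pair _) s).

End Encoding.

(* Main.v *)
(** Number the vertices 0, ..., n-1 along the path obtained from the cycle by
    deleting e_r, with the root at 0. Then C_G is the family of intervals
    [i, j] with 0 < i <= j < n, and a maximal laminar family is a binary tree of
    intervals, so that thinness suits a dynamic program over intervals.

    A link (u, v) of F0 is responsible for C iff v is in C and no vertex of the
    path from r to u is. Minimality of F0 gives every vertex at most one
    incoming link, so this path is found by walking backwards from u. Hence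
    (u, v) is dropped iff every interval around v that avoids the path is
    crossed by K, and this happens iff the component of v, in the graph whose
    vertices are the links of K and whose edges join links that cross or share
    an endpoint, has an endpoint that a vertex of the path separates from v.

    To certify this locally, each link of K carries, for the leftmost and for
    the rightmost link t of its component, the label (t, distance to t). A label
    is justified by a neighbour with the same target and smaller distance, and
    following justifications leads to t. If l leaves an interval of the tree in
    which its neighbour m has an endpoint, then l and m both leave this interval
    or one of its subintervals in the tree. So it is enough that a state stores
    the at most alpha links leaving the current interval, with their labels and
    one bit per label telling whether it has been justified. There are
    polynomially many states. *)

(* The labels are guessed, and the two halves of the correctness proof ask different things of them.
   Soundness holds for any labels whose ranks decrease along justifications. If a blocked vertex
   separates the head [v] from an endpoint of a target, an interval around [v] without blocked
   vertices cannot contain that target, so some link on the chain of justifications from a link at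
   [v] to the target leaves the interval. Hence every derivation bounds the objective of its link
   set from below, drops that are not claimed doing no harm because the values [ct] are nonnegative.
   Completeness uses the two extreme links of a component. The hull they span is left by no link of
   [K]: such a link would meet a link of the component and so belong to it. Were the hull free of
   blocked vertices, it would be an uncrossed cut around [v]. This is why two targets per link
   suffice. Drops are decided at the leaf of [v], where all links at [v] are in the state. The
   numbering and the root paths are recomputed by walks over numeric codes, compared with walks over
   vertices by invariance under injective renaming. *)
Require Import Defs.
From mathcomp Require Import all_boot all_order all_algebra.
From mathcomp Require Import zify boolp reals.

Set Implicit Arguments.
Unset Strict Implicit.
Unset Printing Implicit Defensive.

Import Order.TTheory GRing.Theory Num.Theory.

(** * Polynomial-time functions on encoded data *)

Section Polytime.
Variable R : realType.

(** No injectivity is imposed: types share representations, so that a change of type can cost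
    nothing. The instances follow the input format of the theorem and the truth convention of
    [dtrue], with [false], [0], [tt] and [[::]] all encoded as [DNil]. *)
Class encodable (A : Type) := enc : A -> data R.

#[export] Instance unit_encodable : encodable unit := fun=> DNil.
#[export] Instance bool_encodable : encodable bool := @dbool R.
#[export] Instance nat_encodable : encodable nat := @enc_nat R.
#[export] Instance real_encodable : encodable R := @DReal R.
#[export] Instance prod_encodable A B (eA : encodable A) (eB : encodable B) :
  encodable (A * B) := fun p => DCons (eA p.1) (eB p.2).
#[export] Instance seq_encodable A (eA : encodable A) : encodable (seq A) :=
  fun s => enc_seq (map eA s).

Definition esize A {eA : encodable A} (a : A) : nat := dsize (enc a).

Lemma dsize_gt0 (d : data R) : (0 < dsize d)%N.
Proof. by case: d. Qed.

Lemma esize_gt0 A {eA : encodable A} (a : A) : (0 < esize a)%N.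
Proof. exact: dsize_gt0. Qed.

Lemma esize_pair A B {eA : encodable A} {eB : encodable B} (a : A) (b : B) :
  esize (a, b) = (esize a + esize b).+1.
Proof. by []. Qed.

Lemma esize_cons A {eA : encodable A} (a : A) (s : seq A) :
  esize (a :: s) = (esize a + esize s).+1.
Proof. by []. Qed.

Lemma esize_nil A {eA : encodable A} : esize ([::] : seq A) = 1%N.
Proof. by []. Qed.

Lemma esize_nat (n : nat) : esize n = n.*2.+1.
Proof.
rewrite /esize /enc /nat_encodable; elim: n => [//|n IH].
by rewrite [enc_nat _ _]/= [dsize _]/= IH doubleS.
Qed.

Lemma esize_bool (b : bool) : (esize b <= 3)%N.
Proof. by case: b. Qed.

Lemma esize_cat A {eA : encodable A} (s1 s2 : seq A) :
  (esize (s1 ++ s2)).+1 = (esize s1 + esize s2)%N.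
Proof.
elim: s1 => [|a s1 IH]; first by rewrite esize_nil.
rewrite cat_cons !esize_cons; move: IH; set u := esize _; set v := esize _; set w := esize _; lia.
Qed.

Lemma size_esize A {eA : encodable A} (s : seq A) : (size s < esize s)%N.
Proof.
elim: s => [|a s IH] //=.
by rewrite esize_cons; have := esize_gt0 a; lia.
Qed.

Lemma esize_mem (A : eqType) {eA : encodable A} (a : A) s :
  a \in s -> (esize a < esize s)%N.
Proof.
elim: s => // b s IH; rewrite in_cons esize_cons ltnS => /orP[/eqP->|/IH].
  exact: leq_addr.
by move=> h; rewrite (leq_trans (ltnW h)) // leq_addl.
Qed.

Lemma esize_drop A {eA : encodable A} i (s : seq A) :
  (esize (drop i s) <= esize s)%N.
Proof.
elim: s i => [|a s IH] [|i] //=.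
by rewrite esize_cons; have := IH i; lia.
Qed.

Lemma esize_le_sum A {eA : encodable A} (s : seq A) m :
  (forall i a0, (i < size s)%N -> (esize (nth a0 s i) <= m)%N) ->
  (esize s <= (size s * m.+1).+1)%N.
Proof.
elim: s => [|a s IH] // H; rewrite esize_cons /=.
have /= := H 0 a (ltn0Sn _).
have := IH (fun i => H i.+1); lia.
Qed.

(* Exponents of [(esize a).+1], which is at least 2, bound the running times:
   every constant is a power of it, and the bounds compose. *)
Definition poly_bounded A {eA : encodable A} (g : A -> nat) : Prop :=
  exists c, forall a, (g a <= (esize a).+1 ^ c)%N.

Section PolyBounded.
Context {A : Type} {eA : encodable A}.
Implicit Types g h : A -> nat.

Let base_gt1 (a : A) : (1 < (esize a).+1)%N.
Proof. by rewrite ltnS esize_gt0. Qed.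

Lemma poly_bounded_le g h :
  (forall a, g a <= h a)%N -> poly_bounded h -> poly_bounded g.
Proof. by move=> gh [c hc]; exists c => a; exact: leq_trans (gh a) (hc a). Qed.

Lemma poly_bounded_cst k : poly_bounded (fun _ : A => k).
Proof.
exists k => a; apply: leq_trans (ltnW (ltn_expl k (ltnSn 1))) _.
by case: k => // k; rewrite leq_exp2r.
Qed.

Lemma poly_bounded_esize : poly_bounded (fun a : A => esize a).
Proof. by exists 1%N => a; rewrite expn1. Qed.

Lemma poly_bounded_mul g h : poly_bounded g -> poly_bounded h ->
  poly_bounded (fun a => g a * h a)%N.
Proof.
by move=> [c hc] [d hd]; exists (c + d)%N => a; rewrite expnD leq_mul.
Qed.

Lemma poly_bounded_add g h : poly_bounded g -> poly_bounded h ->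
  poly_bounded (fun a => g a + h a)%N.
Proof.
move=> [c hc] [d hd]; exists (c + d).+1 => a; rewrite expnS.
apply: (@leq_trans (2 * (esize a).+1 ^ (c + d))); last by rewrite leq_mul2r base_gt1 orbT.
rewrite mul2n -addnn leq_add //.
- by apply: leq_trans (hc a) _; rewrite leq_exp2l ?leq_addr.
- by apply: leq_trans (hd a) _; rewrite leq_exp2l ?leq_addl.
Qed.

Lemma poly_bounded_exp g k : poly_bounded g -> poly_bounded (fun a => g a ^ k)%N.
Proof.
move=> hg; elim: k => [|k IH]; first exact: (poly_bounded_cst 1).
apply: (poly_bounded_le _ (poly_bounded_mul hg IH)) => a.
by rewrite expnS.
Qed.

Lemma poly_bounded_comp B {eB : encodable B} (f : A -> B) (g : B -> nat) :
  poly_bounded (fun a => esize (f a)) -> poly_bounded g ->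
  poly_bounded (fun a => g (f a)).
Proof.
move=> hf [c hc].
have hf1 := poly_bounded_add hf (poly_bounded_cst 1).
apply: (poly_bounded_le _ (poly_bounded_exp c hf1)) => a.
by rewrite addn1.
Qed.

End PolyBounded.

Definition has_code (prog P : program) (k : nat) : Prop :=
  forall i, (i < size P)%N -> nth ENil prog (k + i) = nth ENil P i.

Lemma has_code_cat prog P Q k : has_code prog (P ++ Q) k ->
  has_code prog P k /\ has_code prog Q (k + size P).
Proof.
move=> H; split=> i hi; first by rewrite H ?nth_cat ?size_cat ?hi ?ltn_addr.
by rewrite -addnA H ?nth_cat ?size_cat ?ltn_add2l // ltnNge leq_addr /= addKn.
Qed.

(* The code is position independent: [P k] is meant to be placed at index [k]
   of the program. *)
Definition polytime A B {eA : encodable A} {eB : encodable B} (f : A -> B) :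
    Prop :=
  poly_bounded (fun a => esize (f a)) /\
  exists (P : nat -> program) (e : nat -> expr) (T : A -> nat),
    poly_bounded T /\
    forall k prog, has_code prog (P k) k -> forall env a,
      exists2 t, eval prog (enc a :: env) (e k) (enc (f a)) t & (t <= T a)%N.

Section Basic.
Context {A B C : Type} {eA : encodable A} {eB : encodable B} {eC : encodable C}.

Lemma polytime_eq (f g : A -> B) : f =1 g -> polytime f -> polytime g.
Proof. by move=> /funext->. Qed.

Lemma polytime_id : polytime (fun a : A => a).
Proof.
split; first exact: poly_bounded_esize.
exists (fun=> [::]), (fun=> EVar 0), (fun=> 1%N); split; first exact: poly_bounded_cst.
by move=> k prog _ env a; exists 1%N => //; exact: eval_var.
Qed.

(** The code of [g] runs below an [ELet], in an environment that still carries the argument of [f];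
    this is why [polytime] quantifies over the tail [env]. The bound on the output size of [f] turns
    the time bound of [g] into one in the size of [a]. *)
Lemma polytime_comp (f : A -> B) (g : B -> C) :
  polytime g -> polytime f -> polytime (fun a => g (f a)).
Proof.
move=> [sg [Pg [eg [Tg [hTg Hg]]]]] [sf [Pf [ef [Tf [hTf Hf]]]]].
split; first exact: (poly_bounded_comp sf sg).
exists (fun k => Pf k ++ Pg (k + size (Pf k))%N),
  (fun k => ELet (ef k) (eg (k + size (Pf k))%N)), (fun a => (Tf a + Tg (f a) + 1)%N).
split.
  apply: poly_bounded_add (poly_bounded_cst 1).
  exact: poly_bounded_add hTf (poly_bounded_comp sf hTg).
move=> k prog /has_code_cat[/Hf{}Hf /Hg{}Hg] env a.
have [t1 e1 l1] := Hf env a; have [t2 e2 l2] := Hg (enc a :: env) (f a).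
exists (t1 + t2).+1; last lia.
exact: eval_let e1 e2.
Qed.

Lemma polytime_pair (f : A -> B) (g : A -> C) :
  polytime f -> polytime g -> polytime (fun a => (f a, g a)).
Proof.
move=> [sf [Pf [ef [Tf [hTf Hf]]]]] [sg [Pg [eg [Tg [hTg Hg]]]]].
split.
  apply: (poly_bounded_le _ (poly_bounded_add (poly_bounded_add sf sg) (poly_bounded_cst 1))) => a.
  by rewrite esize_pair addn1.
exists (fun k => Pf k ++ Pg (k + size (Pf k))%N),
  (fun k => ECons (ef k) (eg (k + size (Pf k))%N)), (fun a => (Tf a + Tg a + 1)%N).
split; first exact: poly_bounded_add (poly_bounded_add hTf hTg) (poly_bounded_cst 1).
move=> k prog /has_code_cat[/Hf{}Hf /Hg{}Hg] env a.
have [t1 e1 l1] := Hf env a; have [t2 e2 l2] := Hg env a.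
exists (t1 + t2).+1; last lia.
exact: eval_cons e1 e2.
Qed.

Lemma polytime_if (b : A -> bool) (f g : A -> B) :
  polytime b -> polytime f -> polytime g ->
  polytime (fun a => if b a then f a else g a).
Proof.
move=> [sb [Pb [eb [Tb [hTb Hb]]]]] [sf [Pf [ef [Tf [hTf Hf]]]]]
  [sg [Pg [eg [Tg [hTg Hg]]]]].
split.
  apply: (poly_bounded_le _ (poly_bounded_add sf sg)) => a.
  by case: (b a); rewrite ?leq_addr ?leq_addl.
exists (fun k => Pb k ++ (Pf (k + size (Pb k))%N ++
   Pg (k + size (Pb k) + size (Pf (k + size (Pb k))%N))%N)),
  (fun k => EIf (eb k) (ef (k + size (Pb k))%N)
    (eg (k + size (Pb k) + size (Pf (k + size (Pb k))%N))%N)),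
  (fun a => (Tb a + (Tf a + Tg a) + 1)%N).
split.
  apply: poly_bounded_add (poly_bounded_cst 1).
  exact: poly_bounded_add hTb (poly_bounded_add hTf hTg).
move=> k prog /has_code_cat[/Hb{}Hb /has_code_cat[/Hf{}Hf /Hg{}Hg]] env a.
have [t e l] := Hb env a.
have [t1 e1 l1] := Hf env a; have [t2 e2 l2] := Hg env a.
case: (b a) in e *.
- by exists (t + t1).+1; [exact: eval_if e e1 | lia].
- by exists (t + t2).+1; [exact: eval_if e e2 | lia].
Qed.

(* Lets an expression without calls act as a map between encodings, whatever
   the types are. *)
Lemma polytime_expr (f : A -> B) (e : expr) (T : nat) :
  poly_bounded (fun a => esize (f a)) ->
  (forall prog env a, eval prog (enc a :: env) e (enc (f a)) T) ->
  polytime f.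
Proof.
move=> sf H; split=> //.
exists (fun=> [::]), (fun=> e), (fun=> T); split; first exact: poly_bounded_cst.
by move=> k prog _ env a; exists T.
Qed.

End Basic.

Lemma eval_fst P env e a b t :
  @eval R P env e (DCons a b) t -> eval P env (EHead e) a t.+1.
Proof. exact: eval_head. Qed.

Lemma eval_snd P env e a b t :
  @eval R P env e (DCons a b) t -> eval P env (ETail e) b t.+1.
Proof. exact: eval_tail. Qed.

Section Foldr.
Context {G A B : Type} {eG : encodable G} {eA : encodable A} {eB : encodable B}.

(** The source of all loops below. A step in polynomial time may still double its accumulator and so
    blow up exponentially; hence the bound [Q] on the accumulator after every suffix of the list. *)
Lemma polytime_foldr (z : G -> B) (s : G -> A -> B -> B) (l : G -> seq A)
    (Q : G -> nat) :
  polytime z -> polytime (fun y : G * (A * B) => s y.1 y.2.1 y.2.2) ->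
  polytime l -> poly_bounded Q ->
  (forall x i, (esize (foldr (s x) (z x) (drop i (l x))) <= Q x)%N) ->
  polytime (fun x => foldr (s x) (z x) (l x)).
Proof.
move=> [sz [Pz [ez [Tz [hTz Hz]]]]] [ss [Ps [es [Ts [[cs hTs] Hs]]]]]
  [sl [Pl [el [Tl [hTl Hl]]]]] hQ HQ.
split; first by apply: (poly_bounded_le _ hQ) => x; have := HQ x 0; rewrite drop0.
pose kz k := k.+1; pose ks k := (kz k + size (Pz (kz k)))%N.
pose kl k := (ks k + size (Ps (ks k)))%N.
pose v0 := EVar 0.
pose body k := EIf (EHead v0)
  (ELet (ECons (ETail v0) (ECons (EHead (EHead v0))
     (ECall k (ECons (ETail (EHead v0)) (ETail v0))))) (es (ks k)))
  (ELet (ETail v0) (ez (kz k))).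
(* [M] bounds one round: 20 covers the fixed overhead of [body], [Tz] the base case, and the power
   the step on [(x, (a, acc))], whose size is dominated by the base of the power. *)
pose (M := fun x : G => (20 + Tz x + (esize x + esize (l x) + Q x + 4) ^ cs)%N).
exists (fun k => [:: body k] ++ (Pz (kz k) ++ (Ps (ks k) ++ Pl (kl k)))),
  (fun k => ECall k (ECons (el (kl k)) v0)),
  (fun x => (Tl x + (esize (l x)) * M x + 4)%N).
have hM : poly_bounded M.
  apply: poly_bounded_add; first exact: poly_bounded_add (poly_bounded_cst _) hTz.
  apply: poly_bounded_exp; apply: poly_bounded_add (poly_bounded_cst _).
  exact: poly_bounded_add (poly_bounded_add poly_bounded_esize sl) hQ.
split.
  apply: poly_bounded_add (poly_bounded_cst _).
  exact: poly_bounded_add hTl (poly_bounded_mul sl hM).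
move=> k prog /has_code_cat[hk /has_code_cat[]].
rewrite [size [:: _]]/= addn1 => /Hz{}Hz /has_code_cat[/Hs{}Hs /Hl{}Hl] env x.
have {}hk : nth ENil prog k = body k by have := hk 0 (ltn0Sn _); rewrite addn0.
have loop l' : (forall i, esize (foldr (s x) (z x) (drop i l')) <= Q x)%N ->
    (esize l' <= esize (l x))%N ->
    exists2 t, eval prog [:: DCons (enc l') (enc x)] (body k)
        (enc (foldr (s x) (z x) l')) t & (t <= (size l').+1 * M x)%N.
  elim: l' => [|a l' IH] hQ' hl'.
    have [t e le] := Hz [:: DCons DNil (enc x)] x.
    exists (2 + (2 + t).+1).+1; last by rewrite /= mul1n /M; lia.
    apply: eval_if; first by apply: eval_fst; exact: eval_var.
    by apply: eval_let e; apply: eval_snd; exact: eval_var.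
  have {IH} [||t e le] := IH; first by move=> i; exact: (hQ' i.+1).
    by rewrite (leq_trans _ hl') // esize_cons; lia.
  set acc := foldr _ _ l' in e le.
  have [t2 e2 le2] := Hs [:: DCons (enc (a :: l')) (enc x)] (x, (a, acc)).
  have le3 : (t2 <= (esize x + esize (l x) + Q x + 4) ^ cs)%N.
    apply: leq_trans (leq_trans le2 (hTs _)) _.
    case: (cs) => // c; rewrite leq_exp2r // !esize_pair.
    have := hQ' 1; rewrite /= drop0 -/acc; rewrite esize_cons in hl'.
    have := esize_gt0 l'; lia.
  eexists.
    apply: eval_if; first by apply: eval_fst; exact: eval_var.
    rewrite /=; apply: eval_let e2.
    apply: eval_cons; first by apply: eval_snd; exact: eval_var.
    apply: eval_cons; first by apply: eval_fst; apply: eval_fst; exact: eval_var.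
    apply: eval_call; last by rewrite hk; exact: e.
    apply: eval_cons; last by apply: eval_snd; exact: eval_var.
    by apply: eval_snd; apply: eval_fst; exact: eval_var.
  rewrite [size _]/= mulSn (_ : (_ + _).+1 = t + t2 + 18)%N; last lia.
  rewrite {1}/M; lia.
have [t e le] := Hl env x.
have [||t' e' le'] := loop (l x); [exact: HQ | by [] |].
exists ((t + 1).+1 + t').+1.
  apply: eval_call; last by rewrite hk; exact: e'.
  by apply: eval_cons e _; exact: eval_var.
have {}le' : (t' <= esize (l x) * M x)%N.
  by rewrite (leq_trans le') // leq_mul2r size_esize orbT.
lia.
Qed.

End Foldr.

Section Primitives.
Context {A B C : Type} {eA : encodable A} {eB : encodable B} {eC : encodable C}.

Lemma polytime_fst (f : A -> B * C) : polytime f -> polytime (fun a => (f a).1).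
Proof.
apply: polytime_comp; apply: (polytime_expr (e := EHead (EVar 0)) (T := 2)).
  apply: (poly_bounded_le _ poly_bounded_esize) => -[b c] /=.
  by rewrite esize_pair; lia.
by move=> prog env [b c]; apply: eval_fst; exact: eval_var.
Qed.

Lemma polytime_snd (f : A -> B * C) : polytime f -> polytime (fun a => (f a).2).
Proof.
apply: polytime_comp; apply: (polytime_expr (e := ETail (EVar 0)) (T := 2)).
  apply: (poly_bounded_le _ poly_bounded_esize) => -[b c] /=.
  by rewrite esize_pair; lia.
by move=> prog env [b c]; apply: eval_snd; exact: eval_var.
Qed.

Lemma polytime_nil : polytime (fun _ : A => ([::] : seq B)).
Proof.
apply: (polytime_expr (e := ENil) (T := 1)); first exact: poly_bounded_cst.
by move=> *; exact: eval_nil.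
Qed.

Lemma polytime_tt : polytime (fun _ : A => tt).
Proof.
apply: (polytime_expr (e := ENil) (T := 1)); first exact: poly_bounded_cst.
by move=> *; exact: eval_nil.
Qed.

Lemma polytime_0 : polytime (fun _ : A => 0%N).
Proof.
apply: (polytime_expr (e := ENil) (T := 1)); first exact: poly_bounded_cst.
by move=> *; exact: eval_nil.
Qed.

Lemma polytime_0r : polytime (fun _ : A => (0 : R)%R).
Proof.
apply: (polytime_expr (e := EZero) (T := 1)); first exact: poly_bounded_cst.
by move=> *; exact: eval_zero.
Qed.

Lemma polytime_bool (b : bool) : polytime (fun _ : A => b).
Proof.
case: b; last first.
  apply: (polytime_expr (e := ENil) (T := 1)); first exact: poly_bounded_cst.
  by move=> *; exact: eval_nil.
apply: (polytime_expr (e := ECons ENil ENil) (T := 3)); first exact: poly_bounded_cst.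
by move=> *; exact: (eval_cons (eval_nil _ _) (eval_nil _ _)).
Qed.

Lemma polytime_cons (f : A -> B) (g : A -> seq B) :
  polytime f -> polytime g -> polytime (fun a => f a :: g a).
Proof.
move=> hf hg.
apply: (polytime_comp (g := fun p : B * seq B => p.1 :: p.2) _ (polytime_pair hf hg)).
apply: (polytime_expr (e := EVar 0) (T := 1)).
  by apply: (poly_bounded_le _ poly_bounded_esize) => -[b c].
by move=> prog env [b c]; exact: eval_var.
Qed.

Lemma polytime_succ (f : A -> nat) : polytime f -> polytime (fun a => (f a).+1).
Proof.
apply: polytime_comp.
apply: (polytime_expr (e := ECons ENil (EVar 0)) (T := 3)).
  apply: (poly_bounded_le _
    (poly_bounded_add poly_bounded_esize (poly_bounded_cst 2))) => n.
  by rewrite !esize_nat; lia.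
by move=> prog env n; exact: (eval_cons (eval_nil _ _) (eval_var _ _ 0)).
Qed.

Lemma polytime_nat (n : nat) : polytime (fun _ : A => n).
Proof.
by elim: n => [|n IH]; [exact: polytime_0 | exact: polytime_succ].
Qed.

(** A unary number is at the same time a list of units, so counting loops become folds without any
    conversion. *)
Lemma enc_nseq (n : nat) : enc (nseq n tt) = enc n.
Proof.
by elim: n => // n IH; rewrite -[enc n.+1]/(DCons DNil (enc n)) -IH.
Qed.

Lemma polytime_nseq (f : A -> nat) :
  polytime f -> polytime (fun a => nseq (f a) tt).
Proof.
apply: (polytime_comp (g := fun n => nseq n tt)).
apply: (polytime_expr (e := EVar 0) (T := 1)).
  by apply: (poly_bounded_le _ poly_bounded_esize) => n; rewrite /esize enc_nseq.
by move=> prog env n; rewrite enc_nseq; exact: eval_var.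
Qed.

Lemma polytime_pred (f : A -> nat) : polytime f -> polytime (fun a => (f a).-1).
Proof.
apply: polytime_comp; apply: (polytime_expr (e := ETail (EVar 0)) (T := 2)).
  apply: (poly_bounded_le _ poly_bounded_esize) => n.
  by rewrite !esize_nat; lia.
by move=> prog env [|n]; [exact: (eval_tail (eval_var _ _ 0)) |
  apply: eval_snd; exact: eval_var].
Qed.

Lemma polytime_behead (f : A -> seq B) :
  polytime f -> polytime (fun a => behead (f a)).
Proof.
apply: polytime_comp; apply: (polytime_expr (e := ETail (EVar 0)) (T := 2)).
  apply: (poly_bounded_le _ poly_bounded_esize) => -[|b s] //=.
  by rewrite esize_cons; lia.
by move=> prog env [|b s]; [exact: (eval_tail (eval_var _ _ 0)) |
  apply: eval_snd; exact: eval_var].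
Qed.

Lemma polytime_is_nil (f : A -> seq B) :
  polytime f -> polytime (fun a => if f a is [::] then true else false).
Proof.
apply: (polytime_comp (g := fun s : seq B => if s is [::] then true else false)).
split.
  by apply: (poly_bounded_le _ (poly_bounded_cst 3)) => s; exact: esize_bool.
exists (fun=> [::]), (fun=> EIf (EVar 0) ENil (ECons ENil ENil)), (fun=> 5%N).
split; first exact: poly_bounded_cst.
move=> k prog _ env [|b s].
  exists (1 + 3).+1 => //; apply: eval_if; first exact: eval_var.
  exact: (eval_cons (eval_nil _ _) (eval_nil _ _)).
by exists (1 + 1).+1 => //; apply: eval_if; [exact: eval_var | exact: eval_nil].
Qed.

Lemma polytime_head (d : A -> B) (f : A -> seq B) :
  polytime d -> polytime f -> polytime (fun a => head (d a) (f a)).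
Proof.
move=> hd hf.
have h : polytime (fun p : B * seq B => head p.1 p.2).
  split.
    apply: (poly_bounded_le _ poly_bounded_esize) => -[b [|c s]] /=;
    by rewrite esize_pair ?esize_cons; lia.
  exists (fun=> [::]), (fun=> EIf (ETail (EVar 0)) (EHead (ETail (EVar 0))) (EHead (EVar 0))),
    (fun=> 6%N).
  split; first exact: poly_bounded_cst.
  move=> k prog _ env [b [|c s]].
    exists (2 + 2).+1 => //; apply: eval_if.
      by apply: eval_snd; exact: eval_var.
    by apply: eval_fst; exact: eval_var.
  exists (2 + 3).+1 => //; apply: eval_if.
    by apply: eval_snd; exact: eval_var.
  by apply: eval_fst; apply: eval_snd; exact: eval_var.
exact: polytime_comp h (polytime_pair hd hf).
Qed.

Lemma polytime_addr (f g : A -> R) :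
  polytime f -> polytime g -> polytime (fun a => f a + g a)%R.
Proof.
move=> hf hg.
apply: (polytime_comp (g := fun p : R * R => (p.1 + p.2)%R) _ (polytime_pair hf hg)).
apply: (polytime_expr (e := EAdd (EHead (EVar 0)) (ETail (EVar 0))) (T := 5)).
  exact: (poly_bounded_cst 1).
move=> prog env [b c]; have ev := eval_var prog (DCons (DReal b) (DReal c) :: env) 0.
exact: (eval_add (@eval_fst _ _ _ (DReal b) (DReal c) _ ev)
  (@eval_snd _ _ _ (DReal b) (DReal c) _ ev)).
Qed.

Lemma polytime_subr (f g : A -> R) :
  polytime f -> polytime g -> polytime (fun a => f a - g a)%R.
Proof.
move=> hf hg.
apply: (polytime_comp (g := fun p : R * R => (p.1 - p.2)%R) _ (polytime_pair hf hg)).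
apply: (polytime_expr (e := ESub (EHead (EVar 0)) (ETail (EVar 0))) (T := 5)).
  exact: (poly_bounded_cst 1).
move=> prog env [b c]; have ev := eval_var prog (DCons (DReal b) (DReal c) :: env) 0.
exact: (eval_sub (@eval_fst _ _ _ (DReal b) (DReal c) _ ev)
  (@eval_snd _ _ _ (DReal b) (DReal c) _ ev)).
Qed.

Lemma polytime_ler (f g : A -> R) :
  polytime f -> polytime g -> polytime (fun a => f a <= g a)%R.
Proof.
move=> hf hg.
apply: (polytime_comp (g := fun p : R * R => (p.1 <= p.2)%R) _ (polytime_pair hf hg)).
apply: (polytime_expr (e := ELe (EHead (EVar 0)) (ETail (EVar 0))) (T := 5)).
  by apply: (poly_bounded_le _ (poly_bounded_cst 3)) => p; exact: esize_bool.
move=> prog env [b c]; have ev := eval_var prog (DCons (DReal b) (DReal c) :: env) 0.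
exact: (eval_le (@eval_fst _ _ _ (DReal b) (DReal c) _ ev)
  (@eval_snd _ _ _ (DReal b) (DReal c) _ ev)).
Qed.

End Primitives.

Section Bool.
Context {A : Type} {eA : encodable A}.
Implicit Types f g : A -> bool.

Lemma polytime_and f g :
  polytime f -> polytime g -> polytime (fun a => f a && g a).
Proof. by move=> hf hg; exact: (polytime_if hf hg (polytime_bool false)). Qed.

Lemma polytime_or f g :
  polytime f -> polytime g -> polytime (fun a => f a || g a).
Proof. by move=> hf hg; exact: (polytime_if hf (polytime_bool true) hg). Qed.

Lemma polytime_not f : polytime f -> polytime (fun a => ~~ f a).
Proof.
by move=> hf; exact: (polytime_if hf (polytime_bool false) (polytime_bool true)).
Qed.

Lemma polytime_imply f g :
  polytime f -> polytime g -> polytime (fun a => f a ==> g a).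
Proof. by move=> hf hg; exact: (polytime_if hf hg (polytime_bool true)). Qed.

Lemma polytime_addb f g :
  polytime f -> polytime g -> polytime (fun a => f a (+) g a).
Proof.
move=> hf hg; apply: (polytime_eq _ (polytime_if hf (polytime_not hg) hg)) => a.
by case: (f a).
Qed.

End Bool.

Section Cat.
Context {G A : Type} {eG : encodable G} {eA : encodable A}.

Lemma polytime_cat (f g : G -> seq A) :
  polytime f -> polytime g -> polytime (fun x => f x ++ g x).
Proof.
move=> hf hg; have [sf _] := hf; have [sg _] := hg.
apply: (@polytime_eq _ _ _ _ (fun x => foldr (fun a s => a :: s) (g x) (f x))).
  by move=> x; elim: (f x) => //= a s ->.
apply: (polytime_foldr (Q := fun x => esize (f x) + esize (g x))%N) => //.
- apply: polytime_cons; first by apply/polytime_fst/polytime_snd/polytime_id.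
  by apply/polytime_snd/polytime_snd/polytime_id.
- exact: poly_bounded_add.
move=> x i; rewrite (_ : foldr _ _ _ = drop i (f x) ++ g x); last first.
  by elim: (drop i (f x)) => //= a s ->.
by rewrite ltnW // esize_cat leq_add2r esize_drop.
Qed.

End Cat.

Section Flatmap.
Context {G A B : Type} {eG : encodable G} {eA : encodable A} {eB : encodable B}.

Lemma polytime_flatmap (f : G -> A -> seq B) (l : G -> seq A) :
  polytime (fun y : G * A => f y.1 y.2) -> polytime l ->
  polytime (fun x => flatten [seq f x a | a <- l x]).
Proof.
move=> hf hl; have [[c sf] _] := hf; have [sl _] := hl.
apply: (@polytime_eq _ _ _ _ (fun x => foldr (fun a s => f x a ++ s) [::] (l x))).
  by move=> x; elim: (l x) => //= a s ->.
apply: (polytime_foldr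
  (Q := fun x => esize (l x) * (esize x + esize (l x) + 2) ^ c + 1)%N) => //.
- exact: polytime_nil.
- apply: polytime_cat; last by apply/polytime_snd/polytime_snd/polytime_id.
  apply: (polytime_comp (f := fun y : G * (A * seq B) => (y.1, y.2.1))
    (g := fun y => f y.1 y.2)) => //.
  apply: polytime_pair; first by apply/polytime_fst/polytime_id.
  by apply/polytime_fst/polytime_snd/polytime_id.
- apply: poly_bounded_add (poly_bounded_cst 1); apply: poly_bounded_mul => //.
  apply: poly_bounded_exp; apply: poly_bounded_add (poly_bounded_cst 2).
  exact: poly_bounded_add poly_bounded_esize sl.
move=> x i; apply: (@leq_trans (esize (drop i (l x)) * (esize x + esize (l x) + 2) ^ c + 1)).
  have := @esize_drop A eA i (l x); elim: (drop i (l x)) => [|a s IH].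
    by rewrite /= [esize _]esize_nil leq_addl.
  rewrite esize_cons /= => hs.
  have {}IH := IH (leq_trans (leq_addl _ _) (ltnW hs)).
  have h1 : (esize (f x a) <= (esize x + esize (l x) + 2) ^ c)%N.
    apply: leq_trans (sf (x, a)) _; rewrite esize_pair.
    case: (c) => // d; rewrite leq_exp2r //; lia.
  rewrite -ltnS esize_cat mulSn mulnDl.
  apply: (@leq_trans ((esize x + esize (l x) + 2) ^ c +
    (esize s * (esize x + esize (l x) + 2) ^ c + 1))); first exact: leq_add.
  by rewrite -addnS addnA; move: (_ ^ c)%N => m; lia.
by rewrite leq_add2r leq_mul2r esize_drop orbT.
Qed.

End Flatmap.

Section Lists.
Context {G A B : Type} {eG : encodable G} {eA : encodable A} {eB : encodable B}.

Lemma polytime_map (f : G -> A -> B) (l : G -> seq A) :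
  polytime (fun y : G * A => f y.1 y.2) -> polytime l ->
  polytime (fun x => [seq f x a | a <- l x]).
Proof.
move=> hf hl.
apply: (@polytime_eq _ _ _ _ (fun x => flatten [seq [:: f x a] | a <- l x])).
  by move=> x; elim: (l x) => //= a s ->.
apply: (polytime_flatmap (f := fun x a => [:: f x a])) => //.
by apply: polytime_cons => //; exact: polytime_nil.
Qed.

Lemma polytime_filter (p : G -> pred A) (l : G -> seq A) :
  polytime (fun y : G * A => p y.1 y.2) -> polytime l ->
  polytime (fun x => [seq a <- l x | p x a]).
Proof.
move=> hp hl.
apply: (@polytime_eq _ _ _ _
    (fun x => flatten [seq if p x a then [:: a] else [::] | a <- l x])).
  by move=> x; elim: (l x) => //= a s ->; case: ifP.
apply: (polytime_flatmap (f := fun x a => if p x a then [:: a] else [::])) => //.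
rewrite /=; apply: polytime_if => //; last exact: polytime_nil.
by apply: polytime_cons; [exact/polytime_snd/polytime_id | exact: polytime_nil].
Qed.

Lemma polytime_has (p : G -> pred A) (l : G -> seq A) :
  polytime (fun y : G * A => p y.1 y.2) -> polytime l ->
  polytime (fun x => has (p x) (l x)).
Proof.
move=> hp hl.
apply: (@polytime_eq _ _ _ _ (fun x => foldr (fun a b => p x a || b) false (l x))).
  by move=> x; elim: (l x) => //= a s ->.
apply: (polytime_foldr (Q := fun=> 3%N)) => //; first exact: polytime_bool.
- apply: polytime_or; last by apply/polytime_snd/polytime_snd/polytime_id.
  apply: (polytime_comp (f := fun y : G * (A * bool) => (y.1, y.2.1))
    (g := fun y => p y.1 y.2)) => //.
  apply: polytime_pair; first by apply/polytime_fst/polytime_id.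
  by apply/polytime_fst/polytime_snd/polytime_id.
- exact: poly_bounded_cst.
by move=> x i; exact: esize_bool.
Qed.

Lemma polytime_all (p : G -> pred A) (l : G -> seq A) :
  polytime (fun y : G * A => p y.1 y.2) -> polytime l ->
  polytime (fun x => all (p x) (l x)).
Proof.
move=> hp hl.
apply: (@polytime_eq _ _ _ _ (fun x => ~~ has (fun a => ~~ p x a) (l x))).
  by move=> x; rewrite -all_predC; apply: eq_all => a /=; rewrite negbK.
by apply/polytime_not/polytime_has => //; exact: polytime_not.
Qed.

Lemma polytime_size (l : G -> seq A) :
  polytime l -> polytime (fun x => size (l x)).
Proof.
move=> hl; have [sl _] := hl.
apply: (polytime_foldr (z := fun=> 0%N) (s := fun _ _ n => n.+1)
  (Q := fun x => (esize (l x)).*2.+1)) => //.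
- exact: polytime_0.
- by apply/polytime_succ/polytime_snd/polytime_snd/polytime_id.
- apply: (poly_bounded_le _ (poly_bounded_add (poly_bounded_add sl sl) (poly_bounded_cst 1))).
  by move=> x; rewrite addn1 addnn.
move=> x i; rewrite -[foldr _ _ _]/(size _) esize_nat ltnS leq_double.
exact: leq_trans (ltnW (size_esize _)) (esize_drop _ _).
Qed.

Lemma polytime_sumr (f : G -> A -> R) (l : G -> seq A) :
  polytime (fun y : G * A => f y.1 y.2) -> polytime l ->
  polytime (fun x => \sum_(a <- l x) f x a)%R.
Proof.
move=> hf hl.
apply: (@polytime_eq _ _ _ _ (fun x => foldr (fun a b => f x a + b)%R 0%R (l x))).
  by move=> x; elim: (l x) => [|a s IH]; rewrite ?big_nil ?big_cons //= IH.
apply: (polytime_foldr (Q := fun=> 1%N)) => //; first exact: polytime_0r.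
- apply: polytime_addr; last by apply/polytime_snd/polytime_snd/polytime_id.
  apply: (polytime_comp (f := fun y : G * (A * R) => (y.1, y.2.1)) (g := fun y => f y.1 y.2)) => //.
  apply: polytime_pair; first by apply/polytime_fst/polytime_id.
  by apply/polytime_fst/polytime_snd/polytime_id.
- exact: poly_bounded_cst.
Qed.

Lemma polytime_iter (n : G -> nat) (s : G -> B -> B) (z : G -> B) (Q : G -> nat) :
  polytime n -> polytime (fun y : G * B => s y.1 y.2) -> polytime z ->
  poly_bounded Q ->
  (forall x i, (i <= n x)%N -> (esize (iter i (s x) (z x)) <= Q x)%N) ->
  polytime (fun x => iter (n x) (s x) (z x)).
Proof.
move=> hn hs hz hQ HQ.
have iterE x i : iter i (s x) (z x) = foldr (fun _ => s x) (z x) (nseq i tt).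
  by elim: i => //= i ->.
apply: (@polytime_eq _ _ _ _ (fun x => foldr (fun _ => s x) (z x) (nseq (n x) tt))).
  by move=> x; rewrite iterE.
apply: (polytime_foldr (Q := Q)) => //.
- apply: (polytime_comp (f := fun y : G * (unit * B) => (y.1, y.2.2))
    (g := fun y => s y.1 y.2)) => //.
  apply: polytime_pair; first by apply/polytime_fst/polytime_id.
  by apply/polytime_snd/polytime_snd/polytime_id.
- exact: polytime_nseq.
by move=> x i; rewrite drop_nseq -iterE; apply: HQ; exact: leq_subr.
Qed.

End Lists.

Section Arith.
Context {G : Type} {eG : encodable G}.

Lemma polytime_sub (f g : G -> nat) :
  polytime f -> polytime g -> polytime (fun x => f x - g x)%N.
Proof.
move=> hf hg; have [sf _] := hf.
have subE m n : iter n predn m = (m - n)%N.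
  by elim: n => [|n IH]; rewrite ?subn0 //= IH subnS.
apply: (@polytime_eq _ _ _ _ (fun x => iter (g x) predn (f x))) => [x|]; first exact: subE.
apply: (polytime_iter (s := fun _ => predn) (Q := fun x => esize (f x))) => //.
  by apply/polytime_pred/polytime_snd/polytime_id.
by move=> x i _; rewrite subE !esize_nat; lia.
Qed.

Lemma polytime_leq (f g : G -> nat) :
  polytime f -> polytime g -> polytime (fun x => f x <= g x)%N.
Proof.
move=> hf hg; have h := polytime_sub hf hg.
apply: (@polytime_eq _ _ _ _ (fun x => if nseq (f x - g x)%N tt is [::] then true else false)).
  by move=> x; rewrite -subn_eq0; case: (_ - _)%N.
exact/polytime_is_nil/polytime_nseq.
Qed.

End Arith.

Definition polytime_eqType (A : eqType) {eA : encodable A} : Prop :=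
  polytime (fun p : A * A => p.1 == p.2).

Lemma polytime_eqn : @polytime_eqType nat _.
Proof.
apply: (@polytime_eq _ _ _ _ (fun p : nat * nat => (p.1 <= p.2)%N && (p.2 <= p.1)%N)).
  by move=> p; rewrite eqn_leq.
have p1 : polytime (fun p : nat * nat => p.1) by exact/polytime_fst/polytime_id.
have p2 : polytime (fun p : nat * nat => p.2) by exact/polytime_snd/polytime_id.
exact: (polytime_and (polytime_leq p1 p2) (polytime_leq p2 p1)).
Qed.

Lemma polytime_eq_prod (A B : eqType) {eA : encodable A} {eB : encodable B} :
  @polytime_eqType A _ -> @polytime_eqType B _ -> @polytime_eqType (A * B)%type _.
Proof.
move=> hA hB.
apply: (@polytime_eq _ _ _ _
    (fun p : (A * B) * (A * B) => (p.1.1 == p.2.1) && (p.1.2 == p.2.2))).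
  by move=> [[a b] [c d]].
apply: polytime_and.
  apply: (polytime_comp (f := fun p : (A * B) * (A * B) => (p.1.1, p.2.1)) hA).
  by apply: polytime_pair; [apply/polytime_fst/polytime_fst/polytime_id |
    apply/polytime_fst/polytime_snd/polytime_id].
apply: (polytime_comp (f := fun p : (A * B) * (A * B) => (p.1.2, p.2.2)) hB).
by apply: polytime_pair; [apply/polytime_snd/polytime_fst/polytime_id |
  apply/polytime_snd/polytime_snd/polytime_id].
Qed.

Lemma polytime_eqop (G : Type) (A : eqType) {eG : encodable G} {eA : encodable A}
    (f g : G -> A) :
  @polytime_eqType A _ -> polytime f -> polytime g ->
  polytime (fun x => f x == g x).
Proof.
by move=> hA hf hg; exact: (polytime_comp (f := fun x => (f x, g x)) hA (polytime_pair hf hg)).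
Qed.

Lemma polytime_program (A B : Type) {eA : encodable A} {eB : encodable B}
    (f : A -> B) : polytime f ->
  exists (P : program) (k : nat), forall a,
    exists2 t, runs P (enc a) (enc (f a)) t & (t <= k * esize a ^ k + k)%N.
Proof.
(* Execution starts at function 0, so the main expression goes to index 0 and its code to index 1.
   The single constant [2 ^ c] serves as the factor in [(s + 1) ^ c <= 2 ^ c * s ^ c], valid since
   sizes are positive, and as the exponent, since [c <= 2 ^ c]. *)
move=> [_ [P [e [T [[c hT] H]]]]]; exists (e 1%N :: P 1%N), (2 ^ c)%N => a.
have [//|t ev le] := H 1%N (e 1%N :: P 1%N) _ [::] a.
exists t => //; apply: leq_trans (leq_trans le (hT a)) _; apply: leq_trans (leq_addr _ _).
apply: (@leq_trans ((2 * esize a) ^ c)%N).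
  case: (c) => // d; rewrite leq_exp2r //.
  by rewrite mul2n -addnn -addn1 leq_add2l esize_gt0.
rewrite expnMn leq_mul2l; apply/orP; right.
by rewrite leq_pexp2l ?esize_gt0 // ltnW // ltn_expl.
Qed.

End Polytime.

(** A hook: it is redefined with [::=] once the definitions exist that [ptime] has to unfold. *)
Ltac ptime_user := fail.

(** The recursion follows the head symbol of the function body. The final [idtac] leaves open what
    no rule covers, in particular the loops that need a size bound. *)
Ltac ptime :=
  cbv beta;
  lazymatch goal with
  | |- polytime (fun _ => _) => idtac
  | |- polytime ?f => change (polytime (fun x => f x))
  | _ => idtac
  end;
  match goal with
  | |- polytime (fun x => x) => apply polytime_id
  | |- polytime (fun x => (@?f x).1) => apply (polytime_fst (f := f)); ptime
  | |- polytime (fun x => (@?f x).2) => apply (polytime_snd (f := f)); ptime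
  | |- polytime (fun x => (@?f x, @?g x)) => apply (polytime_pair (f := f) (g := g)); ptime
  | |- polytime (fun x => [::]) => apply polytime_nil
  | |- polytime (fun x => @?f x :: @?g x) => apply (polytime_cons (f := f) (g := g)); ptime
  | |- polytime (fun x => true) => apply polytime_bool
  | |- polytime (fun x => false) => apply polytime_bool
  | |- polytime (fun x => 0%N) => apply polytime_0
  | |- polytime (fun x => ?n) => apply (polytime_nat n)
  | |- polytime (fun x => 0%R) => apply polytime_0r
  | |- polytime (fun x => S (@?f x)) => apply (polytime_succ (f := f)); ptime
  | |- polytime (fun x => @?f x && @?g x) => apply (polytime_and (f := f) (g := g)); ptime
  | |- polytime (fun x => @?f x || @?g x) => apply (polytime_or (f := f) (g := g)); ptime
  | |- polytime (fun x => ~~ @?f x) => apply (polytime_not (f := f)); ptime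
  | |- polytime (fun x => @?f x ==> @?g x) => apply (polytime_imply (f := f) (g := g)); ptime
  | |- polytime (fun x => @?f x (+) @?g x) => apply (polytime_addb (f := f) (g := g)); ptime
  | |- polytime (fun x => (@?f x <= @?g x)%N) => apply (polytime_leq (f := f) (g := g)); ptime
  | |- polytime (fun x => (@?f x - @?g x)%N) => apply (polytime_sub (f := f) (g := g)); ptime
  | |- polytime (fun x => (@?f x - @?g x)%R) => apply (polytime_subr (f := f) (g := g)); ptime
  | |- polytime (fun x => (@?f x + @?g x)%R) => apply (polytime_addr (f := f) (g := g)); ptime
  | |- polytime (fun x => (@?f x <= @?g x)%R) => apply (polytime_ler (f := f) (g := g)); ptime
  | |- polytime (fun x => @?f x == @?g x) => apply (polytime_eqop (f := f) (g := g)); ptime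
  | |- @polytime_eqType _ _ _ => first [exact: polytime_eqn | apply: polytime_eq_prod; ptime]
  | |- polytime (fun x => @?f x ++ @?g x) => apply (polytime_cat (f := f) (g := g)); ptime
  | |- polytime (fun x => behead (@?f x)) => apply (polytime_behead (f := f)); ptime
  | |- polytime (fun x => size (@?f x)) => apply (polytime_size (l := f)); ptime
  | |- polytime (fun x => head (@?d x) (@?f x)) =>
      apply (polytime_head (d := d) (f := f)); ptime
  | |- polytime (fun x => flatten (map (@?f x) (@?l x))) =>
      apply (polytime_flatmap (f := f) (l := l)); ptime
  | |- polytime (fun x => map (@?f x) (@?l x)) => apply (polytime_map (f := f) (l := l)); ptime
  | |- polytime (fun x => filter (@?f x) (@?l x)) =>
      apply (polytime_filter (p := f) (l := l)); ptime
  | |- polytime (fun x => has (@?f x) (@?l x)) => apply (polytime_has (p := f) (l := l)); ptime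
  | |- polytime (fun x => all (@?f x) (@?l x)) => apply (polytime_all (p := f) (l := l)); ptime
  | |- polytime (fun x => \sum_(a <- @?l x) @?f x a)%R =>
      apply (polytime_sumr (f := f) (l := l)); ptime
  | _ => first [assumption | ptime_user; ptime | simple apply polytime_if; ptime | idtac]
  end.

(** * The dynamic program over intervals *)

Notation link := (nat * nat)%type.
Notation entry := (link * link * nat * bool)%type.
Notation state := (seq entry).
Notation key := (nat * nat * state)%type.

Definition inside (i j x : nat) : bool := (i <= x) && (x <= j).
Definition inner (i j : nat) (l : link) : bool := inside i j l.1 && inside i j l.2.
Definition leaves (i j : nat) (l : link) : bool := inside i j l.1 (+) inside i j l.2.

(* For l.1 < l.2 and m.1 < m.2: the chords l and m of the cycle share an
   endpoint or cross. *)
Definition meets (l m : link) : bool :=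
  (l.1 <= m.1) && (m.1 <= l.2) && (l.2 <= m.2) ||
  (m.1 <= l.1) && (l.1 <= m.2) && (m.2 <= l.2).

(** The case [y = x] is included and [y = v] is not: an interval that contains [v] and [x] then
    contains every [y] that separates them. *)
Definition separates (v x y : nat) : bool :=
  (v < y) && (y <= x) || (x <= y) && (y < v).

(* An entry (l, t, d, b) claims that l is at distance d from the link t of its
   component; b tells whether a neighbour of l closer to t has been seen. *)
Definition ent_link (e : entry) : link := e.1.1.1.
Definition ent_target (e : entry) : link := e.1.1.2.
Definition ent_rank (e : entry) : nat := e.1.2.
Definition ent_done (e : entry) : bool := e.2.

Definition uses (S : state) (l : link) : bool := has (fun e => ent_link e == l) S.

(** Ranks need not be true distances: strict decrease alone rules out circular justifications and
    makes the chain end at the target. *)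
Definition witnessed (S : state) (e : entry) : bool :=
  (ent_target e == ent_link e) ||
  has (fun f => (ent_target f == ent_target e) && (ent_rank f < ent_rank e) &&
                meets (ent_link e) (ent_link f)) S.

Section Program.
Variables (R : realType) (alpha : nat).

Notation cand := (R * seq link)%type.
Notation inst := (nat * (seq (link * R) * seq (nat * seq nat * R)))%type.
Notation table := (seq (key * cand)).

Definition upto (n : nat) : seq nat := iter n (fun s => size s :: s) [::].

(** Ranks below [n * n] suffice, because distances are smaller than the number of links and
    [card_links] bounds the latter. The product is obtained as the length of a list of pairs, since
    multiplication is not among the combinators above. *)
Definition alphabet (n : nat) (L : seq (link * R)) : seq entry :=
  flatten [seq flatten [seq flatten [seq [seq (l.1, m.1, d, b) | b <- [:: true; false]]
    | d <- upto (size (flatten [seq [seq tt | j <- upto n] | i <- upto n]))]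
    | m <- L] | l <- L].

(** Called with the constant length [alpha + alpha], so the number of words is polynomial in the
    size of [A], with a degree that depends on [alpha]. *)
Fixpoint words (A : seq entry) (m : nat) : seq state :=
  if m is m'.+1 then [::] :: flatten [seq [seq e :: w | w <- words A m'] | e <- A]
  else [:: [::]].

(** The count runs over the links of the instance and not over the entries, because thinness counts
    a link once even if several labels of it are stored. *)
Definition valid (L : seq (link * R)) (k : key) : bool :=
  all (fun e => leaves k.1.1 k.1.2 (ent_link e)) k.2 &&
  (size [seq l <- L | uses k.2 l.1] <= alpha).

(* Each of the at most alpha links leaving an interval has two labels. *)
Definition universe (x : inst) : seq key :=
  [seq k <- flatten [seq flatten [seq [seq (i, j, w)
      | w <- words (alphabet x.1 x.2.1) (alpha + alpha)%N]
      | j <- upto x.1] | i <- upto x.1] | valid x.2.1 k].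

Definition leaf_ok (k : key) : bool :=
  (k.1.1 == k.1.2) && all (fun e => ent_done e ==> witnessed k.2 e) k.2.

(** An entry whose link becomes inner disappears at this merge, which is the last moment to check
    it: the other half [B] must hold the same label, and one of the two must have seen a
    justification. All other entries go on to the parent [S]. *)
Definition forwards (i j : nat) (A B S : state) : bool :=
  all (fun e => if inner i j (ent_link e)
         then has (fun f => (f.1 == e.1) && (ent_done e || ent_done f)) B
         else has (fun f => f.1 == e.1) S) A.

(** The last clause reads from the parent to the halves: no entry is invented, and a bit is either
    inherited or backed by a justification in the parent state. *)
Definition merge_ok (k1 k2 k : key) : bool :=
  [&& k.1.1 == k1.1.1, k.1.2 == k2.1.2, k2.1.1 == k1.1.2.+1,
      forwards k.1.1 k.1.2 k1.2 k2.2 k.2, forwards k.1.1 k.1.2 k2.2 k1.2 k.2 &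
      all (fun e => has (fun f => (f.1 == e.1) &&
             (ent_done e ==> ent_done f || witnessed k.2 e)) (k1.2 ++ k2.2)) k.2].

Definition final_ok (n : nat) (k : key) : bool :=
  (k.1.1 == 1%N) && (k.1.2.+1 == n) && all ent_done k.2.

(** Evaluated at the singleton of the head of a directed link. All links of [K] at this vertex leave
    the singleton, so the state holds the labels of their component. [f.1.2] lists the vertices that
    a cut must avoid. *)
Definition claims (k : key) (f : nat * seq nat * R) : bool :=
  (f.1.1 == k.1.1) && has (fun e => has (separates k.1.1 (ent_target e).1) f.1.2 ||
                                    has (separates k.1.1 (ent_target e).2) f.1.2) k.2.

Definition pays (k : key) (l : link * R) : bool := (l.1.2 == k.1.1) && uses k.2 l.1.

(* Each link is paid for at the leaf of its larger endpoint, which is never the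
   root. *)
Definition leaf_cand (x : inst) (k : key) : cand :=
  ((\sum_(f <- [seq f <- x.2.2 | claims k f]) f.2
    - \sum_(l <- [seq l <- x.2.1 | pays k l]) l.2)%R,
   [seq l.1 | l <- [seq l <- x.2.1 | pays k l]]).

(** A list of length at most one plays the role of an option; the emptiness test is a boolean so
    that [polytime_is_nil] and [polytime_if] apply. *)
Definition best (cs : seq cand) : seq cand :=
  foldr (fun c acc => if (if acc is [::] then true else false) then [:: c]
    else if ((head (0%R, [::]) acc).1 <= c.1)%R then [:: c] else acc) [::] cs.

Definition candidates (x : inst) (T : table) (k : key) : seq cand :=
  (if leaf_ok k then [:: leaf_cand x k] else [::]) ++
  flatten [seq flatten [seq if merge_ok p.1 q.1 k
      then [:: ((p.2.1 + q.2.1)%R, p.2.2 ++ q.2.2)] else [::] | q <- T] | p <- T].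

Definition step (x : inst) (T : table) : table :=
  flatten [seq [seq (k, c) | c <- best (candidates x T k)] | k <- universe x].

(** [x.1] rounds suffice: an interval [[i, j]] is settled after [j - i + 1] rounds, as its halves
    are shorter. *)
Definition solve (x : inst) : seq link :=
  (head (0%R, [::]) (best [seq p.2 | p <- [seq p <- iter x.1 (step x) [::] | final_ok x.1 p.1]])).2.

(** The dynamic program without pruning. Correctness is proved for these derivations;
    [table_derivable] and [table_complete] relate them to the table, which keeps only one candidate
    per key. *)
Inductive derivable (x : inst) : key -> cand -> Prop :=
| derivable_leaf k :
    k \in universe x -> leaf_ok k -> derivable x k (leaf_cand x k)
| derivable_merge k1 k2 k c1 c2 :
    k \in universe x -> derivable x k1 c1 -> derivable x k2 c2 ->
    merge_ok k1 k2 k -> derivable x k ((c1.1 + c2.1)%R, c1.2 ++ c2.2).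

Lemma mem_upto n i : (i \in upto n) = (i < n).
Proof.
have szu m : size (upto m) = m by elim: m => //= m ->.
elim: n => [|n IH]; first by rewrite ltn0.
by rewrite [upto _]/= in_cons IH szu ltnS [RHS]leq_eqVlt.
Qed.

Lemma mem_alphabet n L (e : entry) :
  (e \in alphabet n L) = [&& ent_link e \in [seq l.1 | l <- L],
    ent_target e \in [seq l.1 | l <- L] & ent_rank e < n * n].
Proof.
have szf : size (flatten [seq [seq tt | j <- upto n] | i <- upto n]) = (n * n)%N.
  have szu m : size (upto m) = m by elim: m => //= m ->.
  by rewrite (size_allpairs (fun _ _ => tt)) szu.
case: e => [[[l m] d] b]; rewrite /alphabet szf /ent_link /ent_target /ent_rank /=.
apply/flatten_mapP/and3P => [[l' hl' /flatten_mapP[m' hm' /flatten_mapP[d' hd']]]|[hl hm hd]].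
  by rewrite !inE => /orP[] /eqP[-> -> -> _]; rewrite -mem_upto; split=> //; exact: map_f.
move: hl hm => /mapP[l' hl' ->] /mapP[m' hm' ->].
exists l' => //; apply/flatten_mapP; exists m' => //; apply/flatten_mapP.
by exists d; rewrite ?mem_upto // !inE; case: b; rewrite eqxx ?orbT.
Qed.

Lemma mem_words A m (w : state) :
  (w \in words A m) = all (mem A) w && (size w <= m).
Proof.
elim: m w => [|m IH] [|e w] //=; first by rewrite andbF.
rewrite in_cons /= ltnS; apply/flatten_mapP/andP.
  by move=> [e' he' /mapP[w' hw' [-> ->]]]; move: hw'; rewrite IH he' => /andP[-> ->].
move=> [/andP[he hw] hs]; exists e => //; apply/mapP; exists w => //.
by rewrite IH hw.
Qed.

Lemma mem_universe x (k : key) :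
  (k \in universe x) = [&& k.1.1 < x.1, k.1.2 < x.1,
    all (mem (alphabet x.1 x.2.1)) k.2, size k.2 <= alpha + alpha & valid x.2.1 k].
Proof.
case: k => [[i j] S]; rewrite mem_filter /= andbC; case: valid; rewrite ?andbF ?andbT //=.
rewrite -mem_words -!mem_upto; apply/flatten_mapP/and3P.
  by move=> [i' hi /flatten_mapP[j' hj /mapP[S' hS [-> -> ->]]]].
move=> [hi hj hS]; exists i => //; apply/flatten_mapP; exists j => //.
by apply/mapP; exists S.
Qed.

Lemma best_spec (cs : seq cand) :
  (cs = [::] /\ best cs = [::]) \/
  exists2 c, best cs = [:: c] & c \in cs /\ forall c', c' \in cs -> (c'.1 <= c.1)%R.
Proof.
elim: cs => [|c cs IH]; [by left | right] => /=.
case: IH => [[-> ->]|[b -> [hb hmax]]] /=.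
  by exists c => //; rewrite inE eqxx; split=> // c'; rewrite inE => /eqP->.
case: ifP => hc.
  exists c => //; rewrite inE eqxx; split=> // c'; rewrite inE => /orP[/eqP->//|/hmax h].
  exact: le_trans h hc.
exists b => //; rewrite inE hb orbT; split=> // c'; rewrite inE => /orP[/eqP->|/hmax//].
by apply/ltW; rewrite real_ltNge ?num_real // hc.
Qed.

Lemma candidatesP x T k c : reflect
  ((leaf_ok k /\ c = leaf_cand x k) \/
   exists p q, [/\ p \in T, q \in T, merge_ok p.1 q.1 k &
                   c = ((p.2.1 + q.2.1)%R, p.2.2 ++ q.2.2)])
  (c \in candidates x T k).
Proof.
rewrite mem_cat; apply: (iffP orP) => -[].
- by case: ifP => // h; rewrite inE => /eqP->; left.
- move=> /flatten_mapP[p hp /flatten_mapP[q hq]].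
  by case: ifP => // h; rewrite inE => /eqP->; right; exists p, q.
- by move=> [-> ->]; left; rewrite inE.
- move=> [p [q [hp hq h ->]]]; right; apply/flatten_mapP; exists p => //.
  by apply/flatten_mapP; exists q => //; rewrite h inE.
Qed.

Lemma mem_step x T k c : ((k, c) \in step x T) ->
  [/\ k \in universe x, c \in candidates x T k &
     forall c', c' \in candidates x T k -> (c'.1 <= c.1)%R].
Proof.
move=> /flatten_mapP[k' hk' /mapP[c' hc' [-> ->]]].
by case: (best_spec (candidates x T k')) hc' => [[_ ->]//|[b ->]]; rewrite inE => -[h1 h2] /eqP->.
Qed.

Lemma table_derivable x m p : p \in iter m (step x) [::] -> derivable x p.1 p.2.
Proof.
elim: m p => //= m IH [k c] /mem_step[hk].
move=> /candidatesP[[h ->]|[p [q [/IH hp /IH hq h ->]]]] _; first exact: derivable_leaf.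
exact: derivable_merge h.
Qed.

Lemma derivable_universe x k c : derivable x k c -> k \in universe x.
Proof. by case. Qed.

Lemma merge_okE (k1 k2 k : key) : merge_ok k1 k2 k ->
  [/\ k.1.1 = k1.1.1, k.1.2 = k2.1.2 & k2.1.1 = k1.1.2.+1].
Proof. by rewrite /merge_ok => /and5P[/eqP-> /eqP-> /eqP-> _ _]. Qed.

Lemma derivable_le x k c : derivable x k c -> k.1.1 <= k.1.2.
Proof.
elim=> {k c} [k _ /andP[/eqP-> _]//|k1 k2 k c1 c2 _ _ h1 _ h2 /merge_okE[-> -> h]].
by rewrite h in h2; lia.
Qed.

(** Pruning is safe because [merge_ok] sees only the keys: replacing the candidates of the halves by
    better ones keeps the merge legal, and addition is monotone. *)
Lemma table_complete x m k c : derivable x k c -> k.1.2 - k.1.1 < m ->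
  exists2 c' : cand, (k, c') \in iter m (step x) [::] & (c.1 <= c'.1)%R.
Proof.
move=> h; elim: h m => {k c} [k hk hl|k1 k2 k c1 c2 hk h1 IH1 h2 IH2 hm] [|m] //= hlt.
  have hc : leaf_cand x k \in candidates x (iter m (step x) [::]) k.
    by apply/candidatesP; left.
  have [[E _]|[b E [hb hmax]]] := best_spec (candidates x (iter m (step x) [::]) k).
    by rewrite E in hc.
  exists b; last exact: hmax hc.
  by apply/flatten_mapP; exists k => //; rewrite E inE.
have [e1 e2 e3] := merge_okE hm.
have [l1 l2] := (derivable_le h1, derivable_le h2); rewrite e3 in l2.
have [|b1 hb1 lb1] := IH1 m; first by rewrite e1 e2 in hlt; lia.
have [|b2 hb2 lb2] := IH2 m; first by rewrite e1 e2 in hlt; rewrite e3; lia.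
pose c := ((b1.1 + b2.1)%R, b1.2 ++ b2.2).
have hc : c \in candidates x (iter m (step x) [::]) k.
  by apply/candidatesP; right; exists (k1, b1), (k2, b2).
have [[E _]|[b E [hb hmax]]] := best_spec (candidates x (iter m (step x) [::]) k).
  by rewrite E in hc.
exists b; first by apply/flatten_mapP; exists k => //; rewrite E inE.
exact: le_trans (lerD lb1 lb2) (hmax _ hc).
Qed.

(** The given derivation guarantees a final row in the table, so the default of [head] in [solve] is
    never returned. *)
Lemma solve_spec x k0 c0 : derivable x k0 c0 -> final_ok x.1 k0 ->
  exists2 c : cand, c.2 = solve x &
    (exists2 k, derivable x k c & final_ok x.1 k) /\
    forall k c', derivable x k c' -> final_ok x.1 k -> (c'.1 <= c.1)%R.
Proof.
pose T := iter x.1 (step x) [::].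
have final k c : derivable x k c -> final_ok x.1 k ->
    exists2 c', c' \in [seq p.2 | p <- [seq p <- T | final_ok x.1 p.1]] & (c.1 <= c'.1)%R.
  move=> h hf.
  have [|c' hc' le] := table_complete (m := x.1) h.
    by move: hf => /andP[/andP[/eqP-> /eqP<-] _]; lia.
  by exists c' => //; apply/mapP; exists (k, c') => //; rewrite mem_filter hf.
move=> h0 f0; have [c1 hc1 _] := final _ _ h0 f0.
have [[E _]|[b E [hb hmax]]] := best_spec [seq p.2 | p <- [seq p <- T | final_ok x.1 p.1]].
  by rewrite E in hc1.
exists b; first by rewrite /solve E.
split; last by move=> k c h hf; have [c' /hmax h' le] := final _ _ h hf; exact: le_trans le h'.
move: hb => /mapP[[k c]]; rewrite mem_filter /= => /andP[hf /table_derivable h] ->.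
by exists k.
Qed.

Ltac ptime_user ::= progress (cbv delta [inside inner leaves meets separates ent_link
  ent_target ent_rank ent_done uses witnessed valid leaf_ok forwards merge_ok final_ok
  claims pays leaf_cand candidates step]).

(** * Running time of the dynamic program *)

Section Polytime.
Local Notation esize := (@esize R _ _).
Local Notation polytime := (@polytime R _ _ _ _).

Lemma esize_upto n : (esize (upto n) <= (n * (n.*2.+2)).+1)%N.
Proof.
have szu m : size (upto m) = m by elim: m => //= m ->.
rewrite -{2}(szu n); apply: esize_le_sum => i a hi.
have : nth a (upto n) i \in upto n by exact: mem_nth.
by rewrite mem_upto esize_nat; lia.
Qed.

Lemma polytime_upto {A : Type} {eA : encodable R A} (f : A -> nat) :
  polytime f -> polytime (fun a => upto (f a)).
Proof.
move=> hf; have [sf _] := hf; rewrite /upto.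
apply: (polytime_iter (s := fun _ s => size s :: s) (z := fun=> [::])
  (Q := fun a => (esize (f a) * (esize (f a) + esize (f a) + 2) + 1)%N)) => //.
- by ptime.
- by ptime.
- apply: poly_bounded_add (poly_bounded_cst _); apply: poly_bounded_mul => //.
  by apply: poly_bounded_add (poly_bounded_cst _); apply: poly_bounded_add.
move=> x i hi; apply: leq_trans (esize_upto i) _; rewrite esize_nat addn1 ltnS.
by apply: leq_mul; lia.
Qed.

(** Induction on the constant [m] over all input types at once: the shorter words are built in the
    scope of a letter, thus with input type [G * entry]. *)
Lemma polytime_words {A : Type} {eA : encodable R A} (f : A -> seq entry) m :
  polytime f -> polytime (fun a => words (f a) m).
Proof.
elim: m A eA f => [|m IH] G eG f hf /=; first by ptime.
pose g (y : G * entry) := words (f y.1) m.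
have hg : polytime g by apply: IH; apply: (polytime_comp (f := fun y : G * entry => y.1) hf); ptime.
apply: polytime_cons; first by ptime.
apply: (polytime_flatmap (f := fun a e => [seq e :: w | w <- words (f a) m])) => //.
apply: (polytime_map (f := fun (y : G * entry) w => y.2 :: w)) => //; ptime.
Qed.

Lemma polytime_best {A : Type} {eA : encodable R A} (f : A -> seq cand) :
  polytime f -> polytime (fun a => best (f a)).
Proof.
move=> hf; have [sf _] := hf; rewrite /best.
apply: (polytime_foldr (z := fun=> [::]) (Q := fun a => (esize (f a) + 2)%N)
  (s := fun _ c acc => if (if acc is [::] then true else false) then [:: c]
    else if ((head (0%R, [::]) acc).1 <= c.1)%R then [:: c] else acc)) => //.
- by ptime.
- apply: polytime_if; first by apply: polytime_is_nil; ptime.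
    by ptime.
  by ptime.
- by apply: poly_bounded_add (poly_bounded_cst _).
move=> x i; rewrite -[foldr _ _ _]/(best _).
case: (best_spec (drop i (f x))) => [[_ ->]|[c -> [hc _]]] /=; first by rewrite addn2.
have h1 : (esize c < esize (drop i (f x)))%N by exact: esize_mem hc.
have h2 : (esize (drop i (f x)) <= esize (f x))%N by exact: esize_drop.
by rewrite esize_cons esize_nil addn1 addn2 !ltnS (leq_trans (ltnW h1) h2).
Qed.

Lemma polytime_universe {A : Type} {eA : encodable R A} (f : A -> inst) :
  polytime f -> polytime (fun a => universe (f a)).
Proof.
apply: (polytime_comp (g := universe)); rewrite /universe.
have hU : polytime (fun x : inst => upto x.1).
  by apply: polytime_upto; ptime.
have hW : polytime (fun x : inst => words (alphabet x.1 x.2.1) (alpha + alpha)).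
  apply: polytime_words; rewrite /alphabet.
  have hd : polytime (fun x : inst => upto (size
      (flatten [seq [seq tt | j <- upto x.1] | i <- upto x.1]))).
    apply: polytime_upto; apply: polytime_size; apply: polytime_flatmap hU.
    apply: polytime_map; first exact: polytime_tt.
    by apply: polytime_upto; ptime.
  apply: polytime_flatmap; last by ptime.
  apply: polytime_flatmap; last by ptime.
  apply: polytime_flatmap; first by ptime.
  by apply: (polytime_comp (f := fun y : inst * (link * R) * (link * R) => y.1.1) hd); ptime.
apply: polytime_filter; first by ptime.
apply: polytime_flatmap => //.
apply: polytime_flatmap; last first.
  by apply: (polytime_comp (f := fun y : inst * nat => y.1) hU); ptime.
apply: polytime_map; first by ptime.
by apply: (polytime_comp (f := fun y : inst * nat * nat => y.1.1) hW); ptime.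
Qed.

(** A real number has size one, so only the link lists can grow. A leaf contributes at most the size
    of [L], and the number of leaves is the length of the interval; concatenation in the merges is
    therefore harmless. *)
Lemma derivable_esize (x : inst) (k : key) (c : cand) : derivable x k c ->
  (esize c.2 <= (k.1.2.+1 - k.1.1) * esize x.2.1)%N.
Proof.
elim=> {k c} [k _ /andP[/eqP-> _]|k1 k2 k c1 c2 _ h1 IH1 h2 IH2 /merge_okE[-> -> E]].
  rewrite subSnn mul1n /=; elim: (x.2.1) => [//|[l r] L IH] /=.
  case: ifP => _ /=; rewrite !esize_cons esize_pair.
    by rewrite ltnS leq_add // leqW // leq_addr.
  by apply: leq_trans IH _; rewrite leqW // leq_addl.
have := derivable_le h1; have := derivable_le h2; rewrite E => l2 l1.
have e : (esize (c1.2 ++ c2.2)).+1 = (esize c1.2 + esize c2.2)%N by exact: esize_cat.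
apply: (leq_trans (ltnW (ltnSn _))); rewrite e; apply: leq_trans (leq_add IH1 IH2) _.
by rewrite E -mulnDl leq_mul2r; apply/orP; right; lia.
Qed.

Lemma size_step x T : (size (step x T) <= size (universe x))%N.
Proof.
rewrite /step; elim: (universe x) => //= k s IH; rewrite size_cat size_map.
have : (size (best (candidates x T k)) <= 1)%N.
  by case: (best_spec (candidates x T k)) => [[_ ->]|[c ->]].
lia.
Qed.

(** One bound for all rounds, since each round rebuilds the table with at most one row per key of
    the universe. *)
Lemma esize_table (x : inst) m : (esize (iter m (step x) [::]) <=
  (esize (universe x) * (esize (universe x) + esize x * esize x + 4)).+1)%N.
Proof.
apply: leq_trans (esize_le_sum (m := (esize (universe x) + esize x * esize x + 3)%N) _) _.
  move=> i a hi; have : nth a (iter m (step x) [::]) i \in iter m (step x) [::].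
    exact: mem_nth.
  case: (nth _ _ _) => k c /table_derivable /= h.
  have h1 : (esize k < esize (universe x))%N by exact/esize_mem/(derivable_universe h).
  have h2 := derivable_esize h; rewrite esize_pair.
  have h3 : (esize c = (esize c.2).+2)%N by case: (c).
  have h4 : (esize x.2.1 <= esize x)%N by case: (x) => n [L F]; rewrite !esize_pair /=; lia.
  have h5 : (k.1.2 < x.1)%N by move: (derivable_universe h); rewrite mem_universe => /and3P[].
  have h6 : (x.1 <= esize x)%N.
    by case: (x) => n LF; rewrite esize_pair esize_nat /=; lia.
  have : (esize c.2 <= esize x * esize x)%N.
    by apply: leq_trans h2 _; apply: leq_mul => //; lia.
  lia.
rewrite ltnS; apply: leq_mul; last by rewrite -addnS.
case: m => // m; apply: leq_trans (size_step _ _) _.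
exact: ltnW (size_esize _).
Qed.

Lemma polytime_step : polytime (fun y : inst * table => step y.1 y.2).
Proof.
rewrite /step; apply: polytime_flatmap; last by apply: polytime_universe; ptime.
apply: polytime_map; first by ptime.
by apply: polytime_best; ptime.
Qed.

Lemma polytime_solve : polytime solve.
Proof.
rewrite /solve; apply: polytime_snd; apply: polytime_head; first by ptime.
apply: polytime_best; apply: polytime_map; first by ptime.
apply: polytime_filter; first by ptime.
have hU : polytime (fun x => universe x) by apply: polytime_universe; ptime.
apply: (polytime_iter (Q := fun x =>
  (esize (universe x) * (esize (universe x) + esize x * esize x + 4)).+1)).
- by ptime.
- exact: polytime_step.
- by ptime.
- have [sU _] := hU.
  apply: (poly_bounded_le (h := fun x : inst =>
    (esize (universe x) * (esize (universe x) + esize x * esize x + 4) + 1)%N)).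
    by move=> x; rewrite addn1.
  apply: poly_bounded_add (poly_bounded_cst _); apply: poly_bounded_mul => //.
  apply: poly_bounded_add (poly_bounded_cst _); apply: poly_bounded_add => //.
  by apply: poly_bounded_mul; exact: poly_bounded_esize.
by move=> x i _; exact: esize_table.
Qed.

End Polytime.

End Program.

(** * Components of crossing links *)

Definition touches (i j : nat) (l : link) : bool := inside i j l.1 || inside i j l.2.

Lemma meetsC l m : meets l m = meets m l.
Proof. by rewrite /meets orbC. Qed.

(** Both alternatives in [meets] put an endpoint of [m] weakly between the endpoints of [l]. So all
    neighbours of an inner link are visible in the interval. *)
Lemma meets_touches i j l m : m.1 < m.2 -> inner i j l -> meets l m -> touches i j m.
Proof. rewrite /inner /touches /meets /inside; lia. Qed.

Lemma touchesE i j l : touches i j l = inner i j l || leaves i j l.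
Proof. by rewrite /touches /inner /leaves; do 2!case: inside. Qed.

Lemma leavesE i j l : leaves i j l =
  inside i j l.1 && ~~ inside i j l.2 || ~~ inside i j l.1 && inside i j l.2.
Proof. by rewrite /leaves; do 2!case: inside. Qed.

Lemma inner_hull a b l : l.1 < l.2 -> a <= l.1 -> l.2 <= b -> inner a b l.
Proof. rewrite /inner /inside; lia. Qed.

Lemma inner_leaves i j l : inner i j l -> ~~ leaves i j l.
Proof. by rewrite /inner /leaves => /andP[-> ->]. Qed.

(** The endpoint of [l] inside [[a, b]] lies under [h], and the other one is outside [[a, b]], hence
    beyond an end of [h]. *)
Lemma hull_meets a b h l : leaves a b l -> a <= h.1 -> h.2 <= b ->
  (inside a b l.1 -> h.1 <= l.1 <= h.2) -> (inside a b l.2 -> h.1 <= l.2 <= h.2) ->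
  l.1 < l.2 -> meets h l.
Proof. rewrite leavesE /inside /meets; lia. Qed.

Section Labels.
Variables (n : nat) (K : seq link).
Hypothesis K_uniq : uniq K.
Hypothesis K_lt : forall l, l \in K -> l.1 < l.2 < n.

Local Notation G := (seq_sub K).
Implicit Types x y z : G.

Definition meet_rel : rel G := [rel x y | meets (val x) (val y)].

Lemma meet_rel_sym : symmetric meet_rel.
Proof. by move=> x y; exact: meetsC. Qed.

Lemma connect_meet_sym : connect_sym meet_rel.
Proof. exact: sym_connect_sym meet_rel_sym. Qed.

Lemma card_links : #|{: G}| <= n * n.
Proof.
rewrite card_seq_sub //; have -> : (n * n)%N = size [seq (i, j) | i <- iota 0 n, j <- iota 0 n].
  by rewrite size_allpairs size_iota.
apply: uniq_leq_size => // -[a b] /K_lt /= h.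
by apply/allpairsP; exists (a, b); rewrite !mem_iota; split=> //=; lia.
Qed.

Definition reaches x y k : bool :=
  [exists p : k.-tuple G, path meet_rel x p && (last x p == y)].

(** [find] returns the number of links if no shorter walk exists; for connected links a simple path
    stays below this number. *)
Definition dist x y : nat := find (reaches x y) (iota 0 #|{: G}|).

Lemma dist_le x y k : k < #|{: G}| -> reaches x y k -> dist x y <= k.
Proof.
move=> hk hr; rewrite leqNgt; apply/negP => /(before_find 0).
by rewrite nth_iota // hr.
Qed.

Lemma dist_reaches x y : connect meet_rel x y ->
  dist x y < #|{: G}| /\ reaches x y (dist x y).
Proof.
move=> /connectP[p hp ->]; case/shortenP: hp => q hq uq _.
have hs : size q < #|{: G}|.
  by have := card_uniqP uq; have := max_card (mem (x :: q)); rewrite /= => h1 h2; rewrite -h2.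
have hr : reaches x (last x q) (size q).
  by apply/existsP; exists (in_tuple q); rewrite /= hq eqxx.
have hd : dist x (last x q) < #|{: G}| by exact: leq_ltn_trans (dist_le hs hr) hs.
split=> //; have : has (reaches x (last x q)) (iota 0 #|{: G}|).
  by rewrite has_find size_iota.
by move=> /(nth_find 0); rewrite nth_iota.
Qed.

(** Drop the last vertex of a shortest walk from [x] to [y]. Distances are measured from the target
    [x], so [z] is the neighbour that justifies the label of [y]. *)
Lemma dist_pred x y : connect meet_rel x y -> x != y ->
  exists z, [/\ meet_rel y z, connect meet_rel x z & dist x z < dist x y].
Proof.
move=> hc ne; have [hd /existsP[[p /= sp] /andP[hp /eqP hl]]] := dist_reaches hc.
case/lastP: p => [|p w] in sp hp hl *; first by rewrite -hl eqxx in ne.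
rewrite last_rcons in hl; rewrite hl rcons_path in hp; move: hp => /andP[hp he].
exists (last x p); split; first by rewrite meet_rel_sym.
  by apply/connectP; exists p.
move: sp; rewrite size_rcons => /eqP sp; rewrite -sp ltnS.
apply: dist_le; first by rewrite -sp in hd; lia.
by apply/existsP; exists (in_tuple p); rewrite /= hp eqxx.
Qed.

(** The minimum is searched from the canonical root of the component so that ties are resolved
    alike: all links of a component get the same link as target, and not merely the same
    coordinate. *)
Definition leftmost x : G :=
  let r := fingraph.root meet_rel x in [arg min_(y < r | connect meet_rel r y) (val y).1].
Definition rightmost x : G :=
  let r := fingraph.root meet_rel x in [arg max_(y > r | connect meet_rel r y) (val y).2].

Lemma leftmostP x : connect meet_rel x (leftmost x) /\
  forall y, connect meet_rel x y -> (val (leftmost x)).1 <= (val y).1.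
Proof.
rewrite /leftmost; case: arg_minnP => [|y hy hmin]; first exact: connect0.
have hr := connect_root meet_rel x; split; first exact: connect_trans hr hy.
move=> z hz; apply: hmin; apply: connect_trans hz.
by rewrite connect_meet_sym.
Qed.

Lemma rightmostP x : connect meet_rel x (rightmost x) /\
  forall y, connect meet_rel x y -> (val y).2 <= (val (rightmost x)).2.
Proof.
rewrite /rightmost; case: arg_maxnP => [|y hy hmin]; first exact: connect0.
have hr := connect_root meet_rel x; split; first exact: connect_trans hr hy.
move=> z hz; apply: hmin; apply: connect_trans hz.
by rewrite connect_meet_sym.
Qed.

Lemma leftmost_connect x y : connect meet_rel x y -> leftmost x = leftmost y.
Proof. by move=> /(fingraph.rootP connect_meet_sym) h; rewrite /leftmost h. Qed.

Lemma rightmost_connect x y : connect meet_rel x y -> rightmost x = rightmost y.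
Proof. by move=> /(fingraph.rootP connect_meet_sym) h; rewrite /rightmost h. Qed.

(** A walk in the component from its leftmost to its rightmost link cannot jump over [u]: links on
    different sides of [u] do not meet, so if no link spans [u], the neighbours of a link left of
    [u] are left of [u] too. *)
Lemma hull_spans x u : (val (leftmost x)).1 <= u <= (val (rightmost x)).2 ->
  exists2 h, connect meet_rel x h & (val h).1 <= u <= (val h).2.
Proof.
move=> /andP[hl hr]; apply: contrapT => hn.
have side h : connect meet_rel x h -> ~~ ((val h).1 <= u <= (val h).2).
  by move=> hh; apply/negP => hu; apply: hn; exists h.
have [cl _] := leftmostP x; have [cr _] := rightmostP x.
have left p y : connect meet_rel x y -> (val y).2 < u -> path meet_rel y p ->
    (val (last y p)).2 < u.
  elim: p y => //= z p IH y cy hy /andP[e hp]; have cz := connect_trans cy (connect1 e).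
  apply: IH => //; have := side _ cz; move: e (K_lt (valP z)) (K_lt (valP y)).
  rewrite /meet_rel /= /meets; move: (val y) (val z) hy => a b; lia.
have : connect meet_rel (leftmost x) (rightmost x).
  by apply: connect_trans cr; rewrite connect_meet_sym.
have h0 : (val (leftmost x)).2 < u by have := side _ cl; rewrite hl /= -ltnNge.
by move=> /connectP[p hp e]; have := left p _ cl h0 hp; rewrite -e ltnNge hr.
Qed.

(** A link leaving the hull has an endpoint inside it, which some link of the component spans. The
    two meet, so the leaving link belongs to the component and lies in the hull after all. *)
Lemma hull_closed x y :
  ~~ leaves (val (leftmost x)).1 (val (rightmost x)).2 (val y).
Proof.
have [_ lmin] := leftmostP x; have [_ rmax] := rightmostP x.
apply/negP => hy; have K_y := K_lt (valP y).
have close h : connect meet_rel x h -> ~~ meets (val h) (val y).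
  move=> ch; apply/negP => m; have cy := connect_trans ch (connect1 (m : meet_rel h y)).
  have := inner_hull (proj1 (andP K_y)) (lmin _ cy) (rmax _ cy).
  by move=> /inner_leaves /negP.
have [u hu hu'] : exists2 u, inside (val (leftmost x)).1 (val (rightmost x)).2 u &
    forall h : G, (val h).1 <= u <= (val h).2 -> [/\
      inside (val (leftmost x)).1 (val (rightmost x)).2 (val y).1 ->
        (val h).1 <= (val y).1 <= (val h).2 &
      inside (val (leftmost x)).1 (val (rightmost x)).2 (val y).2 ->
        (val h).1 <= (val y).2 <= (val h).2].
  move: hy; rewrite leavesE => /orP[] /andP[h1 h2].
    by exists (val y).1 => // h hh; split=> // h3; rewrite h3 in h2.
  by exists (val y).2 => // h hh; split=> // h3; rewrite h3 in h1.
have [h ch /hu'[h1 h2]] := hull_spans hu.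
have /negP := close _ ch; apply.
exact: hull_meets hy (lmin _ ch) (rmax _ ch) h1 h2 (proj1 (andP K_y)).
Qed.

Definition labelled (rho : link -> link) (d : link -> link -> nat) : Prop :=
  forall l, l \in K -> [/\ rho l \in K, d (rho l) l < n * n &
    rho l = l \/ exists m, [/\ m \in K, meets l m, rho m = rho l &
                              d (rho l) m < d (rho l) l]].

(** [rho1] and [rho2] are the extreme links of the component, [d] is the distance from the target.
    The last clause keeps what completeness uses of the geometry: the hull is an interval around [l]
    that no link of [K] leaves. *)
Lemma labels_exist : exists rho1 rho2 d,
  [/\ labelled rho1 d, labelled rho2 d &
      forall l, l \in K -> inner (rho1 l).1 (rho2 l).2 l /\
        forall m, m \in K -> ~~ leaves (rho1 l).1 (rho2 l).2 m].
Proof.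
pose lift (f : G -> G) l := if insub l is Some x then val (f x) else l.
pose d l m := if insub l is Some x then (if insub m is Some y then dist x y else 0) else 0.
have liftE f x : lift f (val x) = val (f x) by rewrite /lift valK.
have dE x y : d (val x) (val y) = dist x y by rewrite /d !valK.
have label f : (forall x, connect meet_rel x (f x)) ->
    (forall x y, connect meet_rel x y -> f x = f y) -> labelled (lift f) d.
  move=> hf fE l hl; pose x : G := SeqSub hl; rewrite -[l]/(val x) liftE dE.
  have cx : connect meet_rel (f x) x by rewrite connect_meet_sym.
  split; first exact: valP.
    by have [h _] := dist_reaches cx; exact: leq_trans h card_links.
  have [->|ne] := eqVneq (f x) x; [by left | right].
  have [z [e cz lt]] := dist_pred cx ne.
  exists (val z); rewrite liftE !dE; split=> //; first exact: valP.
  by congr val; apply/esym/fE; exact: connect_trans (hf x) cz.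
exists (lift leftmost), (lift rightmost), d; split.
- by apply: label => [x|x y]; [have [] := leftmostP x | exact: leftmost_connect].
- by apply: label => [x|x y]; [have [] := rightmostP x | exact: rightmost_connect].
move=> l hl; pose x : G := SeqSub hl; rewrite -[l]/(val x) !liftE; split; last first.
  by move=> m hm; exact: (hull_closed x (SeqSub hm)).
have [_ /(_ x (connect0 _ _)) h1] := leftmostP x.
have [_ /(_ x (connect0 _ _)) h2] := rightmostP x.
exact: inner_hull (proj1 (andP (K_lt hl))) h1 h2.
Qed.

End Labels.

(** * Correctness of the dynamic program *)

Lemma inside_top a b n : a < b < n -> inside 1 n.-1 b.
Proof. rewrite /inside; lia. Qed.

Lemma separates_inside i j v u y : separates v u y -> inside i j v -> inside i j u ->
  inside i j y.
Proof. rewrite /separates /inside; lia. Qed.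

Lemma touches_split i m j l : i <= m < j -> touches i m l -> touches m.+1 j l ->
  [/\ leaves i m l, leaves m.+1 j l & inner i j l].
Proof. by rewrite !leavesE /touches /inner /inside => *; split; lia. Qed.

Lemma leaves_left i m j l : m < j -> touches i m l -> leaves i j l -> leaves i m l.
Proof. rewrite !leavesE /touches /inside; lia. Qed.

Lemma leaves_right i m j l : i <= m -> touches m.+1 j l -> leaves i j l -> leaves m.+1 j l.
Proof. rewrite !leavesE /touches /inside; lia. Qed.

Lemma leaves_left_only i m j l : i <= m < j -> leaves i m l -> leaves i j l ->
  ~~ touches m.+1 j l.
Proof. rewrite !leavesE /touches /inside; lia. Qed.

Lemma leaves_right_only i m j l : i <= m < j -> leaves m.+1 j l -> leaves i j l ->
  ~~ touches i m l.
Proof. rewrite !leavesE /touches /inside; lia. Qed.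

Lemma touches_right_leaves i m j l : i <= m < j -> ~~ touches i m l -> touches m.+1 j l ->
  ~~ inner m.+1 j l -> leaves i j l.
Proof. rewrite !leavesE /touches /inner /inside; lia. Qed.

Lemma touches_left_leaves i m j l : i <= m < j -> ~~ touches m.+1 j l -> touches i m l ->
  ~~ inner i m l -> leaves i j l.
Proof. rewrite !leavesE /touches /inner /inside; lia. Qed.

Lemma leaves_either i m j l : i <= m < j -> leaves i j l ->
  leaves i m l || leaves m.+1 j l.
Proof. rewrite !leavesE /inside; lia. Qed.

Lemma inner_point a b v l : inner a b l -> leaves v v l -> inside a b v.
Proof. rewrite leavesE /inner /inside; lia. Qed.

Lemma hull_separates a b v y : inside a b v -> inside a b y -> v != y ->
  separates v a y || separates v b y.
Proof. rewrite /separates /inside; lia. Qed.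

Section Correctness.
Variables (R : realType) (alpha : nat) (x : nat * (seq (link * R) * seq (nat * seq nat * R))).
Local Notation n := x.1.
Local Notation L := x.2.1.
Local Notation F := x.2.2.
Local Notation cand := (R * seq link)%type.
Local Notation label := (link * link * nat)%type.
Hypothesis L_lt : forall l : link * R, l \in L -> l.1.1 < l.1.2 < n.
Hypothesis L_uniq : uniq [seq l.1 | l <- L].

Definition cut_size (K : pred link) i j := size [seq l <- L | K l.1 && leaves i j l.1].

(** Recursive form of thinness: a maximal laminar family of intervals is a tree of splits down to
    singletons. [thin_to_tree] and [tree_to_thin] give the equivalence. *)
Inductive thin_tree (K : pred link) : nat -> nat -> Prop :=
| thin_leaf v : cut_size K v v <= alpha -> thin_tree K v v
| thin_node i m j : cut_size K i j <= alpha ->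
    thin_tree K i m -> thin_tree K m.+1 j -> thin_tree K i j.

(** Membership in Drop in terms of positions: [f.1.1] is the head of a directed link and [f.1.2] the
    vertices that its cuts must avoid; see [dropped_drop_links]. *)
Definition dropped (K : pred link) (f : nat * seq nat * R) : bool :=
  `[< forall i j, 0 < i -> inside i j f.1.1 -> j < n ->
        ~~ has (inside i j) f.1.2 -> has (fun l => K l.1 && leaves i j l.1) L >].

Definition gain (K : pred link) : R :=
  (\sum_(f <- F | dropped K f) f.2 - \sum_(l <- L | K l.1) l.2)%R.

Lemma thin_tree_le K i j : thin_tree K i j -> i <= j.
Proof. by elim=> {i j} // i m j _ _ h1 _ h2; exact: leq_trans h1 (ltnW h2). Qed.

(** Only links with an endpoint in [[i, j]] can leave an interval of its tree. This lets the tree of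
    a half be reused when the labels of the other half are added. *)
Lemma eq_thin_tree (K K' : pred link) i j :
    {in [seq l.1 | l <- L], forall l, touches i j l -> K l = K' l} ->
  thin_tree K i j -> thin_tree K' i j.
Proof.
have eq_cut i0 j0 : {in [seq l.1 | l <- L], forall l, touches i0 j0 l -> K l = K' l} ->
    cut_size K i0 j0 = cut_size K' i0 j0.
  move=> h; rewrite /cut_size; congr size; apply: eq_in_filter => l hl.
  have := h _ (map_f fst hl); rewrite touchesE.
  by case: leaves; rewrite ?andbF // orbT => ->.
move=> h t; elim: t h => {i j} [v c h|i m j c t1 IH1 t2 IH2 h].
  by apply: thin_leaf; rewrite -eq_cut.
have [l1 l2] := (thin_tree_le t1, thin_tree_le t2).
apply: (@thin_node _ _ m); first by rewrite -eq_cut.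
  apply: IH1 => l hl tl; apply: h => //; move: tl; rewrite /touches /inside; lia.
apply: IH2 => l hl tl; apply: h => //; move: tl; rewrite /touches /inside; lia.
Qed.

Lemma sum_inside_split (T : Type) (s : seq T) (v : T -> nat) (P : pred T) (w : T -> R)
    i m j : i <= m -> m < j ->
  (\sum_(t <- s | inside i j (v t) && P t) w t =
   \sum_(t <- s | inside i m (v t) && P t) w t +
   \sum_(t <- s | inside m.+1 j (v t) && P t) w t)%R.
Proof.
move=> h1 h2; rewrite (bigID (fun t => v t <= m)) /=; congr (_ + _)%R;
  apply: eq_bigl => t; case: (P t); rewrite ?andbF ?andbT //= /inside; lia.
Qed.

Definition label_uses (X : seq label) (l : link) := has (fun t => t.1.1 == l) X.

Definition satisfied (X : seq label) (t : label) : bool :=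
  (t.1.2 == t.1.1) ||
  has (fun s => (s.1.2 == t.1.2) && (s.2 < t.2) && meets t.1.1 s.1.1) X.

Definition label_claims (X : seq label) (f : nat * seq nat * R) : bool :=
  has (fun t => ((t.1.1.1 == f.1.1) || (t.1.1.2 == f.1.1)) &&
    (has (separates f.1.1 t.1.2.1) f.1.2 || has (separates f.1.1 t.1.2.2) f.1.2)) X.

(* X lists the labels of all links with an endpoint in the interval of k. *)
Record explains (k : key) (c : cand) (X : seq label) : Prop := Explains {
  ex_mem : forall t, t \in X -> t.1.1 \in [seq l.1 | l <- L] /\ touches k.1.1 k.1.2 t.1.1;
  ex_state : forall e, e \in k.2 -> e.1 \in X /\ leaves k.1.1 k.1.2 e.1.1.1;
  ex_leaves : forall t, t \in X -> leaves k.1.1 k.1.2 t.1.1 -> exists b, (t, b) \in k.2;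
  ex_links : forall l, (l \in c.2) = label_uses X l && inside k.1.1 k.1.2 l.2;
  ex_uniq : uniq c.2;
  ex_thin : thin_tree (label_uses X) k.1.1 k.1.2;
  ex_inner : forall t, t \in X -> inner k.1.1 k.1.2 t.1.1 -> satisfied X t;
  ex_done : forall e, e \in k.2 -> e.2 -> satisfied X e.1;
  ex_value : c.1 = (\sum_(f <- F | inside k.1.1 k.1.2 f.1.1 && label_claims X f) f.2
     - \sum_(l <- L | inside k.1.1 k.1.2 l.1.2 && label_uses X l.1) l.2)%R }.

Lemma universe_links k e : k \in universe alpha x -> e \in k.2 ->
  ent_link e \in [seq l.1 | l <- L] /\ leaves k.1.1 k.1.2 (ent_link e).
Proof.
rewrite mem_universe => /and5P[_ _ /allP hA _ /andP[/allP hl _]] he.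
by have /= := hA _ he; rewrite mem_alphabet => /andP[-> _]; rewrite hl.
Qed.

Lemma universe_cut_size (k : key) (K : pred link) : k \in universe alpha x ->
  {in [seq l.1 | l <- L], forall l, uses k.2 l = K l && leaves k.1.1 k.1.2 l} ->
  cut_size K k.1.1 k.1.2 <= alpha.
Proof.
rewrite mem_universe => /and5P[_ _ _ _ /andP[_ h]] hK.
rewrite /cut_size -(eq_in_filter (a1 := fun l => uses k.2 l.1)) // => l hl.
by rewrite hK // map_f.
Qed.

Lemma satisfied_sub (X Y : seq label) t : {subset X <= Y} -> satisfied X t -> satisfied Y t.
Proof.
move=> sub /orP[h|/hasP[s /sub hs hp]]; apply/orP; first by left.
by right; apply/hasP; exists s.
Qed.

Lemma explains_leaf k : k \in universe alpha x -> leaf_ok k ->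
  explains k (leaf_cand x k) (map fst k.2).
Proof.
move=> hU /andP[/eqP ij /allP hd].
have mem e : e \in k.2 -> ent_link e \in [seq l.1 | l <- L] /\ leaves k.1.1 k.1.2 (ent_link e).
  exact: universe_links.
have lv l : leaves k.1.1 k.1.2 l -> touches k.1.1 k.1.2 l by rewrite touchesE => ->; rewrite orbT.
have usesE l : label_uses (map fst k.2) l = uses k.2 l by rewrite /label_uses has_map.
have sat e : e \in k.2 -> witnessed k.2 e -> satisfied (map fst k.2) e.1.
  move=> he /orP[h|/hasP[f hf hp]]; apply/orP; [by left | right].
  by apply/hasP; exists f.1; [exact: map_f | exact: hp].
have insideE u : inside k.1.1 k.1.2 u = (u == k.1.1) by rewrite -ij /inside eqn_leq andbC.
split.
- by move=> t /mapP[e /mem[h1 h2] ->]; split=> //; exact: lv.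
- by move=> e he; split; [exact: map_f | have [] := mem e he].
- by move=> t /mapP[[t' b] he ->] _; exists b.
- move=> l; rewrite usesE insideE; apply/mapP/andP.
    by move=> [l']; rewrite mem_filter => /andP[/andP[h1 h2] _] ->.
  move=> [hu hi]; have /hasP[e he /eqP el] := hu.
  have [/mapP[l' hl' e'] _] := mem e he; rewrite el in e'.
  by exists l' => //; rewrite mem_filter hl' /pays -e' hi hu.
- by apply: subseq_uniq L_uniq; apply/map_subseq/filter_subseq.
- rewrite -ij; apply: thin_leaf; rewrite [in X in cut_size _ _ X]ij.
  apply: universe_cut_size => // l hl; rewrite usesE.
  case hu: uses => //=; move/hasP: hu => [e he /eqP <-].
  by have [_ ->] := mem e he.
- move=> t /mapP[e he ->] hi; have [_ hl] := mem e he.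
  by move: hl; rewrite (negbTE (inner_leaves hi)).
- by move=> e he de; apply: sat => //; exact: (implyP (hd _ he)).
rewrite /leaf_cand /=; congr (_ - _)%R.
  (* [claims] inspects every entry, [label_claims] only those whose link ends at the head of [f]; at
     a singleton the two agree, since all entries leave it. *)
  rewrite big_filter; apply: eq_bigl => f; rewrite insideE /claims.
  case: eqP => //= fv; rewrite /label_claims has_map; apply: eq_in_has => e he /=.
  have [_] := mem e he; rewrite leavesE !insideE fv /ent_link /ent_target.
  by case: (_ == _) => //=; case: (_ == _).
by rewrite big_filter; apply: eq_bigl => l; rewrite usesE insideE /pays.
Qed.

(** The label lists agree on common links: a link touching both halves leaves both and is inner to
    [[i, j]], so [forwards] makes each of its labels appear on both sides ([cross1], [cross2]).
    Hence usage and claims can be judged in one half alone. *)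
Lemma explains_merge k1 k2 k c1 c2 X1 X2 : k \in universe alpha x -> merge_ok k1 k2 k ->
  explains k1 c1 X1 -> explains k2 c2 X2 ->
  explains k ((c1.1 + c2.1)%R, c1.2 ++ c2.2) (X1 ++ X2).
Proof.
move=> hU hm; have [] := merge_okE hm.
case: k1 k2 k hm hU => [[i' m] S1] [[m' j'] S2] [[i j] S] hm hU /= ei ej em.
rewrite -{i'}ei -{j'}ej {m'}em in hm * => E1 E2.
move: hm => /and5P[_ _ _ /allP /= f1 /andP[/allP /= f2 /allP /= f3]].
have [/= l1 l2] := (thin_tree_le (ex_thin E1), thin_tree_le (ex_thin E2)).
have imj : i <= m < j by rewrite l1.
have mem_l e : e \in S -> ent_link e \in [seq l.1 | l <- L] /\ leaves i j (ent_link e).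
  exact: universe_links hU.
have t1 l : touches i m l -> touches i j l by rewrite /touches /inside; lia.
have t2 l : touches m.+1 j l -> touches i j l by rewrite /touches /inside; lia.
have tl1 l : touches i m l -> ~~ inner i m l -> leaves i m l.
  by rewrite touchesE; case: inner.
have tl2 l : touches m.+1 j l -> ~~ inner m.+1 j l -> leaves m.+1 j l.
  by rewrite touchesE; case: inner.
have cross1 t : t \in X1 -> touches m.+1 j t.1.1 -> t \in X2.
  move=> ht h; have [_ /= h'] := ex_mem E1 ht.
  have [h3 _ h4] := touches_split imj h' h.
  have [b hb] := ex_leaves E1 ht h3; have := f1 _ hb; rewrite [ent_link _]/= h4.
  by move=> /hasP[f hf /andP[/eqP /= <- _]]; have [] := ex_state E2 hf.
have cross2 t : t \in X2 -> touches i m t.1.1 -> t \in X1.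
  move=> ht h; have [_ /= h'] := ex_mem E2 ht.
  have [_ h3 h4] := touches_split imj h h'.
  have [b hb] := ex_leaves E2 ht h3; have := f2 _ hb; rewrite [ent_link _]/= h4.
  by move=> /hasP[f hf /andP[/eqP /= <- _]]; have [] := ex_state E1 hf.
have uses1 l : touches i m l -> label_uses (X1 ++ X2) l = label_uses X1 l.
  move=> h; rewrite /label_uses has_cat; case: hasP => //= h1.
  by apply/hasP => -[t ht /eqP e]; apply: h1; exists t; rewrite ?e // cross2 // e.
have uses2 l : touches m.+1 j l -> label_uses (X1 ++ X2) l = label_uses X2 l.
  move=> h; rewrite /label_uses has_cat orbC; case: hasP => //= h1.
  by apply/hasP => -[t ht /eqP e]; apply: h1; exists t; rewrite ?e // cross1 // e.
have st e : e \in S -> e.1 \in X1 ++ X2.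
  move=> /f3 /hasP[f]; rewrite !mem_cat => /orP[] hf /andP[/eqP <- _].
    by have [-> _] := ex_state E1 hf.
  by have [-> _] := ex_state E2 hf; rewrite orbT.
have sat e : witnessed S e -> satisfied (X1 ++ X2) e.1.
  move=> /orP[h|/hasP[f hf hp]]; apply/orP; [by left | right].
  by apply/hasP; exists f.1; [exact: st | exact: hp].
have lv t : t \in X1 ++ X2 -> leaves i j t.1.1 -> exists b, (t, b) \in S.
  move=> ht hl; have ni : ~~ inner i j t.1.1 by apply/negP => /inner_leaves; rewrite hl.
  move: ht; rewrite mem_cat => /orP[] ht.
    have [_ /= h] := ex_mem E1 ht.
    have h3 := leaves_left l2 h hl.
    have [b hb] := ex_leaves E1 ht h3; have := f1 _ hb.
    rewrite /ent_link (negbTE ni) => /hasP[[t' b'] hf /eqP /= e].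
    by exists b'; rewrite -e.
  have [_ /= h] := ex_mem E2 ht.
  have h3 := leaves_right l1 h hl.
  have [b hb] := ex_leaves E2 ht h3; have := f2 _ hb.
  rewrite /ent_link (negbTE ni) => /hasP[[t' b'] hf /eqP /= e].
  by exists b'; rewrite -e.
have sub1 : {subset X1 <= X1 ++ X2} by move=> t; rewrite mem_cat => ->.
have sub2 : {subset X2 <= X1 ++ X2} by move=> t; rewrite mem_cat orbC => ->.
have in1 u : inside i m u -> inside i j u by rewrite /inside; lia.
have in2 u : inside m.+1 j u -> inside i j u by rewrite /inside; lia.
split=> /=.
- move=> t; rewrite mem_cat => /orP[] ht.
    by have [h h'] := ex_mem E1 ht; split=> //; exact: t1.
  by have [h h'] := ex_mem E2 ht; split=> //; exact: t2.
- by move=> e he; split; [exact: st | have [] := mem_l e he].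
- exact: lv.
- move=> l; rewrite mem_cat (ex_links E1) (ex_links E2) /=.
  apply/orP/andP => [[]/andP[h h']|[h h']].
  + by rewrite uses1 ?in1 // /touches h' orbT.
  + by rewrite uses2 ?in2 // /touches h' orbT.
  have [h1|h1] := boolP (inside i m l.2).
    by left; rewrite -uses1 ?h // /touches h1 orbT.
  have h2 : inside m.+1 j l.2 by move: h1 h'; rewrite /inside; lia.
  by right; rewrite -uses2 ?h // /touches h2 orbT.
- rewrite cat_uniq (ex_uniq E1) (ex_uniq E2) andbT /=; apply/hasPn => l.
  rewrite (ex_links E2) (ex_links E1) /= => /andP[_ h]; apply/negP => /andP[_].
  by move: h; rewrite /inside; lia.
- apply: (@thin_node _ _ m).
  + apply: (universe_cut_size hU) => l _ /=; apply/hasP/andP.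
      move=> [e he /eqP <-]; have [_ ->] := mem_l e he; split=> //.
      by apply/hasP; exists e.1; [exact: st|].
    move=> [/hasP[t ht /eqP <-] hl]; have [b hb] := lv t ht hl.
    by exists (t, b).
  + by apply: eq_thin_tree (ex_thin E1) => l _ /uses1.
  + by apply: eq_thin_tree (ex_thin E2) => l _ /uses2.
(* A link inner to [[i, j]] but to neither half leaves the state at this merge; [forwards] then
   demands a set bit in one half, which [ex_done] turns into a justification. *)
- move=> t; rewrite mem_cat => /orP[] ht hi.
    have [/(ex_inner E1 ht)|hn] := boolP (inner i m t.1.1); first exact: satisfied_sub.
    have [_ /= h] := ex_mem E1 ht; have [b hb] := ex_leaves E1 ht (tl1 _ h hn).
    have := f1 _ hb; rewrite /ent_link hi => /hasP[f hf /andP[/eqP e /orP[d|d]]].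
      exact: satisfied_sub sub1 (ex_done E1 hb d).
    by rewrite -[t]/(t, b).1 -e; exact: satisfied_sub sub2 (ex_done E2 hf d).
  have [/(ex_inner E2 ht)|hn] := boolP (inner m.+1 j t.1.1); first exact: satisfied_sub.
  have [_ /= h] := ex_mem E2 ht; have [b hb] := ex_leaves E2 ht (tl2 _ h hn).
  have := f2 _ hb; rewrite /ent_link hi => /hasP[f hf /andP[/eqP e /orP[d|d]]].
    exact: satisfied_sub sub2 (ex_done E2 hb d).
  by rewrite -[t]/(t, b).1 -e; exact: satisfied_sub sub1 (ex_done E1 hf d).
- move=> e he de; have := f3 _ he; rewrite /ent_done de /= => /hasP[f].
  rewrite mem_cat => /orP[] hf /andP[/eqP ef /orP[d|w]].
  + by rewrite -ef; exact: satisfied_sub sub1 (ex_done E1 hf d).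
  + exact: sat.
  + by rewrite -ef; exact: satisfied_sub sub2 (ex_done E2 hf d).
  + exact: sat.
have claims1 f : inside i m f.1.1 -> label_claims (X1 ++ X2) f = label_claims X1 f.
  move=> h; rewrite /label_claims has_cat; case: hasP => //= h1.
  apply/hasP => -[t ht /andP[hv hs]]; apply: h1; exists t; rewrite ?hv //.
  by apply: cross2 => //; rewrite /touches; case/orP: hv => /eqP->; rewrite h ?orbT.
have claims2 f : inside m.+1 j f.1.1 -> label_claims (X1 ++ X2) f = label_claims X2 f.
  move=> h; rewrite /label_claims has_cat orbC; case: hasP => //= h1.
  apply/hasP => -[t ht /andP[hv hs]]; apply: h1; exists t; rewrite ?hv //.
  by apply: cross1 => //; rewrite /touches; case/orP: hv => /eqP->; rewrite h ?orbT.
rewrite (ex_value E1) (ex_value E2) /=.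
rewrite (sum_inside_split F (fun f => f.1.1) _ _ l1 l2).
rewrite (sum_inside_split L (fun l => l.1.2) _ _ l1 l2) opprD addrACA.
congr (_ + _ + (- _ - _))%R; apply: eq_bigl.
- by move=> f; case h: inside => //=; rewrite claims1.
- by move=> f; case h: inside => //=; rewrite claims2.
- by move=> l; case h: inside => //=; rewrite uses1 // /touches h orbT.
- by move=> l; case h: inside => //=; rewrite uses2 // /touches h orbT.
Qed.

Lemma derivable_explains k c : derivable alpha x k c -> exists X, explains k c X.
Proof.
elim=> {k c} [k hU hl|k1 k2 k c1 c2 hU _ [X1 E1] _ [X2 E2] hm].
  by exists (map fst k.2); exact: explains_leaf.
by exists (X1 ++ X2); exact: (explains_merge hU hm E1 E2).
Qed.

(** Follow the justifications from [t]. While the current link is inner to [[i, j]], it is not the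
    target, and the next link meets it and so touches [[i, j]]. Since ranks drop, some link of the
    chain must leave. *)
Lemma explains_cut k c X i j t : explains k c X ->
  (forall s, s \in X -> satisfied X s) -> t \in X ->
  touches i j t.1.1 -> ~~ inner i j t.1.2 ->
  exists l, label_uses X l && leaves i j l.
Proof.
move=> E sat; have [r] := ubnP t.2; elim: r t => // r IH t ht hX tt nt.
have [hl|nl] := boolP (leaves i j t.1.1).
  by exists t.1.1; rewrite hl andbT; apply/hasP; exists t.
have hi : inner i j t.1.1 by move: tt; rewrite touchesE (negbTE nl) orbF.
case/orP: (sat t hX) => [/eqP e|]; first by rewrite e hi in nt.
move=> /hasP[s hs /andP[/andP[/eqP es lt] hm]].
apply: (IH s); rewrite ?es //; first exact: leq_trans lt ht.
have [/mapP[l hl e] _] := ex_mem E hs.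
by apply: meets_touches hi hm; rewrite e; have /andP[] := L_lt hl.
Qed.

(** Claims based on guessed labels still prove drops, by [explains_cut]. Links are paid for exactly,
    and a drop that is not claimed only lowers the value because [f.2] is nonnegative. *)
Lemma derivable_sound k c : {in F, forall f, 0 <= f.2}%R ->
    {in F, forall f, 0 < f.1.1 < n} -> derivable alpha x k c -> final_ok n k ->
  [/\ uniq c.2, {subset c.2 <= [seq l.1 | l <- L]},
      thin_tree (mem c.2) 1 n.-1 & (c.1 <= gain (mem c.2))%R].
Proof.
move=> F_ge0 F_lt /derivable_explains[X E] /andP[/andP[/eqP ei /eqP ej] /allP hd].
have {}ej : k.1.2 = n.-1 by rewrite -ej.
have memE l : l \in [seq l.1 | l <- L] -> (l \in c.2) = label_uses X l.
  move=> /mapP[l' /L_lt hl' ->]; rewrite (ex_links E) ei ej.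
  by rewrite (inside_top hl') andbT.
have sat t : t \in X -> satisfied X t.
  move=> ht; have [_ h] := ex_mem E ht; move: h; rewrite touchesE => /orP[h|h].
    exact: (ex_inner E).
  by have [b hb] := ex_leaves E ht h; have := ex_done E hb (hd _ hb).
split.
- exact: ex_uniq E.
- move=> l; rewrite (ex_links E) => /andP[/hasP[t ht /eqP <-] _].
  by have [] := ex_mem E ht.
- rewrite -ei -ej; apply: eq_thin_tree (ex_thin E) => l hl _.
  by rewrite -memE.
rewrite (ex_value E) /gain; apply: lerB.
  rewrite big_mkcond [leRHS]big_mkcond big_seq [leRHS]big_seq /=.
  apply: ler_sum => f hf; case: ifP => [/andP[_ hc]|_]; last first.
    by case: ifP => // _; exact: F_ge0.
  case: ifPn => // /asboolPn hn; case: hn => i j i0 hv jn nB.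
  have /hasP[t ht /andP[tv ts]] := hc.
  have tt : touches i j t.1.1.
    by rewrite /touches; case/orP: tv => /eqP->; rewrite hv ?orbT.
  (* The interval contains the head and no blocked vertex; with both endpoints of the target it
     would also contain the blocked vertex that separates one of them from the head. *)
  have ni : ~~ inner i j t.1.2.
    apply/negP => /andP[h1 h2]; move: nB => /hasPn nB; case/orP: ts => /hasP[y hy sy];
      by have /negP := nB y hy; apply; exact: separates_inside sy hv _.
  have [l /andP[hl ll]] := explains_cut E sat ht tt ni.
  have hL : l \in [seq l.1 | l <- L].
    by have /hasP[s hs /eqP <-] := hl; have [] := ex_mem E hs.
  move/mapP: (hL) => [l' hl' el]; apply/hasP; exists l' => //.
  by rewrite -el ll andbT /= memE.
rewrite big_mkcond [leRHS]big_mkcond big_seq [leRHS]big_seq /= le_eqVlt; apply/orP; left.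
apply/eqP/eq_bigr => l hl; rewrite memE ?map_f //.
by rewrite ei ej (inside_top (L_lt hl)).
Qed.

Section Completeness.
Variables (K : pred link) (rho1 rho2 : link -> link) (d : link -> link -> nat).
Let Kl := [seq l.1 | l <- [seq l <- L | K l.1]].
Hypothesis rho1P : labelled n Kl rho1 d.
Hypothesis rho2P : labelled n Kl rho2 d.

Let labels_of l : seq label := [:: (l, rho1 l, d (rho1 l) l); (l, rho2 l, d (rho2 l) l)].
Let is_label (t : label) := (t.1.1 \in Kl) && (t \in labels_of t.1.1).
Let near i j := flatten [seq labels_of l | l <- [seq l <- Kl | touches i j l]].
(** Bits are set as early as possible: as soon as a justification touches [[i, j]], even if that
    link is already inner and no longer in the state. *)
Let state_of i j : state := [seq (t, satisfied (near i j) t) |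
  t <- flatten [seq labels_of l | l <- [seq l <- Kl | leaves i j l]]].

Let mem_labels t l : t \in labels_of l -> t.1.1 = l.
Proof. by rewrite !inE => /orP[] /eqP->. Qed.

Let mem_flatten_labels (p : pred link) t :
  (t \in flatten [seq labels_of l | l <- [seq l <- Kl | p l]]) = is_label t && p t.1.1.
Proof.
apply/flatten_mapP/andP => [[l]|[/andP[h1 h2] h3]].
  rewrite mem_filter => /andP[hp hl] ht; have e := mem_labels ht.
  by rewrite /is_label e hl hp ht.
by exists t.1.1; rewrite ?mem_filter ?h3.
Qed.

Let mem_near i j t : (t \in near i j) = is_label t && touches i j t.1.1.
Proof. exact: mem_flatten_labels. Qed.

Let mem_state i j e : (e \in state_of i j) =
  [&& is_label e.1, leaves i j e.1.1.1 & e.2 == satisfied (near i j) e.1].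
Proof.
case: e => t b /=; apply/mapP/and3P => [[t' ht [-> ->]]|[h1 h2 /eqP->]].
  by move: ht; rewrite mem_flatten_labels => /andP[-> ->].
by exists t; rewrite // mem_flatten_labels h1.
Qed.

Let mem_Kl l : l \in Kl = K l && (l \in [seq l.1 | l <- L]).
Proof.
apply/mapP/andP => [[l']|[hK /mapP[l' hl e]]].
  by rewrite mem_filter => /andP[h1 h2] ->; rewrite h1 map_f.
by exists l'; rewrite // mem_filter hl -e hK.
Qed.

Let Kl_lt (l : link) : l \in Kl -> l.1 < l.2 < n.
Proof. by rewrite mem_Kl => /andP[_ /mapP[l' /L_lt h ->]]. Qed.

Let is_labelP t : is_label t -> [/\ t.1.1 \in Kl, t.1.2 \in Kl, t.2 < n * n &
  t.1.2 = t.1.1 \/ exists s, [/\ is_label s, s.1.2 = t.1.2, s.2 < t.2 & meets t.1.1 s.1.1]].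
Proof.
move=> /andP[hl]; have [h1 h2 h3] := rho1P hl; have [h4 h5 h6] := rho2P hl.
rewrite !inE => /orP[] /eqP->; split=> //=.
  case: h3 => [->|[m [hm mm e lt]]]; [by left | right].
  exists (m, rho1 m, d (rho1 m) m); rewrite /= e; split=> //.
  by rewrite /is_label /= hm inE e eqxx.
case: h6 => [->|[m [hm mm e lt]]]; [by left | right].
exists (m, rho2 m, d (rho2 m) m); rewrite /= e; split=> //.
by rewrite /is_label /= hm !inE e eqxx orbT.
Qed.

Let uses_state i j l : uses (state_of i j) l = (l \in Kl) && leaves i j l.
Proof.
apply/hasP/andP => [[e]|[h1 h2]].
  by rewrite mem_state => /and3P[/andP[h1 _] h2 _] /eqP <-.
pose t : label := (l, rho1 l, d (rho1 l) l).
exists (t, satisfied (near i j) t); last by rewrite /ent_link /=.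
by rewrite mem_state /= h2 eqxx /is_label /= h1 inE eqxx.
Qed.

Let key_universe i j : i < n -> j < n -> cut_size K i j <= alpha ->
  (i, j, state_of i j) \in universe alpha x.
Proof.
move=> hi hj hc; rewrite mem_universe /= hi hj /=; apply/and3P; split.
- apply/allP => e; rewrite mem_state => /and3P[/is_labelP[h1 h2 h3 _] _ _].
  rewrite /= mem_alphabet h3 andbT.
  by move: h1 h2; rewrite !mem_Kl => /andP[_ ->] /andP[_ ->].
- rewrite size_map size_flatten /shape -map_comp.
  rewrite (eq_map (g := fun=> 2)) // sumnE big_map big_const_seq count_predT.
  rewrite iter_addn_0 mul2n -addnn /Kl filter_map size_map -filter_predI.
  have -> : size [seq l <- L | predI (preim fst (leaves i j)) (fun l => K l.1) l] =
      cut_size K i j.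
    by rewrite /cut_size; congr size; apply: eq_filter => l /=; rewrite andbC.
  exact: leq_add.
apply/andP; split; first by apply/allP => e; rewrite mem_state => /and3P[].
rewrite (leq_trans _ hc) // /cut_size /=.
rewrite (eq_in_filter (a2 := fun l => K l.1 && leaves i j l.1)) // => l hl.
by rewrite uses_state mem_Kl map_f // andbT.
Qed.

Let witnessed_state i j t b : (forall s : label, is_label s -> touches i j s.1.1 ->
    meets t.1.1 s.1.1 -> leaves i j s.1.1) ->
  satisfied (near i j) t -> witnessed (state_of i j) (t, b).
Proof.
rewrite /witnessed /ent_link /ent_target /ent_rank /= => h /orP[->//|/hasP[s]].
rewrite mem_near => /andP[h1 h2] /andP[h3 h4]; apply/orP; right.
apply/hasP; exists (s, satisfied (near i j) s); last by rewrite h4 andbT.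
by rewrite mem_state /= h1 eqxx h.
Qed.

Let touches_leaves v (l : link) : l \in Kl -> touches v v l -> leaves v v l.
Proof. by move=> /Kl_lt; rewrite leavesE /touches /inside; lia. Qed.

Let leaf_ok_state v : leaf_ok (v, v, state_of v v).
Proof.
rewrite /leaf_ok /= eqxx /=; apply/allP => -[t b].
rewrite mem_state => /and3P[/= ht hl /eqP->]; apply/implyP => hs.
by apply: witnessed_state hs => s /andP[hs _] h _; exact: touches_leaves.
Qed.

(** Stated for an ordered pair of halves, to serve both orders. When a link becomes inner, its
    justification touches [[i, j]] and hence one of the halves, where the bit is then set. *)
Let forwards_state i j i' j' i'' j'' :
  (forall l : link, l \in Kl -> leaves i' j' l -> inner i j l -> leaves i'' j'' l) ->
  (forall l : link, l \in Kl -> leaves i' j' l -> ~~ inner i j l -> leaves i j l) ->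
  (forall l : link, touches i j l -> touches i' j' l || touches i'' j'' l) ->
  forwards i j (state_of i' j') (state_of i'' j'') (state_of i j).
Proof.
move=> hin hout ht; apply/allP => -[t b]; rewrite mem_state => /and3P[/= h1 h2 /eqP ->].
have [hK _ _ hw] := is_labelP h1; rewrite /ent_link /=; case: ifPn => hi.
  apply/hasP; exists (t, satisfied (near i'' j'') t).
    by rewrite mem_state /= h1 eqxx hin.
  rewrite eqxx /= /ent_done /=.
  case: hw => [/eqP e|[s [s1 /eqP s2 s3 s4]]]; first by rewrite /satisfied e.
  have [sK _ _ _] := is_labelP s1.
  have /ht /orP[hs|hs] : touches i j s.1.1.
    by apply: meets_touches hi s4; have /andP[] := Kl_lt sK.
    apply/orP; left; apply/orP; right; apply/hasP; exists s; last by rewrite s2 s3.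
    by rewrite mem_near s1.
  apply/orP; right; apply/orP; right; apply/hasP; exists s; last by rewrite s2 s3.
  by rewrite mem_near s1.
apply/hasP; exists (t, satisfied (near i j) t); last by rewrite eqxx.
by rewrite mem_state /= h1 eqxx hout.
Qed.

Let merge_ok_state i m j : i <= m < j ->
  merge_ok (i, m, state_of i m) (m.+1, j, state_of m.+1 j) (i, j, state_of i j).
Proof.
move=> imj; apply/and5P; split=> //=; rewrite ?eqxx //.
  apply: forwards_state => [l _|l _|l]; rewrite ?leavesE /inner /touches /inside; lia.
apply/andP; split.
  apply: forwards_state => [l _|l _|l]; rewrite ?leavesE /inner /touches /inside; lia.
apply/allP => -[t b]; rewrite mem_state => /and3P[/= h1 h2 /eqP ->].
rewrite has_cat /ent_done /=; have [hK _ _ _] := is_labelP h1.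
(* [t] survives the merge and comes from the half [[i', j']]. A justifying [s] that touches this
   half has set the bit there. Otherwise [s] touches only the other half, which [t] avoids; as [t]
   meets [s], the latter is not inner there, so it leaves [[i, j]] and is found in the parent
   state. *)
have side i' j' i'' j'' : leaves i' j' t.1.1 ->
    (forall l : link, touches i j l -> touches i' j' l || touches i'' j'' l) ->
    (forall s : label, is_label s -> ~~ touches i' j' s.1.1 -> touches i'' j'' s.1.1 ->
       meets t.1.1 s.1.1 -> leaves i j s.1.1) ->
    has (fun f => (f.1 == t) && (satisfied (near i j) t ==>
      f.2 || witnessed (state_of i j) (t, satisfied (near i j) t))) (state_of i' j').
  move=> hl hc hs; apply/hasP; exists (t, satisfied (near i' j') t).
    by rewrite mem_state /= h1 eqxx hl.
  rewrite eqxx /=; apply/implyP => /orP[e|/hasP[s]]; first by rewrite /satisfied e.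
  rewrite mem_near => /andP[s1 /hc ts] /andP[s3 s4].
  have [t1|t1] := boolP (touches i' j' s.1.1).
    apply/orP; left; apply/orP; right; apply/hasP; exists s; last by rewrite s3 s4.
    by rewrite mem_near s1.
  have lv : leaves i j s.1.1 by apply: hs => //; rewrite (negbTE t1) in ts.
  apply/orP; right; apply/orP; right; apply/hasP.
  exists (s, satisfied (near i j) s); last by rewrite /= s3 s4.
  by rewrite mem_state /= s1 lv eqxx.
have meetsP (s : label) : is_label s -> meets t.1.1 s.1.1 -> meets s.1.1 t.1.1 /\ t.1.1.1 < t.1.1.2.
  by move=> _; rewrite meetsC; split=> //; have /andP[] := Kl_lt hK.
have [hl|hl] := boolP (leaves i m t.1.1).
  apply/orP; left; apply: (side _ _ m.+1 j) => //.
    by move=> l; rewrite /touches /inside; lia.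
  move=> s s1 n1 n2 /(meetsP _ s1)[ms lt]; apply: (touches_right_leaves imj n1 n2).
  apply/negP => hi; have := meets_touches lt hi ms.
  by rewrite (negbTE (leaves_left_only imj hl h2)).
have hl' : leaves m.+1 j t.1.1.
  by have := leaves_either imj h2; rewrite (negbTE hl).
apply/orP; right; apply: (side _ _ i m) => //.
  by move=> l; rewrite /touches /inside; lia.
move=> s s1 n1 n2 /(meetsP _ s1)[ms lt]; apply: (touches_left_leaves imj n1 n2).
apply/negP => hi; have := meets_touches lt hi ms.
by rewrite (negbTE (leaves_right_only imj hl' h2)).
Qed.

Let value i j : R :=
  (\sum_(f <- F | inside i j f.1.1 && claims (f.1.1, f.1.1, state_of f.1.1 f.1.1) f) f.2 -
   \sum_(l <- L | inside i j l.1.2 && K l.1) l.2)%R.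

Lemma derivable_state i j : thin_tree K i j -> 0 < i -> j < n ->
  exists2 c, derivable alpha x (i, j, state_of i j) c & c.1 = value i j.
Proof.
elim=> {i j} [v hc i0 jn|i m j hc t1 IH1 t2 IH2 i0 jn].
  exists (leaf_cand x (v, v, state_of v v)).
    by apply: derivable_leaf (leaf_ok_state v); exact: key_universe.
  rewrite /leaf_cand /value /= !big_filter.
  have insideE u : inside v v u = (u == v) by rewrite /inside eqn_leq andbC.
  congr (_ - _)%R; first apply: eq_bigl => f.
    by rewrite insideE /claims /=; case: eqP => //= ->; rewrite eqxx.
  rewrite big_mkcond [RHS]big_mkcond big_seq [RHS]big_seq; apply: eq_bigr => l hl.
  rewrite insideE /pays uses_state mem_Kl map_f // andbT /=; case: eqP => //= e.
  case: (K l.1) => //=; have := L_lt hl; rewrite leavesE !insideE e eqxx /=.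
  by move=> /andP[lt _]; rewrite andbF (ltn_eqF lt).
have [l1 l2] := (thin_tree_le t1, thin_tree_le t2).
have [c1 D1 v1] := IH1 i0 (leq_trans l2 (ltnW jn)).
have [c2 D2 v2] := IH2 (ltn0Sn _) jn.
exists ((c1.1 + c2.1)%R, c1.2 ++ c2.2).
  apply: derivable_merge D1 D2 _; last by apply: merge_ok_state; rewrite l1.
  by apply: key_universe => //; lia.
rewrite /= v1 v2 /value.
rewrite (sum_inside_split F (fun f => f.1.1) _ _ l1 l2).
by rewrite (sum_inside_split L (fun l => l.1.2) _ _ l1 l2) opprD addrACA.
Qed.

(** The larger endpoint of every link lies in [[1, n - 1]], so all justifications touch the top
    interval and all bits are set. *)
Lemma final_ok_state : 1 < n -> final_ok n (1, n.-1, state_of 1 n.-1).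
Proof.
move=> n1; rewrite /final_ok /= prednK ?(ltnW n1) // eqxx /=.
apply/allP => -[t b]; rewrite mem_state => /and3P[/is_labelP[_ _ _ h] _ /eqP /= ->].
rewrite /ent_done /=; case: h => [/eqP e|[s [s1 /eqP s2 s3 s4]]]; first by rewrite /satisfied e.
apply/orP; right; apply/hasP; exists s; last by rewrite s2 s3.
rewrite mem_near s1 /touches; have [sK _ _ _] := is_labelP s1.
by rewrite (inside_top (Kl_lt sK)) orbT.
Qed.

(** With true labels no drop is missed. The singleton of the head is a cut that must be crossed, so
    some link of [K] ends there, and the hull of its component turns out to contain a blocked
    vertex. *)
Lemma gain_value :
    (forall l, l \in Kl -> inner (rho1 l).1 (rho2 l).2 l /\
        forall m, m \in Kl -> ~~ leaves (rho1 l).1 (rho2 l).2 m) ->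
    {in F, forall f, 0 <= f.2}%R ->
    {in F, forall f : nat * seq nat * R, [/\ 0 < f.1.1 < n, f.1.1 \notin f.1.2 & 0 \in f.1.2]} ->
  (gain K <= value 1 n.-1)%R.
Proof.
move=> hull F_ge0 FP; apply: lerB.
  rewrite big_mkcond [leRHS]big_mkcond big_seq [leRHS]big_seq /=.
  apply: ler_sum => f hf; case: ifP => [/asboolP hd|_]; last first.
    by case: ifP => // _; exact: F_ge0.
  case: ifPn => // /negP; case; have [vn vB B0] := FP f hf.
  have vi : inside 1 n.-1 f.1.1 by move: vn; rewrite /inside; lia.
  rewrite vi /=; set v := f.1.1 in vi vn vB hd *.
  have /hasP[l hl /andP[Kl1 lv]] : has (fun l => K l.1 && leaves v v l.1) L.
    apply: hd; [by case/andP: vn | by rewrite /inside leqnn | by case/andP: vn |].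
    apply/hasPn => y hy; apply/negP => /andP[h1 h2]; move: vB.
    by rewrite (_ : v = y) ?hy //; lia.
  have lK : l.1 \in Kl by rewrite mem_Kl Kl1 map_f.
  have [hin hcl] := hull _ lK.
  have [r1 _ _] := rho1P lK; have [r2 _ _] := rho2P lK.
  set a := (rho1 l.1).1 in hin hcl; set b := (rho2 l.1).2 in hin hcl.
  have vab := inner_point hin lv.
  (* If the hull reaches position 0, the root separates. Otherwise the hull is an interval around
     [v] that no link of [K] leaves, so [dropped] forces a blocked vertex into it. *)
  have [y hy sy] : exists2 y, y \in f.1.2 & separates v a y || separates v b y.
    have [a0|a0] := posnP a.
      by exists 0 => //; have /andP[v0 _] := vn; rewrite /separates a0 leqnn v0 orbT.
    apply: contrapT => hn.
    have /hasP[m hm /andP[Km lm]] : has (fun l => K l.1 && leaves a b l.1) L.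
      apply: hd => //; first by have /andP[_] := Kl_lt r2.
      apply/hasPn => y hy; apply/negP => hi; apply: hn; exists y => //.
      by apply: hull_separates vab hi _; apply: contraNneq vB => ->.
    by have := hcl m.1; rewrite mem_Kl Km map_f // lm => /(_ isT).
  apply/andP; split; first by rewrite eqxx.
  have in_state r dd : (l.1, r, dd) \in labels_of l.1 ->
      ((l.1, r, dd), satisfied (near v v) (l.1, r, dd)) \in state_of v v.
    by move=> h; rewrite mem_state /= eqxx lv /is_label /= lK h.
  case/orP: sy => sy; apply/hasP.
    exists ((l.1, rho1 l.1, d (rho1 l.1) l.1),
      satisfied (near v v) (l.1, rho1 l.1, d (rho1 l.1) l.1)).
      by apply: in_state; rewrite inE eqxx.
    by apply/orP; left; apply/hasP; exists y.
  exists ((l.1, rho2 l.1, d (rho2 l.1) l.1),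
    satisfied (near v v) (l.1, rho2 l.1, d (rho2 l.1) l.1)).
    by apply: in_state; rewrite !inE eqxx orbT.
  by apply/orP; right; apply/hasP; exists y.
rewrite big_mkcond [leRHS]big_mkcond big_seq [leRHS]big_seq /= le_eqVlt; apply/orP; left.
by apply/eqP/eq_bigr => l hl; rewrite (inside_top (L_lt hl)).
Qed.

Lemma complete_of_labels : 1 < n -> thin_tree K 1 n.-1 ->
    (forall l, l \in Kl -> inner (rho1 l).1 (rho2 l).2 l /\
        forall m, m \in Kl -> ~~ leaves (rho1 l).1 (rho2 l).2 m) ->
    {in F, forall f, 0 <= f.2}%R ->
    {in F, forall f : nat * seq nat * R, [/\ 0 < f.1.1 < n, f.1.1 \notin f.1.2 & 0 \in f.1.2]} ->
  exists k c, [/\ derivable alpha x k c, final_ok n k & (gain K <= c.1)%R].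
Proof.
move=> n1 t hull F_ge0 FP; have [|c D v] := derivable_state t (ltn0Sn _); first lia.
exists (1, n.-1, state_of 1 n.-1), c.
by split=> //; [exact: final_ok_state | rewrite v; exact: gain_value].
Qed.

End Completeness.

Lemma derivable_complete (K : pred link) : 1 < n -> {in F, forall f, 0 <= f.2}%R ->
    {in F, forall f : nat * seq nat * R, [/\ 0 < f.1.1 < n, f.1.1 \notin f.1.2 & 0 \in f.1.2]} ->
    thin_tree K 1 n.-1 ->
  exists k c, [/\ derivable alpha x k c, final_ok n k & (gain K <= c.1)%R].
Proof.
move=> n1 F_ge0 FP t.
have Ku : uniq [seq l.1 | l <- [seq l <- L | K l.1]].
  by apply: subseq_uniq L_uniq; apply/map_subseq/filter_subseq.
have Klt (l : link) : l \in [seq l.1 | l <- [seq l <- L | K l.1]] -> l.1 < l.2 < n.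
  by move=> /mapP[l']; rewrite mem_filter => /andP[_ /L_lt h] ->.
have [rho1 [rho2 [d [h1 h2 h3]]]] := labels_exist Ku Klt.
exact: complete_of_labels h1 h2 n1 t h3 F_ge0 FP.
Qed.

Lemma solve_correct : 1 < n -> {in F, forall f, 0 <= f.2}%R ->
    {in F, forall f : nat * seq nat * R, [/\ 0 < f.1.1 < n, f.1.1 \notin f.1.2 & 0 \in f.1.2]} ->
  [/\ uniq (solve alpha x), {subset solve alpha x <= [seq l.1 | l <- L]},
      thin_tree (mem (solve alpha x)) 1 n.-1 &
      forall K, thin_tree K 1 n.-1 -> (gain K <= gain (mem (solve alpha x)))%R].
Proof.
move=> n1 F_ge0 FP.
(* The empty link set provides the derivation that [solve_spec] asks for; its tree splits off one
   vertex at a time. *)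
have t0 : thin_tree pred0 1 n.-1.
  have c0 i j : cut_size pred0 i j <= alpha by rewrite /cut_size filter_pred0.
  rewrite (_ : n.-1 = (1 + n.-2)%N); last lia.
  elim: n.-2 1%N => [|m IH] i; first by rewrite addn0; exact: thin_leaf.
  apply: (@thin_node _ _ i) => //; first exact: thin_leaf.
  by rewrite addnS -addSn; exact: IH.
have [k0 [c0 [D0 f0 _]]] := derivable_complete n1 F_ge0 FP t0.
have [c <- [[k D f] hmax]] := solve_spec D0 f0.
have [|h1 h2 h3 h4] := derivable_sound F_ge0 _ D f; first by move=> g /FP[].
split=> // K /(derivable_complete n1 F_ge0 FP)[k' [c' [D' f' le]]].
exact: le_trans le (le_trans (hmax _ _ D' f') h4).
Qed.

End Correctness.

(** * Ring cuts as intervals and thinness *)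

(** [sigma] is used up to index [#|V|], where it returns to the root, so that the closing edge obeys
    the same formula [cc_ends] as the others. *)
Record cycle_coordinates (V E : finType) (ends : E -> {set V}) (r : V) (er : E)
    (sigma : nat -> V) (eps : nat -> E) : Prop := CycleCoordinates {
  cc_gt1 : 1 < #|V|;
  cc_inj : forall i j, i < #|V| -> j < #|V| -> sigma i = sigma j -> i = j;
  cc_edge_inj : forall i j, i < #|V| -> j < #|V| -> eps i = eps j -> i = j;
  cc_edge_onto : forall e, exists2 i, i < #|V| & e = eps i;
  cc_ends : forall i, i < #|V| -> ends (eps i) = [set sigma i; sigma i.+1];
  cc_closed : sigma #|V| = sigma 0;
  cc_root : sigma 0 = r;
  cc_root_edge : ends er = [set r; sigma #|V|.-1] }.

Lemma injective_onto (n : nat) (T : finType) (f : nat -> T) : #|T| = n ->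
  (forall i j, i < n -> j < n -> f i = f j -> i = j) ->
  forall y, exists2 i, i < n & y = f i.
Proof.
move=> cT finj y; pose g (i : 'I_n) := f i.
have ginj : injective g by move=> i j /finj e; apply/val_inj/e.
have /(_ y) /codomP[i ->] := inj_card_onto ginj (eq_leq (etrans cT (esym (card_ord n)))).
by exists i.
Qed.

(** The cycle may be given in either orientation; the direction of the walk is chosen so that the
    root edge comes last. *)
Lemma cycle_coordinatesP (V E : finType) (ends : E -> {set V}) (r : V) (er : E) :
  is_cycle ends -> r \in ends er ->
  exists sigma eps, cycle_coordinates ends r er sigma eps.
Proof.
move=> [n [v [e [n1 vb eb eE]]]] hr; have n0 := ltnW n1.
have cV : #|V| = n by rewrite -(bij_eq_card vb) card_ord.
have cE : #|E| = n by rewrite -(bij_eq_card eb) card_ord.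
pose o k := Ordinal (ltn_pmod k n0).
have oE a b : a = b %[mod n] -> o a = o b by move=> h; apply: val_inj.
have oI a b : o a = o b -> a = b %[mod n] by move=> /(congr1 val).
have ordSo k : ordS (o k) = o k.+1.
  by apply: val_inj; rewrite /= -[(k %% n).+1]addn1 modnDml addn1.
have vI := bij_inj vb; have eI := bij_inj eb.
have [g _ ge] := eb; pose j := val (g er).
have erE : er = e (o j).
  by rewrite -[LHS]ge; congr e; apply: val_inj; rewrite /= modn_small ?ltn_ord.
move: (hr); rewrite erE eE ordSo in_set2 => /orP[] /eqP rE.
  have inj a b : a <= n -> b <= n -> a - b < n -> b - a < n ->
      j + n - a = j + n - b %[mod n] -> a = b.
    wlog ab : a b / a <= b => [hw ha hb h1 h2 h|ha hb _ h2 /eqP].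
      by case/orP: (leq_total a b) => hab; [exact: hw | exact/esym/hw].
    rewrite eqn_mod_dvd; last by lia.
    rewrite (_ : _ - _ = b - a)%N; last by lia.
    by case: (posnP (b - a)) => [h _|h /(dvdn_leq h)]; lia.
  (* Here the root is the first endpoint of the root edge, so the walk runs against the given
     orientation. Adding [n] avoids truncated subtraction; the edge between positions [k] and
     [k + 1] carries the smaller original index, hence the shift. *)
  exists (fun k => v (o (j + n - k))), (fun k => e (o (j + n - k.+1))).
  have injS a b : a < n -> b < n -> e (o (j + n - a.+1)) = e (o (j + n - b.+1)) -> a = b.
    move=> ha hb /eI/oI h; apply: succn_inj; apply: inj h => //; lia.
  split; rewrite ?cV //.
  - by move=> a b ha hb /vI/oI; apply: inj; lia.
  - exact: injective_onto.
  - move=> i hi; rewrite eE ordSo setUC; congr [set v (o _); _]; lia.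
  - by congr v; apply: oE; rewrite addnK subn0 modnDr.
  - by rewrite subn0 rE; congr v; apply: oE; rewrite modnDr.
  rewrite eE ordSo rE; congr [set _; v (o _)]; lia.
exists (fun k => v (o (j.+1 + k))), (fun k => e (o (j.+1 + k))).
have inj a b : a < n -> b < n -> j.+1 + a = j.+1 + b %[mod n] -> a = b.
  by move=> ha hb /eqP; rewrite eqn_modDl !modn_small // => /eqP.
split; rewrite ?cV //.
- by move=> a b ha hb /vI/oI; exact: inj.
- by move=> a b ha hb /eI/oI; exact: inj.
- apply: injective_onto => // a b ha hb /eI/oI; exact: inj.
- by move=> i _; rewrite eE ordSo addnS.
- by congr v; apply: oE; rewrite addn0 modnDr.
- by rewrite addn0 rE.
rewrite eE ordSo -rE setUC; congr [set _; v _]; apply: oE.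
by rewrite addSnnS prednK // modnDr.
Qed.

Lemma card_pairI (T : finType) (u v : T) (C : {set T}) : u != v ->
  (#|[set u; v] :&: C| == 1) = (u \in C) (+) (v \in C).
Proof.
move=> uv; rewrite -sum1_card (eq_bigl (fun w => (w \in [set u; v]) && (w \in C))); last first.
  by move=> w; rewrite in_setI.
rewrite big_mkcondr /= big_setU1 ?inE // big_set1.
by case: (u \in C); case: (v \in C).
Qed.

Lemma inside_step i j k : 0 < i -> i <= j ->
  inside i j k (+) inside i j k.+1 = (k == i.-1) || (k == j).
Proof.
move=> i0 ij; have -> a b : a (+) b = a && ~~ b || ~~ a && b by case: a; case: b.
by rewrite /inside; apply/idP/idP; lia.
Qed.

Section Positions.
Variables (R : realType) (I : rooted_wrap R).
Variables (sigma : nat -> vertex I) (eps : nat -> edge I).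
Hypothesis cc : cycle_coordinates (@ends R I) (Defs.root I) (root_edge I) sigma eps.
Local Notation V := (vertex I).
Local Notation n := #|vertex I|.

Definition pos (v : V) : nat := index v [seq sigma i | i <- iota 0 n].
Definition vsegment (i j : nat) : {set V} := [set v | inside i j (pos v)].
Definition chord (l : link) : {set V} := [set sigma l.1; sigma l.2].

Lemma sigma_onto v : exists2 i, i < n & v = sigma i.
Proof. by apply: injective_onto => //; exact: (cc_inj cc). Qed.

Lemma posK v : sigma (pos v) = v.
Proof.
have [i hi e] := sigma_onto v.
have hv : v \in [seq sigma i | i <- iota 0 n] by rewrite e map_f // mem_iota.
have := hv; rewrite -index_mem size_map size_iota => h.
by rewrite -[RHS](nth_index (sigma 0) hv) (nth_map 0) ?size_iota // nth_iota.
Qed.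

Lemma pos_lt v : pos v < n.
Proof.
have [i hi e] := sigma_onto v.
have : v \in [seq sigma i | i <- iota 0 n] by rewrite e map_f // mem_iota.
by rewrite -index_mem size_map size_iota.
Qed.

Lemma sigmaK i : i < n -> pos (sigma i) = i.
Proof. by move=> hi; apply: (cc_inj cc) => //; [exact: pos_lt | exact: posK]. Qed.

Lemma pos_inj : injective pos.
Proof. by move=> u v e; rewrite -[u]posK e posK. Qed.

Lemma pos_root : pos (Defs.root I) = 0.
Proof. by rewrite -(cc_root cc) sigmaK // ltnW // (cc_gt1 cc). Qed.

Lemma pos_eq0 v : (pos v == 0) = (v == Defs.root I).
Proof. by rewrite -pos_root (inj_eq pos_inj). Qed.

Lemma cut_eps (C : {set V}) i : i < n ->
  (eps i \in cut (@ends R I) setT C) = (sigma i \in C) (+) (sigma i.+1 \in C).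
Proof.
move=> hi; rewrite !inE /= (cc_ends cc) // card_pairI //.
apply/eqP => e; have n1 := cc_gt1 cc.
have [hS|] := ltnP i.+1 n; first by have := cc_inj cc hi hS e; lia.
move=> hn; have eS : i.+1 = n by apply/eqP; rewrite eqn_leq hi hn.
rewrite eS (cc_closed cc) in e; have := cc_inj cc hi (ltnW n1) e; lia.
Qed.

Lemma interval_ring_cut i j : 0 < i -> i <= j -> j < n -> vsegment i j \in ring_cuts I.
Proof.
move=> i0 ij jn; rewrite !inE pos_root /inside leqn0 gtn_eqF //=.
(* The value [k = n] occurs at the closing edge; there [sigma] gives the root, outside the segment
   since [0 < i], and [n] itself is outside since [j < n]. *)
have P k : k <= n -> (sigma k \in vsegment i j) = inside i j k.
  move=> hk; rewrite inE; have [h|h] := ltnP k n; first by rewrite sigmaK.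
  have -> : k = n by apply/eqP; rewrite eqn_leq hk h.
  by rewrite (cc_closed cc) (cc_root cc) pos_root /inside; lia.
rewrite (_ : cut _ _ _ = [set eps i.-1; eps j]); last first.
  apply/setP => e; have [k hk ->] := cc_edge_onto cc e.
  rewrite cut_eps // !P ?(ltnW hk) // in_set2.
  rewrite (_ : (eps k == eps i.-1) = (k == i.-1)); last first.
    by apply/eqP/eqP => [/(cc_edge_inj cc hk)|->//]; apply; lia.
  rewrite (_ : (eps k == eps j) = (k == j)); last first.
    by apply/eqP/eqP => [/(cc_edge_inj cc hk)|->//]; apply.
  exact: inside_step.
rewrite cards2 (_ : eps i.-1 != eps j) //; apply/eqP => /(cc_edge_inj cc).
by move=> h; have := h _ jn; lia.
Qed.

(** Let [i] and [j] be the least and greatest positions in [C]. The edges just before [i] and just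
    after [j] are cut, so they are the only two, and membership cannot change in between. *)
Lemma ring_cut_interval C : C \in ring_cuts I ->
  exists i j, [/\ 0 < i, i <= j, j < n & C = vsegment i j].
Proof.
rewrite inE => /andP[rC /eqP cut2]; have n1 := cc_gt1 cc.
pose P k := (k < n) && (sigma k \in C).
have exP : exists k, P k.
  have [C0|[v vC]] := set_0Vmem C; last first.
    by exists (pos v); rewrite /P pos_lt posK.
  move: cut2; rewrite (_ : cut _ _ _ = set0) ?cards0 //.
  apply/setP => e; have [k hk ->] := cc_edge_onto cc e.
  by rewrite cut_eps // C0 !inE.
have ubP k : P k -> k <= n by move=> /andP[/ltnW].
pose i := ex_minn exP; pose j := ex_maxn exP ubP.
have [iP imin] : P i /\ forall k, P k -> i <= k by rewrite /i; case: ex_minnP.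
have [jP jmax] : P j /\ forall k, P k -> k <= j by rewrite /j; case: ex_maxnP.
have /andP[jn jC] := jP; have /andP[iN iC] := iP.
have ij : i <= j by exact: imin.
have i0 : 0 < i.
  rewrite lt0n; apply: contraNneq rC => e; by rewrite -(cc_root cc) -e.
have ci : eps i.-1 \in cut (@ends R I) setT C.
  rewrite cut_eps; last lia.
  rewrite prednK // iC addbT; apply/negP => h.
  by have := imin i.-1; rewrite /P h andbT; lia.
have cj : eps j \in cut (@ends R I) setT C.
  rewrite cut_eps // jC /=; apply/negP => h.
  have [jS|jS] := ltnP j.+1 n; first by have := jmax j.+1; rewrite /P jS h => /(_ isT); lia.
  by move: h; rewrite (_ : j.+1 = n) ?(cc_closed cc) ?(cc_root cc) ?(negbTE rC) //; lia.
have ne : eps i.-1 != eps j.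
  by apply/eqP => /(cc_edge_inj cc) h; have := h _ jn; lia.
have cutE : [set eps i.-1; eps j] = cut (@ends R I) setT C.
  by apply/eqP; rewrite eqEcard cut2 cards2 ne subUset !sub1set ci cj.
have run k : k <= j - i -> sigma (i + k) \in C.
  elim: k => [|k IH] hk; first by rewrite addn0.
  have {}IH := IH (ltnW hk).
  have kn : i + k < n by move: hk ij jn; clear; lia.
  have : eps (i + k) \notin cut (@ends R I) setT C.
    rewrite -cutE in_set2; apply/norP; split; apply/eqP => /(cc_edge_inj cc kn) h.
      by have := h (leq_ltn_trans (leq_pred _) iN); move: i0; clear; lia.
    by have := h jn; move: hk; clear; lia.
  by rewrite cut_eps // IH /= negbK addnS.
exists i, j; split=> //; apply/setP => v; rewrite inE; apply/idP/idP => [vC|/andP[h1 h2]].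
  have Pv : P (pos v) by rewrite /P pos_lt posK.
  by rewrite /inside imin // jmax.
rewrite -[v]posK -(subnKC h1); apply: run; exact: leq_sub2r.
Qed.

Lemma chord_inj (l m : link) : l.1 < l.2 < n -> m.1 < m.2 < n ->
  chord l = chord m -> l = m.
Proof.
case: l m => [a b] [c d] /= /andP[ab bn] /andP[cd dn] e.
have [an cn] := (ltn_trans ab bn, ltn_trans cd dn).
have h u v : u < n -> v < n -> (sigma u == sigma v) = (u == v).
  by move=> hu hv; apply/eqP/eqP => [|->//]; exact: (cc_inj cc).
have me w : (w \in [set sigma a; sigma b]) = (w \in [set sigma c; sigma d]).
  by rewrite -[[set sigma a; _]]/(chord (a, b)) e.
have := me (sigma a); have := me (sigma b); have := me (sigma c); have := me (sigma d).
rewrite !in_set2 !h //; move: ab cd; clear => ab cd h1 h2 h3 h4.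
by congr (_, _); lia.
Qed.

Lemma chord_leaves (l : link) i j : l.1 < l.2 < n ->
  (#|chord l :&: vsegment i j| == 1) = leaves i j l.
Proof.
move=> /andP[ab bn]; have an := ltn_trans ab bn.
rewrite card_pairI; first by rewrite !inE !sigmaK.
by apply/eqP => /(cc_inj cc an bn) e; rewrite e ltnn in ab.
Qed.

Lemma chord_pos u v : chord (pos u, pos v) = [set u; v].
Proof. by rewrite /chord !posK. Qed.

Lemma chordP (A : {set V}) : #|A| = 2 -> exists2 l : link, l.1 < l.2 < n & A = chord l.
Proof.
move=> /eqP/cards2P[u [v [uv ->]]].
case: (ltngtP (pos u) (pos v)) => [h|h|/pos_inj e]; last by rewrite e eqxx in uv.
  by exists (pos u, pos v); rewrite /= ?h ?pos_lt // chord_pos.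
by exists (pos v, pos u); rewrite /= ?h ?pos_lt // chord_pos setUC.
Qed.

Definition compatible (A B : {set V}) : bool := [|| [disjoint A & B], A \subset B | B \subset A].

Definition nat_compatible (i j p q : nat) : bool :=
  [|| j < p, q < i, (p <= i) && (j <= q) | (i <= p) && (q <= j)].

Lemma nat_compatibleC i j p q : nat_compatible i j p q = nat_compatible p q i j.
Proof. by rewrite /nat_compatible; apply/idP/idP; lia. Qed.

Lemma interval_subset i j p q : i <= j -> j < n ->
  (vsegment i j \subset vsegment p q) = (p <= i) && (j <= q).
Proof.
move=> ij jn; apply/subsetP/andP => [h|[h1 h2] v].
  have := h (sigma i); have := h (sigma j).
  rewrite !inE !sigmaK ?(leq_ltn_trans ij jn) // /inside !leqnn ij.
  by move=> /(_ isT)/andP[_ ->] /(_ isT)/andP[-> _].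
by rewrite !inE /inside => /andP[h3 h4]; rewrite (leq_trans h1) // (leq_trans h4).
Qed.

Lemma interval_disjoint i j p q : i <= j -> j < n -> p <= q -> q < n ->
  [disjoint vsegment i j & vsegment p q] = (j < p) || (q < i).
Proof.
move=> ij jn pq qn; apply/idP/orP => [h|h].
  have hd k : k < n -> ~~ (inside i j k && inside p q k).
    move=> kn; apply/negP => /andP[h1 h2].
    have := disjointFr h (x := sigma k); rewrite !inE sigmaK // h1 h2.
    by move=> /(_ isT).
  have := hd i (leq_ltn_trans ij jn); have := hd p (leq_ltn_trans pq qn).
  by move: ij pq; rewrite /inside; clear; lia.
rewrite disjoint_subset; apply/subsetP => v; rewrite !inE /inside.
by move: (pos v) h => u; lia.
Qed.

Lemma interval_compatible i j p q : i <= j -> j < n -> p <= q -> q < n ->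
  compatible (vsegment i j) (vsegment p q) = nat_compatible i j p q.
Proof.
move=> ij jn pq qn; rewrite /compatible /nat_compatible interval_disjoint //.
by rewrite !interval_subset // -orbA.
Qed.

Lemma interval_inj i j p q : i <= j -> j < n -> p <= q -> q < n ->
  vsegment i j = vsegment p q -> i = p /\ j = q.
Proof.
move=> ij jn pq qn e; have := interval_subset p q ij jn; have := interval_subset i j pq qn.
rewrite e subxx => /esym/andP[h1 h2] /esym/andP[h3 h4].
by split; apply/eqP; rewrite eqn_leq ?h1 ?h2 ?h3 ?h4.
Qed.

Variables (alpha : nat) (x : nat * (seq (link * R) * seq (nat * seq nat * R))).
Local Notation L := x.2.1.
Hypothesis L_lt : forall l : link * R, l \in L -> l.1.1 < l.1.2 < n.
Hypothesis L_uniq : uniq [seq l.1 | l <- L].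
Hypothesis L_links : forall l : link, l.1 < l.2 < n ->
  (l \in [seq l.1 | l <- L]) = (chord l \in links I).

Lemma links_chord (A : {set V}) : A \in links I ->
  exists2 l : link * R, l \in L & A = chord l.1.
Proof.
move=> hA; have [l hl e] := chordP (linksP hA).
by move: hA; rewrite e -L_links // => /mapP[l' hl' ->]; exists l'.
Qed.

Lemma cut_size_card (K : {set {set V}}) i j : K \subset links I ->
  cut_size x (fun l => chord l \in K) i j = #|link_cut K (vsegment i j)|.
Proof.
move=> /subsetP KL; pose s := [seq l <- L | (chord l.1 \in K) && leaves i j l.1].
have us : uniq [seq chord l.1 | l <- s].
  rewrite map_inj_in_uniq; first by apply: filter_uniq; exact: map_uniq L_uniq.
  move=> l m; rewrite !mem_filter => /andP[_ hl] /andP[_ hm] /(chord_inj (L_lt hl) (L_lt hm)).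
  move=> e; move: hl hm e; elim: (L) L_uniq => //= l0 s0 IH /andP[n0 u0].
  rewrite !in_cons => /orP[/eqP->|hl] /orP[/eqP->|hm] e //; last exact: IH.
    by rewrite e map_f in n0.
  by rewrite -e map_f in n0.
rewrite /cut_size -/s -(size_map (fun l => chord l.1)) -(card_uniqP us); apply: eq_card => A.
rewrite !inE; apply/mapP/andP => [[l]|[hA hc]].
  by rewrite mem_filter => /andP[/andP[h1 h2] hl] ->; rewrite h1 chord_leaves ?h2 // L_lt.
have [l hl e] := links_chord (KL _ hA); exists l => //.
by rewrite mem_filter hl -e hA andbT -(chord_leaves _ _ (L_lt hl)) -e.
Qed.

(** Maximality puts every interval compatible with the family into it. The tree is read off from the
    top: [[i, j]] splits after the largest [m < j] with [[i, m]] in the family, which exists because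
    singletons are compatible with everything. *)
Lemma thin_to_tree (K : {set {set V}}) : K \subset links I -> thin alpha K ->
  thin_tree alpha x (fun l => chord l \in K) 1 n.-1.
Proof.
move=> KL [LL [/maxsetP[/andP[/subsetP LLr /forall_inP LLc] LLmax] LLa]].
have n1 := cc_gt1 cc.
have add i j : 0 < i -> i <= j -> j < n ->
    (forall p q, p <= q -> q < n -> vsegment p q \in LL -> nat_compatible i j p q) ->
    vsegment i j \in LL.
  move=> i0 ij jn hc; rewrite -(LLmax (vsegment i j |: LL)) ?setU11 ?subsetUr //.
  have hA A : A \in LL -> compatible (vsegment i j) A && compatible A (vsegment i j).
    move=> hA; have [p [q [p0 pq qn e]]] := ring_cut_interval (LLr _ hA).
    have h : nat_compatible i j p q by apply: hc; rewrite -?e.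
    by rewrite e !interval_compatible // h nat_compatibleC.
  apply/andP; split.
    rewrite subUset sub1set interval_ring_cut //=; exact/subsetP.
  apply/forall_inP => A; rewrite in_setU1 => /orP[/eqP->|/[dup] hAL /hA /andP[h1 h2]].
    apply/forall_inP => B; rewrite in_setU1 => /orP[/eqP->|/hA /andP[]//].
    by rewrite subxx !orbT.
  apply/forall_inP => B; rewrite in_setU1 => /orP[/eqP->//|hB].
  by have /forall_inP := LLc _ hAL; apply.
have bound i j : vsegment i j \in LL -> cut_size x (fun l => chord l \in K) i j <= alpha.
  by move=> /LLa; rewrite cut_size_card.
have comp i j p q : i <= j -> j < n -> p <= q -> q < n ->
    vsegment i j \in LL -> vsegment p q \in LL -> nat_compatible i j p q.
  move=> ij jn pq qn h1 h2; rewrite -interval_compatible //.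
  by have /forall_inP := LLc _ h1; apply.
have tree d : forall i j, j - i < d -> 0 < i -> i <= j -> j < n -> vsegment i j \in LL ->
    thin_tree alpha x (fun l => chord l \in K) i j.
  elim: d => // d IH i j hd i0 ij jn hij.
  have [eij|ne] := eqVneq i j.
    by rewrite -eij in hij *; apply: thin_leaf; exact: bound.
  have lt : i < j by rewrite ltn_neqAle ne.
  pose P m := [&& i <= m, m < j & vsegment i m \in LL].
  have exP : exists m, P m.
    exists i; rewrite /P leqnn lt /=; apply: add => //; first exact: ltn_trans lt jn.
    by move=> p q pq _ _; rewrite /nat_compatible; move: pq; clear; lia.
  have ubP m : P m -> m <= j by move=> /and3P[_ /ltnW].
  case: (ex_maxnP exP ubP) => m /and3P[im mj hm] mmax.
  (* A member straddling the split contains [[i, m]]. Unless it contains all of [[i, j]], it lies in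
     [[i, j]], hence starts at [i] and, by the choice of [m], ends at [j]. So no member crosses
     [[m + 1, j]]. *)
  have hr : vsegment m.+1 j \in LL.
    apply: add => // p q pq qn hD.
    have h1 := comp _ _ _ _ ij jn pq qn hij hD.
    have h2 := comp _ _ _ _ im (ltn_trans mj jn) pq qn hm hD.
    have h3 : p = i -> q < j -> q <= m.
      by move=> e qj; apply: mmax; rewrite /P qj -e hD pq.
    move: h1 h2 h3 im mj pq; rewrite /nat_compatible; clear; lia.
  apply: (@thin_node _ _ _ _ _ m); first exact: bound.
    by apply: IH => //; [move: hd mj im; clear; lia | exact: ltn_trans mj jn].
  by apply: IH => //; move: hd mj im; clear; lia.
apply: (tree n) => //; try by move: n1; clear; lia.
apply: add; try by move: n1; clear; lia.
move=> p q pq qn hD; have [p' [q' [p0 pq' qn' e]]] := ring_cut_interval (LLr _ hD).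
have [ep _] := interval_inj pq qn pq' qn' e.
by rewrite /nat_compatible ep; move: p0 qn; clear; lia.
Qed.

(** The intervals of the tree form the family. For maximality, an interval compatible with both
    halves either lies in one of them, where induction applies, or straddles the split; then it
    contains both halves and is the whole. *)
Lemma tree_to_thin (K : {set {set V}}) : K \subset links I ->
  thin_tree alpha x (fun l => chord l \in K) 1 n.-1 -> thin alpha K.
Proof.
move=> KL t; have n1 := cc_gt1 cc.
have tree i j : thin_tree alpha x (fun l => chord l \in K) i j -> 0 < i -> j < n ->
  exists LL : {set {set V}},
    [/\ forall A, A \in LL -> exists p q, [/\ i <= p, p <= q, q <= j, A = vsegment p q &
             #|link_cut K A| <= alpha],
        forall A B, A \in LL -> B \in LL -> compatible A B,
        vsegment i j \in LL &
        forall p q, i <= p -> p <= q -> q <= j ->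
          (forall A, A \in LL -> compatible (vsegment p q) A) -> vsegment p q \in LL].
  elim=> {t i j} [v hc v0 vn|i m j hc t1 IH1 t2 IH2 i0 jn].
    exists [set vsegment v v]; split.
    - by move=> A /set1P ->; exists v, v; rewrite -cut_size_card.
    - by move=> A B /set1P-> /set1P->; rewrite /compatible subxx !orbT.
    - by rewrite set11.
    move=> p q h1 h2 h3 _; have -> : p = v by move: h1 h2 h3; clear; lia.
    by have -> : q = v; [move: h1 h2 h3; clear; lia | rewrite set11].
  have [l1 l2] := (thin_tree_le t1, thin_tree_le t2).
  have mn : m < n := leq_trans l2 (ltnW jn).
  have [LL1 [a1 a2 a3 a4]] := IH1 i0 mn.
  have [LL2 [b1 b2 b3 b4]] := IH2 (ltn0Sn _) jn.
  have ij : i <= j := leq_trans l1 (ltnW l2).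
  have cross A B : A \in LL1 -> B \in LL2 -> compatible A B && compatible B A.
    move=> /a1[p [q [p1 pq qm -> _]]] /b1[p' [q' [p1' pq' qm' -> _]]].
    rewrite !interval_compatible ?(leq_ltn_trans qm) ?(leq_ltn_trans qm') //.
    rewrite /nat_compatible; move: p1 pq qm p1' pq' qm'; clear; lia.
  have top A : (A \in LL1) || (A \in LL2) -> A \subset vsegment i j.
    case/orP => [/a1|/b1] [p [q [p1 pq qm -> _]]].
      rewrite interval_subset ?(leq_ltn_trans qm) // p1 (leq_trans qm) //; exact: ltnW.
    by rewrite interval_subset ?(leq_ltn_trans qm) // qm (leq_trans _ p1) // (leq_trans l1).
  exists (vsegment i j |: (LL1 :|: LL2)); split.
  - move=> A; rewrite !inE => /or3P[/eqP->|/a1|/b1].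
    + by exists i, j; rewrite -cut_size_card.
    + move=> [p [q [p1 pq qm e c]]]; exists p, q; split=> //.
      by rewrite (leq_trans qm) // ltnW.
    + move=> [p [q [p1 pq qm e c]]]; exists p, q; split=> //.
      by rewrite (leq_trans _ p1) // ltnW.
  - move=> A B; rewrite !in_setU !in_set1 => /orP[/eqP->|hA] /orP[/eqP->|hB].
    + by rewrite /compatible subxx !orbT.
    + by rewrite /compatible top ?orbT.
    + by rewrite /compatible top ?orbT.
    case/orP: hA => hA; case/orP: hB => hB; [exact: a2 | | | exact: b2].
      by have /andP[] := cross _ _ hA hB.
    by have /andP[] := cross _ _ hB hA.
  - by rewrite setU11.
  move=> p q h1 h2 h3 hc'; have qn := leq_ltn_trans h3 jn.
  have c1 : nat_compatible p q i m.
    by rewrite -interval_compatible //; apply: hc'; rewrite !inE a3 ?orbT.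
  have c2 : nat_compatible p q m.+1 j.
    by rewrite -interval_compatible //; apply: hc'; rewrite !inE b3 ?orbT.
  have [qm|qm] := leqP q m.
    rewrite !inE a4 ?orbT // => A hA; apply: hc'; rewrite !inE hA ?orbT //.
  have [pm|pm] := ltnP m p.
    rewrite !inE b4 ?orbT // => A hA; apply: hc'; rewrite !inE hA ?orbT //.
  have [-> ->] : p = i /\ q = j.
    by move: c1 c2 h1 h2 h3 qm pm l1 l2; rewrite /nat_compatible; clear; split; lia.
  by rewrite setU11.
have nn : n.-1 < n by rewrite prednK // ltnW.
have [LL [h1 h2 _ h4]] := tree _ _ t (ltn0Sn 0) nn.
have LLr : LL \subset ring_cuts I.
  apply/subsetP => A /h1[p [q [p1 pq qn -> _]]]; apply: interval_ring_cut => //.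
  exact: leq_ltn_trans qn nn.
exists LL; split; last by move=> A /h1[p [q []]].
apply/maxsetP; split.
  rewrite /laminar_in LLr; apply/forall_inP => A hA; apply/forall_inP => B hB.
  exact: h2.
move=> B /andP[/subsetP Br /forall_inP Bc] sub; apply/eqP; rewrite eqEsubset sub andbT.
apply/subsetP => A hA; have [p [q [p0 pq qn e]]] := ring_cut_interval (Br _ hA).
rewrite e; apply: h4 => //; first by move: qn; clear; lia.
move=> D hD; rewrite -e; have /forall_inP := Bc _ hA; apply.
exact: (subsetP sub).
Qed.

End Positions.

(** * Responsibility and dropped links *)

(** One step of a walk with its newest vertex in front; without a candidate it stays put. It serves
    the numbering of the ring and the backward root paths, and, being polymorphic, both vertices and
    their codes. *)
Definition grow (T : Type) (d : T) (cand : seq T -> seq T) (s : seq T) : seq T :=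
  if (if cand s is [::] then true else false) then s else head d (cand s) :: s.

Lemma map_grow (T T' : Type) (h : T -> T') d d' cand cand' z k :
  (forall s, cand' (map h s) = map h (cand s)) ->
  iter k (grow d' cand') (map h z) = map h (iter k (grow d cand) z).
Proof.
move=> hc; elim: k => //= k ->; rewrite /grow hc.
by case: (cand _) => //=.
Qed.

Definition parents (T : eqType) (d : T) (F : seq (T * T)) (s : seq T) : seq T :=
  [seq f.1 | f <- F & f.2 == head d s].

(** A cut for which [(u, v)] is responsible avoids the root, as every ring cut does, the tail [u],
    and the root path of [u]. If the backward walk does not stand at [r] after [k] steps, no path is
    recorded. *)
Definition blocked_by (T : eqType) (r : T) (F : seq (T * T)) (k : nat) (u : T) : seq T :=
  let s := iter k (grow r (parents r F)) [:: u] in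
  r :: u :: (if head r s == r then s else [::]).

Definition sorted_pair (T : Type) (f : T -> nat) (p : T * T) : link :=
  if f p.1 <= f p.2 then (f p.1, f p.2) else (f p.2, f p.1).

Section Drop.
Variables (R : realType) (I : rooted_wrap R).
Variables (sigma : nat -> vertex I) (eps : nat -> edge I).
Hypothesis cc : cycle_coordinates (@ends R I) (Defs.root I) (root_edge I) sigma eps.
Local Notation V := (vertex I).
Local Notation n := #|vertex I|.
Local Notation r := (Defs.root I).
Local Notation pos := (pos sigma).
Local Notation vsegment := (vsegment sigma).
Local Notation chord := (chord sigma).
Variables (F0 : {set V * V}) (ct : V * V -> R).
Hypothesis F0_min : forall l, l \in F0 -> ~~ covers_all (F0 :\ l).
Hypothesis F0_cov : covers_all F0.
Hypothesis F0_loop : forall l : V * V, l \in F0 -> l.1 != l.2.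

Local Notation arc := [rel u v : V | (u, v) \in F0].

(** Deleting [l] leaves some cut uncovered. That [l] covers this cut follows later with
    [covering_link]. *)
Lemma uncovered_cut l : l \in F0 -> exists2 C, C \in ring_cuts I &
  forall m, m \in F0 -> covers m C -> m = l.
Proof.
move=> /F0_min /forall_inPn[C hC /exists_inPn h]; exists C => // m hm hc.
apply/eqP; apply: contraLR hc => ne; apply: h.
by rewrite in_setD1 ne.
Qed.

Lemma covering_link C : C \in ring_cuts I -> exists2 m, m \in F0 & covers m C.
Proof. by move=> hC; have /forall_inP/(_ C hC)/exists_inP := F0_cov. Qed.

Lemma root_notin C : C \in ring_cuts I -> r \notin C.
Proof. by rewrite inE => /andP[]. Qed.

Lemma no_arc_to_root u : (u, r) \notin F0.
Proof.
apply/negP => h; have [C hC huniq] := uncovered_cut h.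
have [m hm hc] := covering_link hC; have := huniq m hm hc => e.
by move: hc; rewrite e /covers /= (negbTE (root_notin hC)).
Qed.

(* Uncrossing: if two arcs enter v, they have private cuts C and D, which
   share v, and any arc entering the cut C :|: D enters C or D. *)
Lemma in_arc_uniq u u' v : (u, v) \in F0 -> (u', v) \in F0 -> u = u'.
Proof.
move=> hu hu'; apply/eqP; apply: contraT => ne.
have [C hC Cu] := uncovered_cut hu; have [D hD Du] := uncovered_cut hu'.
have cov l A : l \in F0 -> (forall m, m \in F0 -> covers m A -> m = l) ->
    A \in ring_cuts I -> l.2 \in A /\ l.1 \notin A.
  move=> hl hA rA; have [m hm hc] := covering_link rA.
  by have e := hA m hm hc; move: hc; rewrite e => /andP[].
have [/= vC uC] := cov _ _ hu Cu hC; have [/= vD uD] := cov _ _ hu' Du hD.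
have u'C : u' \in C.
  apply: contraT => h; have := Cu _ hu'; rewrite /covers /= vC h => /(_ isT)[e].
  by rewrite e eqxx in ne.
have uD' : u \in D.
  apply: contraT => h; have := Du _ hu; rewrite /covers /= vD h => /(_ isT)[e].
  by rewrite e eqxx in ne.
have hCD : C :|: D \in ring_cuts I.
  have [i [j [i0 ij jn eC]]] := ring_cut_interval cc hC.
  have [p [q [p0 pq qn eD]]] := ring_cut_interval cc hD.
  rewrite (_ : C :|: D = vsegment (minn i p) (maxn j q)).
    by apply: (interval_ring_cut cc); move: i0 ij jn p0 pq qn; clear; lia.
  move: vC vD; rewrite eC eD !inE /inside => vC vD.
  apply/setP => w; rewrite !inE /inside; move: (pos w) (pos v) vC vD => a b.
  by clear; move=> *; apply/idP/idP; lia.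
have [[s t] hm] := covering_link hCD; rewrite /covers /= !inE negb_or.
move=> /andP[/orP[tC|tD] /andP[sC sD]].
  have := Cu _ hm; rewrite /covers /= tC sC => /(_ isT)[e _].
  by rewrite e uD' in sD.
have := Du _ hm; rewrite /covers /= tD sD => /(_ isT)[e _].
by rewrite e u'C in sC.
Qed.

Definition blocked (u y : V) : Prop :=
  [\/ y = r, y = u |
      exists p, [/\ path arc r p, last r p = u, uniq (r :: p) & y \in r :: p]].

Lemma not_covers_path (C : {set V}) y s : y \notin C ->
  (forall l, l \in zip (y :: s) s -> ~~ covers l C) -> forall w, w \in y :: s -> w \notin C.
Proof.
elim: s y => [|z s IH] y yC h w; rewrite in_cons; first by rewrite orbF => /eqP->.
move=> /orP[/eqP->//|]; apply: IH; last by move=> l hl; apply: h; rewrite /= in_cons hl orbT.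
by have := h (y, z); rewrite /= inE eqxx /covers /= yC andbT; exact.
Qed.

(** The root path starts outside [C], so its links cover nothing of [C] exactly when all its
    vertices stay outside: the first vertex in [C] would be entered by a covering link. *)
Lemma responsibleP u v C : C \in ring_cuts I ->
  responsible F0 (u, v) C <-> v \in C /\ forall y, blocked u y -> y \notin C.
Proof.
move=> hC; have rC := root_notin hC; split=> [[/andP[/= vC uC] h]|[vC h]].
  split=> // y [->//|->//|[p [hp hl hu hy]]]; apply: not_covers_path hy => // l hl'.
  by apply: h; exists p.
split; first by rewrite /covers /= vC; apply: h; exact: Or32.
move=> [s t] [p [hp hl hu hst]]; rewrite /covers negb_and negbK /=; apply/orP; left.
apply: h; apply: Or33; exists p; split=> //; rewrite in_cons; apply/orP; right.
move: hst; elim: (p) (r) => //= z q IH y; rewrite in_cons => /orP[/eqP[_ ->]|/IH].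
  by rewrite mem_head.
by rewrite in_cons => ->; rewrite orbT.
Qed.

(** A root path to [u] through [v] would enter [v] by its only incoming arc, that is from [u], and
    so visit [u] twice. *)
Lemma blocked_head u v : (u, v) \in F0 -> ~ blocked u v.
Proof.
move=> h [e|e|[p [hp hl hu]]].
- by move: h; rewrite e (negbTE (no_arc_to_root _)).
- by have := F0_loop h; rewrite /= e eqxx.
rewrite in_cons => /orP[/eqP e|vp]; first by move: h; rewrite e (negbTE (no_arc_to_root _)).
case/splitPr: vp hp hl hu => p1 p2.
rewrite cat_path last_cat => /andP[_ /andP[h1 _]] hl.
have e := in_arc_uniq h1 h.
rewrite -cat_cons cat_uniq => /and3P[_ /hasPn hn _].
have hu2 : u \in v :: p2 by rewrite -hl /= mem_last.
by have /negP := hn _ hu2; apply; rewrite -e /= mem_last.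
Qed.

Section Blocked.
Variable sF : seq (V * V).
Hypothesis sF_mem : sF =i F0.

Lemma mem_parents s u : (u \in parents r sF s) = ((u, head r s) \in F0).
Proof.
apply/mapP/idP => [[[a b]]|h]; last by exists (u, head r s); rewrite // mem_filter eqxx sF_mem.
by rewrite mem_filter sF_mem /= => /andP[/eqP-> h] ->.
Qed.

Lemma grow_path u k : let s := iter k (grow r (parents r sF)) [:: u] in
  [/\ s != [::], path arc (head r s) (behead s) & last r s = u].
Proof.
elim: k => //= k; set s := iter _ _ _ => -[s0 hp hl]; rewrite /grow.
have := mem_parents s; case: parents => //= a q /(_ a); rewrite mem_head => /esym ha.
case: s s0 hp hl ha => //= b s _ hp hl ha; split=> //.
by rewrite ha.
Qed.

(** In-degrees are at most one, so the backward walk has no choice: it retraces [p] from its end and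
    then rests at the root, which no arc enters. *)
Lemma grow_drop u p k : path arc r p -> last r p = u ->
  iter k (grow r (parents r sF)) [:: u] = drop (size p - k) (r :: p).
Proof.
move=> hp hl; elim: k => [|k IH].
  by rewrite subn0 -hl (drop_nth r) //= -last_nth drop_size.
rewrite /= IH; have [kp|kp] := ltnP k (size p); last first.
  have -> : size p - k = 0 by apply/eqP; rewrite subn_eq0.
  have -> : size p - k.+1 = 0 by apply/eqP; rewrite subn_eq0 leqW.
  rewrite drop0 /grow; have := mem_parents (r :: p); case: parents => //= a q /(_ a).
  by rewrite mem_head (negbTE (no_arc_to_root _)).
set m := size p - k.+1; have em : size p - k = m.+1 by rewrite /m -subSn // subSS.
have mp : m < size p by rewrite /m; move: kp; clear; lia.
rewrite em /grow; have := mem_parents (drop m.+1 (r :: p)).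
rewrite [drop m _](drop_nth r) /=; last exact: ltnW.
rewrite -[drop m p]/(drop m.+1 (r :: p)) => hpar.
have hd : head r (drop m.+1 (r :: p)) = nth r p m by rewrite /= (drop_nth r mp).
have harc : (nth r (r :: p) m, nth r p m) \in F0 by exact: (pathP r hp).
move: hpar; rewrite hd; case: parents => [/(_ (nth r (r :: p) m))|a q hpar].
  by rewrite harc.
have := hpar a; rewrite mem_head => /esym ha.
by rewrite /= (in_arc_uniq ha harc) /= (drop_nth r mp).
Qed.

Lemma mem_blocked_by u y : reflect (blocked u y) (y \in blocked_by r sF n u).
Proof.
rewrite /blocked_by; set s := iter _ _ _.
have simple p : path arc r p -> last r p = u -> uniq (r :: p) -> s = r :: p.
  move=> hp hl hu; rewrite /s (grow_drop _ hp hl).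
  have : size (r :: p) <= n by rewrite -(card_uniqP hu) max_card.
  by rewrite /= => /ltnW; rewrite -subn_eq0 => /eqP->; rewrite drop0.
rewrite !in_cons; apply: (iffP or3P) => [[/eqP->|/eqP->|h]|[->|->|[p [hp hl hu hy]]]].
- exact: Or31.
- exact: Or32.
- move: h; case: ifP => // /eqP hr hy; apply: Or33.
  have [] := grow_path u n; rewrite -/s hr; case: s hr hy simple => //= a q -> hy simple _ hp hl.
  (* The walk that reached the root might repeat vertices; its shortening is simple, and [simple]
     identifies the walk with it. *)
  move: (hp) (hl); case/shortenP => p' hp' hu' _ hl'.
  by have [e] := simple _ hp' hl' hu'; exists p'; split=> //; rewrite -e.
- by apply: Or31.
- by apply: Or32.
by apply: Or33; rewrite (simple p) //= eqxx.
Qed.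

Variable sL : seq (V * V).
Hypothesis sL_links : lists_links (links I) sL.
Hypothesis sF_uniq : uniq sF.

Definition instance : nat * (seq (link * R) * seq (nat * seq nat * R)) :=
  (n, ([seq (sorted_pair pos p, cost (unordered p)) | p <- sL],
       [seq (pos f.2, [seq pos y | y <- blocked_by r sF n f.1], ct f) | f <- sF])).

Lemma chord_sorted_pair p : chord (sorted_pair pos p) = unordered p.
Proof.
by rewrite /sorted_pair; case: ifP => _; rewrite (chord_pos cc) // setUC.
Qed.

Lemma sorted_pair_lt p : p \in sL ->
  (sorted_pair pos p).1 < (sorted_pair pos p).2 < n.
Proof.
move=> hp; have : unordered p \in links I by have [_ <-] := sL_links; exact: map_f.
move=> /linksP; rewrite cards2 /sorted_pair; case: eqVneq => //= ne _.
have {}ne : pos p.1 != pos p.2 by rewrite (inj_eq (pos_inj cc)).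
by case: (ltngtP (pos p.1) (pos p.2)) ne => //= h _; rewrite h (pos_lt cc).
Qed.

Lemma instance_lt (l : link * R) : l \in instance.2.1 -> l.1.1 < l.1.2 < n.
Proof. by move=> /mapP[p hp ->]; exact: sorted_pair_lt. Qed.

Lemma instance_links_map : [seq l.1 | l <- instance.2.1] = [seq sorted_pair pos p | p <- sL].
Proof. by rewrite /= -map_comp. Qed.

Lemma instance_uniq : uniq [seq l.1 | l <- instance.2.1].
Proof.
rewrite instance_links_map; apply: (@map_uniq _ _ chord); rewrite -map_comp.
by rewrite (eq_map chord_sorted_pair); have [] := sL_links.
Qed.

Lemma instance_links (l : link) : l.1 < l.2 < n ->
  (l \in [seq l.1 | l <- instance.2.1]) = (chord l \in links I).
Proof.
move=> hl; rewrite instance_links_map; have [_ <-] := sL_links.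
apply/mapP/mapP => [[p hp ->]|[p hp e]]; first by exists p; rewrite // chord_sorted_pair.
exists p => //; apply: (chord_inj cc hl (sorted_pair_lt hp)).
by rewrite chord_sorted_pair.
Qed.

Lemma instance_drops : {in instance.2.2, forall f : nat * seq nat * R,
  [/\ 0 < f.1.1 < n, f.1.1 \notin f.1.2 & 0 \in f.1.2]}.
Proof.
move=> _ /mapP[[u v] hf ->]; rewrite sF_mem in hf.
set B := blocked_by _ _ _ _; split; rewrite [X in X.1]/=.
- rewrite (pos_lt cc) andbT lt0n (pos_eq0 cc).
  by apply/eqP => e; move: hf; rewrite e (negbTE (no_arc_to_root _)).
- rewrite (mem_map (pos_inj cc)); apply/mem_blocked_by; exact: blocked_head.
by rewrite /B /blocked_by in_cons (pos_root cc).
Qed.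

Lemma has_link_cut (K : {set {set V}}) i j : K \subset links I ->
  has (fun l => (chord l.1 \in K) && leaves i j l.1) instance.2.1 =
  (link_cut K (vsegment i j) != set0).
Proof.
move=> KL; rewrite -cards_eq0.
rewrite -(cut_size_card cc instance_lt instance_uniq instance_links i j KL).
by rewrite /cut_size size_eq0 -has_filter.
Qed.

Lemma dropped_drop_links (K : {set {set V}}) f : K \subset links I -> f \in sF ->
  dropped instance (fun l => chord l \in K)
    (pos f.2, [seq pos y | y <- blocked_by r sF n f.1], ct f) = (f \in drop_links F0 K).
Proof.
case: f => u v KL hf; have := mem_blocked_by u.
move: (blocked_by _ _ _ _) => B mem_B; rewrite inE -sF_mem hf /=.
apply/asboolP/asboolP => /= h.
  move=> C hC /(responsibleP _ _ hC)[vC hB].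
  have [i [j [i0 ij jn eC]]] := ring_cut_interval cc hC.
  rewrite eC -has_link_cut //; apply: h => //.
    by move: vC; rewrite eC inE.
  apply/hasPn => _ /mapP[y /mem_B hy ->].
  by have := hB y hy; rewrite eC inE.
move=> i j i0 hv jn /hasPn hB; rewrite has_link_cut //.
have ij : i <= j by move: hv => /andP[]; exact: leq_trans.
have hC := interval_ring_cut cc i0 ij jn; apply: h => //.
apply/(responsibleP _ _ hC); split; first by rewrite inE.
by move=> y hy; rewrite inE; apply: hB; apply: map_f; apply/mem_B.
Qed.

Lemma gain_objective (K : {set {set V}}) : K \subset links I ->
  gain instance (fun l => chord l \in K) = objective F0 ct K.
Proof.
move=> KL; rewrite /gain /objective; congr (_ - _)%R.
  rewrite big_map big_seq_cond.
  rewrite (eq_bigl (fun f => (f \in sF) && (f \in drop_links F0 K))); last first.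
    by move=> f; case hf: (f \in sF) => //=; rewrite dropped_drop_links.
  rewrite -big_seq_cond -big_filter -big_enum /=; apply: perm_big; apply: uniq_perm.
  - exact: filter_uniq.
  - exact: enum_uniq.
  move=> f; rewrite mem_filter mem_enum andb_idr // => hf; rewrite sF_mem.
  by move: hf; rewrite inE => /andP[].
rewrite big_map (eq_bigl (fun p => unordered p \in K)); last first.
  by move=> p; rewrite chord_sorted_pair.
rewrite -(big_map (@unordered V) (mem K) (@cost R I)) -big_filter -[RHS]big_enum /=.
have [uL mL] := sL_links; apply: perm_big; apply: uniq_perm; rewrite ?enum_uniq ?filter_uniq //.
move=> A; rewrite mem_filter mem_enum mL andb_idr // => hA.
exact: (subsetP KL).
Qed.

End Blocked.

End Drop.

(** * Reading the instance *)

Section Order.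
Variable T : eqType.

Definition neighbours (E : seq (T * T)) (u : T) : seq T :=
  flatten [seq (if e.1 == u then [:: e.2] else [::]) ++
               (if e.2 == u then [:: e.1] else [::]) | e <- E].

Definition fresh (r : T) (E : seq (T * T)) (s : seq T) : seq T :=
  [seq y <- neighbours E (head r s) | (y != r) && ~~ has (fun z => z == y) s].

Definition other_end (r : T) (e : T * T) : T := if e.1 == r then e.2 else e.1.

(* The walk starts on the far side of the root edge, so that prepending the
   vertices lists the path without the root edge in increasing order. *)
Definition ring_order (r : T) (E : seq (T * T)) (i k : nat) : seq T :=
  r :: iter k (grow r (fresh r E)) [:: other_end r (head (r, r) (iter i behead E))].

(** The function [index], written as a fold to fit [polytime_foldr]. *)
Definition position (s : seq T) (v : T) : nat :=
  foldr (fun a k => if a == v then 0 else k.+1) 0 s.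

Lemma positionE s v : position s v = index v s.
Proof. by elim: s => //= a s ->. Qed.

Lemma mem_neighbours E u y :
  (y \in neighbours E u) = ((u, y) \in E) || ((y, u) \in E).
Proof.
apply/flatten_mapP/orP => [[[a b] he]|[h|h]].
- rewrite mem_cat /= => /orP[]; case: eqP => // <-; rewrite mem_seq1 => /eqP->.
    by left.
  by right.
- by exists (u, y); rewrite // mem_cat /= eqxx mem_head.
by exists (y, u); rewrite // mem_cat /= eqxx mem_head orbT.
Qed.

End Order.

(** * Invariance under an injective renaming of the vertices *)

Section MapOrder.
Variables (T T' : eqType) (h : T -> T').
Hypothesis h_inj : injective h.
Let h2 (e : T * T) := (h e.1, h e.2).

Lemma head_map_codes r s : head (h r) (map h s) = h (head r s).
Proof. by case: s. Qed.

Lemma map_fresh r E s : fresh (h r) (map h2 E) (map h s) = map h (fresh r E s).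
Proof.
have nb u : neighbours (map h2 E) (h u) = map h (neighbours E u).
  rewrite /neighbours map_flatten -!map_comp; congr flatten; apply: eq_map => e /=.
  by rewrite map_cat !(inj_eq h_inj); case: (_ == u); case: (_ == u).
rewrite /fresh head_map_codes nb filter_map; congr map; apply: eq_filter => y /=.
by rewrite (inj_eq h_inj) has_map; congr (_ && ~~ _); apply: eq_has => z /=; rewrite (inj_eq h_inj).
Qed.

Lemma map_parents r E s : parents (h r) (map h2 E) (map h s) = map h (parents r E s).
Proof.
rewrite /parents head_map_codes filter_map -!map_comp; congr map; apply: eq_filter => e /=.
by rewrite (inj_eq h_inj).
Qed.

Lemma map_ring_order r E i k : ring_order (h r) (map h2 E) i k = map h (ring_order r E i k).
Proof.
rewrite /ring_order /= -(map_grow r (h r) (cand' := fresh (h r) (map h2 E))) => [|s];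
  last exact: map_fresh.
have -> : iter i behead (map h2 E) = map h2 (iter i behead E).
  by elim: i => //= i ->; case: (iter i behead E).
congr (_ :: iter _ _ [:: _]); rewrite /other_end.
by case: (iter i behead E) => [|e s] /=; rewrite (inj_eq h_inj); case: ifP.
Qed.

Lemma map_blocked_by r F k u :
  blocked_by (h r) (map h2 F) k (h u) = map h (blocked_by r F k u).
Proof.
rewrite /blocked_by; have -> : iter k (grow (h r) (parents (h r) (map h2 F))) [:: h u] =
    map h (iter k (grow r (parents r F)) [:: u]).
  rewrite -(map_grow r (h r) (cand' := parents (h r) (map h2 F))) => // s.
  exact: map_parents.
by rewrite /= head_map_codes (inj_eq h_inj); case: ifP.
Qed.

Lemma map_position s v : position (map h s) (h v) = position s v.
Proof. by rewrite !positionE index_map. Qed.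

End MapOrder.

Section Program.
Variables (R : realType) (alpha : nat).

(** Nested pairs ending in [unit] are encoded like a list, so components of different types can
    match the list in [encodes]. *)
Notation input := (nat * (seq (nat * nat) * (nat * (nat *
  (seq (nat * nat * R) * (seq (nat * nat * R) * unit))))))%type.

Definition input_order (x : input) : seq nat :=
  ring_order x.2.2.1 x.2.1 x.2.2.2.1 x.1.

Definition input_instance (x : input) :=
  (x.1, ([seq (sorted_pair (position (input_order x)) p.1, p.2) | p <- x.2.2.2.2.1],
   [seq (position (input_order x) f.1.2,
         [seq position (input_order x) y
           | y <- blocked_by x.2.2.1 [seq g.1 | g <- x.2.2.2.2.2.1] x.1 f.1.1], f.2)
     | f <- x.2.2.2.2.2.1])).

Definition wrap_solver (x : input) : seq (nat * nat) :=
  [seq (head 0 (iter l.1 behead (input_order x)), head 0 (iter l.2 behead (input_order x)))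
    | l <- solve alpha (input_instance x)].

Local Notation esize := (@esize R _ _).
Local Notation polytime := (@polytime R _ _ _ _).
Local Notation poly_bounded := (@poly_bounded R _ _).

Lemma polytime_drop {A B : Type} {eA : encodable R A} {eB : encodable R B}
    (k : A -> nat) (s : A -> seq B) :
  polytime k -> polytime s -> polytime (fun a => iter (k a) behead (s a)).
Proof.
move=> hk hs; have [ss _] := hs.
apply: (polytime_iter (s := fun _ => behead) (Q := fun a => esize (s a))) => //.
  by ptime.
move=> a i _; elim: i => //= i; apply: leq_trans; rewrite -drop1; exact: esize_drop.
Qed.

Lemma polytime_position {A : Type} {eA : encodable R A}
    (s : A -> seq nat) (v : A -> nat) :
  polytime s -> polytime v -> polytime (fun a => position (s a) (v a)).
Proof.
move=> hs hv; have [ss _] := hs; rewrite /position.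
apply: (polytime_foldr (z := fun=> 0) (s := fun x a k => if a == v x then 0 else k.+1)
  (Q := fun a => (esize (s a) + esize (s a) + 1)%N)) => //.
- by ptime.
- apply: polytime_if; [|by ptime|by ptime].
  apply: polytime_eqop; [exact: polytime_eqn | by ptime |].
  by apply: (polytime_comp (f := fun y : A * (nat * nat) => y.1) hv); ptime.
- by apply: poly_bounded_add (poly_bounded_cst _); apply: poly_bounded_add.
move=> x i; rewrite -[foldr _ _ _]/(position _ _) positionE esize_nat.
have h1 := index_size (v x) (drop i (s x)).
have h2 : (size (s x) < esize (s x))%N by exact: size_esize.
have h3 : (size (drop i (s x)) <= size (s x))%N by rewrite size_drop leq_subr.
by move: h1 h2 h3; rewrite /=; lia.
Qed.

Lemma polytime_grow {A : Type} {eA : encodable R A}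
    (k d w : A -> nat) (cand : A -> seq nat -> seq nat) :
  polytime k -> polytime d -> polytime w ->
  polytime (fun y : A * seq nat => cand y.1 y.2) ->
  (forall x s y, y \in cand x s -> (esize y <= esize x)%N) ->
  polytime (fun x => iter (k x) (grow (d x) (cand x)) [:: w x]).
Proof.
move=> hk hd hw hc hcand; have [sk _] := hk; have [sw _] := hw.
apply: (polytime_iter (s := fun x => grow (d x) (cand x)) (z := fun x => [:: w x])
  (Q := fun x => ((esize (k x) + 1) * (esize x + esize (w x) + 1) + 1)%N)) => //.
- rewrite /grow; apply: polytime_if; first by apply: polytime_is_nil.
    by ptime.
  apply: polytime_cons; last by ptime.
  apply: polytime_head => //.
  by apply: (polytime_comp (f := fun y : A * seq nat => y.1) hd); ptime.
- by ptime.
- apply: poly_bounded_add (poly_bounded_cst _); apply: poly_bounded_mul.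
    exact: poly_bounded_add (poly_bounded_cst _).
  apply: poly_bounded_add (poly_bounded_cst _).
  by apply: poly_bounded_add => //; exact: poly_bounded_esize.
move=> x i hi.
have mem y : y \in iter i (grow (d x) (cand x)) [:: w x] -> (esize y <= esize x + esize (w x))%N.
  elim: i {hi} => [|i IH] /=; first by rewrite inE => /eqP->; exact: leq_addl.
  rewrite {1}/grow; case e: (cand x _) => [|a q] //=; rewrite in_cons => /orP[/eqP->|//].
  apply: leq_trans (leq_addr _ _).
  by apply: (hcand _ (iter i (grow (d x) (cand x)) [:: w x])); rewrite e mem_head.
have sz : (size (iter i (grow (d x) (cand x)) [:: w x]) <= i.+1)%N.
  elim: i {hi mem} => //= i IH; rewrite {1}/grow; case: (cand x _) => //=.
  exact: leq_trans IH (leqnSn _).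
apply: leq_trans (esize_le_sum (m := (esize x + esize (w x))%N) _) _.
  by move=> j a hj; apply: mem; exact: mem_nth.
rewrite !addn1 ltnS; apply: leq_mul => //.
by apply: leq_trans sz _; rewrite ltnS (leq_trans hi) // esize_nat; lia.
Qed.

Lemma polytime_order : polytime input_order.
Proof.
rewrite /input_order /ring_order; apply: polytime_cons; first by ptime.
apply: polytime_grow; [by ptime | by ptime | | |].
- have he : polytime (fun x : input =>
      head (x.2.2.1, x.2.2.1) (iter x.2.2.2.1 behead x.2.1)).
    by apply: polytime_head; [by ptime | by apply: polytime_drop; ptime].
  have ho : polytime (fun y : nat * (nat * nat) => other_end y.1 y.2).
    by rewrite /other_end; ptime.
  apply: (polytime_comp (g := fun y => other_end y.1 y.2) (f := fun x : input =>
    (x.2.2.1, head (x.2.2.1, x.2.2.1) (iter x.2.2.2.1 behead x.2.1))) ho).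
  by apply: polytime_pair; first by ptime.
- by rewrite /fresh /neighbours; ptime.
move=> [n [E [r [ie y]]]] s z /=.
rewrite mem_filter mem_neighbours !esize_pair => /andP[_ h].
have mem e : e \in E -> (esize e < esize E)%N by exact: esize_mem.
have h2 : (esize z < esize E)%N.
  by case/orP: h => /mem; apply: leq_ltn_trans; rewrite esize_pair leqW //;
    [exact: leq_addl | exact: leq_addr].
by apply: leq_trans (ltnW h2) _; lia.
Qed.

Lemma polytime_instance : polytime input_instance.
Proof.
have ho := polytime_order; rewrite /input_instance; apply: polytime_pair; first by ptime.
apply: polytime_pair.
  apply: polytime_map; last by ptime.
  apply: polytime_pair; last by ptime.
  have hp f : polytime f -> polytime (fun y : input * (nat * nat * R) =>
      position (input_order y.1) (f y)).
    move=> hf; apply: polytime_position => //.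
    by apply: (polytime_comp (f := fun y : input * (nat * nat * R) => y.1) ho); ptime.
  have h1 : polytime (fun y : input * (nat * nat * R) => position (input_order y.1) y.2.1.1).
    by apply: hp; ptime.
  have h2 : polytime (fun y : input * (nat * nat * R) => position (input_order y.1) y.2.1.2).
    by apply: hp; ptime.
  by rewrite /sorted_pair; apply: polytime_if; ptime.
apply: polytime_map; last by ptime.
apply: polytime_pair; last by ptime.
apply: polytime_pair.
  apply: polytime_position; last by ptime.
  by apply: (polytime_comp (f := fun y : input * (nat * nat * R) => y.1) ho); ptime.
apply: polytime_map.
  apply: polytime_position; last by ptime.
  by apply: (polytime_comp (f := fun y : input * (nat * nat * R) * nat => y.1.1) ho); ptime.
have hs : polytime (fun y : input * (nat * nat * R) =>
    iter y.1.1 (grow y.1.2.2.1 (parents y.1.2.2.1 [seq g.1 | g <- y.1.2.2.2.2.2.1])) [:: y.2.1.1]).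
  apply: polytime_grow; [by ptime | by ptime | by ptime | by rewrite /parents; ptime |].
  move=> [[n [E [r [ie [LS [FS u]]]]]] q] s y /= /mapP[f].
  rewrite mem_filter => /andP[_ /mapP[g hg ->]] ->.
  have h1 : (esize g < esize FS)%N by exact: esize_mem.
  have h2 : (esize g.1.1 <= esize g)%N.
    by case: (g) => [[a b] c]; rewrite !esize_pair /=; lia.
  by apply: leq_trans h2 (leq_trans (ltnW h1) _); rewrite !esize_pair; lia.
rewrite /blocked_by; apply: polytime_cons; first by ptime.
apply: polytime_cons; first by ptime.
apply: polytime_if; [|exact: hs|by ptime].
apply: polytime_eqop; [exact: polytime_eqn | | by ptime].
by apply: polytime_head; [ptime | exact: hs].
Qed.

Lemma polytime_wrap_solver : polytime wrap_solver.
Proof.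
have ho := polytime_order; rewrite /wrap_solver; apply: polytime_map; last first.
  exact: polytime_comp (polytime_solve _ alpha) polytime_instance.
have h (f : input * (nat * nat) -> nat) : polytime f ->
    polytime (fun y => head 0 (iter (f y) behead (input_order y.1))).
  move=> hf; apply: polytime_head; first by ptime.
  apply: polytime_drop => //.
  by apply: (polytime_comp (f := fun y : input * (nat * nat) => y.1) ho); ptime.
by apply: polytime_pair; apply: h; ptime.
Qed.

End Program.

Lemma set2_eq (T : finType) (a b c d : T) : [set a; b] = [set c; d] ->
  (a = c /\ b = d) \/ (a = d /\ b = c).
Proof.
move=> e; have ha : a \in [set c; d] by rewrite -e set21.
have hb : b \in [set c; d] by rewrite -e set22.
have hc : c \in [set a; b] by rewrite e set21.
have hd : d \in [set a; b] by rewrite e set22.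
move: ha hb hc hd; rewrite !in_set2.
by move=> /orP[]/eqP ea /orP[]/eqP eb; [| left | right |]; rewrite ?ea ?eb //;
  rewrite ?ea ?eb => /orP[]/eqP ec /orP[]/eqP ed; subst; auto.
Qed.

Section Final.
Variables (R : realType) (I : rooted_wrap R).
Variables (sigma : nat -> vertex I) (eps : nat -> edge I).
Hypothesis cc : cycle_coordinates (@ends R I) (Defs.root I) (root_edge I) sigma eps.
Local Notation V := (vertex I).
Local Notation n := #|vertex I|.
Local Notation r := (Defs.root I).
Variable sE : seq (V * V).
Hypothesis sE_ends : map (@unordered V) sE = map (@ends R I) (enum (edge I)).

Lemma mem_ring_neighbours u y : y \in neighbours sE u -> exists2 i, i < n &
  (u = sigma i /\ y = sigma i.+1) \/ (u = sigma i.+1 /\ y = sigma i).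
Proof.
rewrite mem_neighbours => h.
have : [set u; y] \in map (@unordered V) sE.
  by case/orP: h => /(map_f (@unordered V)); rewrite /unordered //= setUC.
rewrite sE_ends => /mapP[e _]; have [i hi ->] := cc_edge_onto cc e.
by rewrite (cc_ends cc hi) => /set2_eq h'; exists i.
Qed.

Lemma ring_neighbour i : i < n -> sigma i \in neighbours sE (sigma i.+1).
Proof.
move=> hi; rewrite mem_neighbours.
have : ends (eps i) \in map (@unordered V) sE.
  by rewrite sE_ends map_f // mem_enum.
move=> /mapP[[a b] hp]; rewrite (cc_ends cc hi) => /set2_eq[] [-> ->];
  by rewrite hp ?orbT.
Qed.

(** With positions [m] to [n - 1] visited, the walk stands at [m]. Its cyclic successor is visited
    or is the root; its predecessor is new unless it is the root, that is, unless [m = 1]. *)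
Lemma mem_fresh m y : 0 < m -> m < n ->
  (y \in fresh r sE [seq sigma i | i <- iota m (n - m)]) = (1 < m) && (y == sigma m.-1).
Proof.
move=> m0 mn; have mem_s i : i < n -> m <= i ->
    sigma i \in [seq sigma i | i <- iota m (n - m)].
  by move=> hi mi; apply: map_f; rewrite mem_iota mi subnKC // ltnW.
have hd : head r [seq sigma i | i <- iota m (n - m)] = sigma m.
  by have -> : n - m = (n - m).-1.+1 by rewrite prednK // subn_gt0.
rewrite mem_filter hd has_pred1 -andbA; apply/and3P/andP => [[yr ys]|[m1 /eqP ->]].
  move=> /mem_ring_neighbours[i hi [[ei ey]|[ei ey]]].
    have e := cc_inj cc mn hi ei; rewrite -e in ey.
    have [hS|hS] := ltnP m.+1 n; first by move: ys; rewrite ey mem_s.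
    have eS : m.+1 = n by apply/eqP; rewrite eqn_leq mn hS.
    by move: yr; rewrite ey eS (cc_closed cc) (cc_root cc) eqxx.
  have [hS|hS] := ltnP i.+1 n.
    have e := cc_inj cc mn hS ei; rewrite e /= ey; split=> //.
    rewrite ltnS lt0n; apply: contraNneq yr => e0; by rewrite ey e0 (cc_root cc).
  have eS : i.+1 = n by apply/eqP; rewrite eqn_leq hi hS.
  rewrite eS (cc_closed cc) in ei; have := cc_inj cc mn (ltnW (cc_gt1 cc)) ei.
  by move=> e; rewrite e in m0.
have pn : m.-1 < n := leq_ltn_trans (leq_pred m) mn.
split.
- rewrite -(cc_root cc); apply/eqP => /(cc_inj cc pn (ltnW (cc_gt1 cc))).
  by move: m1; clear; lia.
- apply/negP => /mapP[i]; rewrite mem_iota (subnKC (ltnW mn)) => /andP[mi hi].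
  by move=> /(cc_inj cc pn hi); move: mi m0; clear; lia.
by have := ring_neighbour pn; rewrite prednK.
Qed.

Lemma ring_orderE :
  ring_order r sE (enum_rank (root_edge I)) n = [seq sigma i | i <- iota 0 n].
Proof.
have n1 := cc_gt1 cc; rewrite /ring_order.
have -> : other_end r (head (r, r) (iter (enum_rank (root_edge I)) behead sE)) = sigma n.-1.
  have drop_behead (s : seq (V * V)) k : iter k behead s = drop k s.
    by elim: k s => [|k IH] s; rewrite ?drop0 // iterS IH -drop1 drop_drop.
  have hk : enum_rank (root_edge I) < size sE.
    rewrite -(size_map (@unordered V)) sE_ends size_map -cardE; exact: ltn_ord.
  rewrite drop_behead (drop_nth (r, r) hk) /=.
  (* [sE] follows the enumeration of the edges, so the rank of the root edge locates it in the
     list. *)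
  have : unordered (nth (r, r) sE (enum_rank (root_edge I))) = [set r; sigma n.-1].
    rewrite -(nth_map _ set0) // sE_ends (nth_map (root_edge I)) -?cardE ?ltn_ord //.
    by rewrite nth_enum_rank (cc_root_edge cc).
  case: nth => a b /set2_eq[] [/= ea eb]; rewrite /other_end /= ea eb ?eqxx //.
  by case: eqP.
(* The walk descends from [n - 1] and rests at position 1, where only the root is left; [maxn]
   covers the idle steps. *)
have grow_s k : iter k (grow r (fresh r sE)) [:: sigma n.-1] =
    [seq sigma i | i <- iota (maxn 1 (n.-1 - k)) (n - maxn 1 (n.-1 - k))].
  elim: k => [|k IH].
    have -> : maxn 1 (n.-1 - 0) = n.-1 by move: n1; clear; lia.
    by have -> : n - n.-1 = 1 by move: n1; clear; lia.
  rewrite iterS IH; set m := maxn 1 (n.-1 - k).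
  have m0 : 0 < m by rewrite leq_max.
  have mn : m < n by rewrite /m; move: n1; clear; lia.
  rewrite /grow; have hf y := mem_fresh y m0 mn.
  have [m1|m1] := ltnP 1 m.
    have -> : maxn 1 (n.-1 - k.+1) = m.-1 by rewrite /m; move: m1; rewrite /m; clear; lia.
    have -> : n - m.-1 = (n - m).+1 by move: mn m0; clear; lia.
    rewrite [iota _ _.+1]/= map_cons prednK //.
    case: fresh hf => [/(_ (sigma m.-1))|a q /(_ a)]; first by rewrite m1 eqxx.
    by rewrite mem_head m1 => /esym/eqP->.
  have -> : maxn 1 (n.-1 - k.+1) = m by move: m1; rewrite /m; clear; lia.
  case: fresh hf => [//|a q /(_ a)].
  by rewrite mem_head ltnNge m1.
rewrite grow_s; have -> : maxn 1 (n.-1 - n) = 1 by move: n1; clear; lia.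
rewrite -[n in iota 0 n](prednK (ltnW n1)) /= (cc_root cc).
by rewrite subn1.
Qed.

End Final.

(** * The theorem *)

(** The solver describes its solution by membership in a list of pairs, the objective by membership
    of chords in [K]; their agreement is known on the links of the instance only. *)
Lemma eq_gain (R : realType) (x : nat * (seq (link * R) * seq (nat * seq nat * R)))
    (K K' : pred link) :
  {in [seq l.1 | l <- x.2.1], K =1 K'} -> gain x K = gain x K'.
Proof.
move=> h; have hL l : l \in x.2.1 -> K l.1 = K' l.1 by move=> hl; apply: h; exact: map_f.
have hd : dropped x K =1 dropped x K'.
  move=> f; rewrite /dropped; congr `[< _ >]; apply/propext.
  have hh i j : has (fun l => K l.1 && leaves i j l.1) x.2.1 =
      has (fun l => K' l.1 && leaves i j l.1) x.2.1.
    by apply: eq_in_has => l hl; rewrite hL.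
  by split=> H i j i0 hv jn nB; [rewrite -hh | rewrite hh]; exact: H.
rewrite /gain (eq_bigl _ _ hd); congr (_ - _)%R.
rewrite big_seq_cond [RHS]big_seq_cond; apply: eq_bigl => l.
by case hl: (l \in _) => //=; rewrite hL.
Qed.

Section Encoded.
Variables (R : realType) (alpha : nat) (I : rooted_wrap R).
Local Notation V := (vertex I).
Local Notation n := #|vertex I|.
Local Notation r := (Defs.root I).
Variables (F0 : {set V * V}) (ct : V * V -> R).

Definition code (v : V) : nat := enum_rank v.
Definition code_pair (p : V * V) : nat * nat := (code p.1, code p.2).

Lemma code_inj : injective code.
Proof. by move=> u v /val_inj/enum_rank_inj. Qed.

Definition input_of (sE sL sF : seq (V * V)) :=
  (n, (map code_pair sE, (code r, (nat_of_ord (enum_rank (root_edge I)),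
    ([seq (code_pair p, cost (unordered p)) | p <- sL],
     ([seq (code_pair f, ct f) | f <- sF], tt)))))).

Lemma enc_input_of sE sL sF : enc (input_of sE sL sF) =
  enc_seq [:: enc_nat R n; enc_seq (map (@enc_pair R V) sE); enc_vertex R r;
    enc_nat R (enum_rank (root_edge I));
    enc_seq [seq DCons (enc_pair R p) (DReal (cost (unordered p))) | p <- sL];
    enc_seq [seq DCons (enc_pair R p) (DReal (ct p)) | p <- sF]].
Proof.
by rewrite /input_of /enc /prod_encodable /seq_encodable /= -!map_comp.
Qed.

Variables (sigma : nat -> V) (eps : nat -> edge I).
Hypothesis cc : cycle_coordinates (@ends R I) r (root_edge I) sigma eps.
Hypothesis F0_ns : non_shortenable F0.
Variables (sE sL sF : seq (V * V)).
Hypothesis sE_ends : map (@unordered V) sE = map (@ends R I) (enum (edge I)).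
Hypothesis sL_links : lists_links (links I) sL.
Hypothesis sF_uniq : uniq sF.
Hypothesis sF_mem : sF =i F0.
Hypothesis ct_ge0 : forall l, l \in F0 -> (0 <= ct l)%R.

Let x := instance sigma ct sF sL.

Lemma input_orderE : input_order (input_of sE sL sF) = map code [seq sigma i | i <- iota 0 n].
Proof.
rewrite -(ring_orderE cc sE_ends) -(map_ring_order code_inj).
by [].
Qed.

Lemma input_position v : position (input_order (input_of sE sL sF)) (code v) = pos sigma v.
Proof. by rewrite input_orderE (map_position code_inj) positionE. Qed.

Lemma input_instanceE : input_instance (input_of sE sL sF) = x.
Proof.
rewrite /input_instance; have := input_position; move: (input_order _) => o oE.
congr (_, (_, _)); first by rewrite -map_comp; apply: eq_map => p; rewrite /= /sorted_pair !oE.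
rewrite -!map_comp; apply: eq_map => f; congr (_, _, _); first exact: oE.
rewrite (map_blocked_by code_inj) -map_comp; apply: eq_map => y; exact: oE.
Qed.

Lemma wrap_solver_correct : exists K : {set {set V}},
  encodes_links K (enc (wrap_solver alpha (input_of sE sL sF))) /\ maximizer alpha F0 ct K.
Proof.
have [[F0_loop F0_cov] F0_min _] := F0_ns.
have xlt := instance_lt (ct := ct) (sF := sF) cc sL_links.
have xu := instance_uniq cc ct sF sL_links.
have xl := instance_links cc ct sF sL_links.
have xd := instance_drops (ct := ct) (sL := sL) cc F0_min F0_cov F0_loop sF_mem.
have x_ge0 : {in x.2.2, forall f, 0 <= f.2}%R.
  by move=> _ /mapP[f hf ->] /=; apply: ct_ge0; rewrite -sF_mem.
have [su ssub st smax] := solve_correct alpha xlt xu (cc_gt1 cc) x_ge0 xd.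
set s := solve alpha _ in su ssub st smax.
have slt l : l \in s -> l.1 < l.2 < n by move=> /ssub /mapP[l' /xlt h ->].
pose K := [set A in [seq chord sigma l | l <- s]].
have memK l : l \in [seq l.1 | l <- x.2.1] -> (chord sigma l \in K) = (l \in s).
  move=> /mapP[l' /xlt hl' ->]; rewrite inE; apply/mapP/idP => [[m hm e]|h].
    by rewrite (chord_inj cc hl' (slt _ hm) e).
  by exists l'.1.
have KL : K \subset links I.
  apply/subsetP => A; rewrite inE => /mapP[l hl ->].
  by rewrite -xl ?slt //; exact: ssub.
exists K; split.
  have eout : wrap_solver alpha (input_of sE sL sF) =
      [seq code_pair (sigma l.1, sigma l.2) | l <- s].
    rewrite /wrap_solver input_instanceE -/s; apply/eq_in_map => l /slt /andP[l1 l2].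
    have drop_behead (q : seq nat) k : iter k behead q = drop k q.
      by elim: k q => [|k IH] q; rewrite ?drop0 // iterS IH -drop1 drop_drop.
    have nthE i : i < n ->
        head 0 (iter i behead (input_order (input_of sE sL sF))) = code (sigma i).
      move=> hi; rewrite input_orderE -map_comp drop_behead -nth0 nth_drop addn0.
      by rewrite (nth_map 0) ?size_iota // nth_iota.
    by rewrite !nthE //; exact: ltn_trans l1 l2.
  exists [seq (sigma l.1, sigma l.2) | l <- s]; last first.
    by rewrite eout /enc /seq_encodable -!map_comp.
  split; rewrite -map_comp; last by move=> A; rewrite inE.
  rewrite map_inj_in_uniq // => l m /slt hl /slt hm; exact: (chord_inj cc).
split=> //.
  apply: (tree_to_thin cc xlt xu xl KL).
  by apply: (eq_thin_tree xu _ st) => l hl _; rewrite memK.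
move=> K' KL' t'.
have tr := thin_to_tree cc xlt xu xl KL' t'.
rewrite -(gain_objective cc ct F0_min F0_cov sF_mem sL_links sF_uniq KL').
rewrite -(gain_objective cc ct F0_min F0_cov sF_mem sL_links sF_uniq KL).
apply: le_trans (smax _ tr) _; rewrite le_eqVlt; apply/orP; left; apply/eqP.
by apply: eq_gain => l hl /=; rewrite memK.
Qed.

End Encoded.

Local Open Scope ring_scope.

Theorem theorem55 (R : realType) (alpha : nat) (alpha_gt0 : (0 < alpha)%N) :
  exists (P : program) (k : nat),
    forall (I : rooted_wrap R) (F0 : {set vertex I * vertex I})
           (ct : vertex I * vertex I -> R),
      non_shortenable F0 ->
      (forall l, l \in F0 -> 0 <= ct l) ->
      forall x : data R, encodes F0 ct x ->
        exists (y : data R) (t : nat) (K : {set {set vertex I}}),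
          [/\ runs P x y t,
              (t <= k * dsize x ^ k + k)%N,
              encodes_links K y &
              maximizer alpha F0 ct K].
Proof.
have [P [k runP]] := polytime_program (polytime_wrap_solver R alpha).
exists P, k => I F0 ct F0_ns ct_ge0 x [sE [sL [sF [hE hL [sFu sFm] ->]]]].
(* These coordinates live in the proof only; the program recomputes the numbering as
   [input_order]. *)
have [sigma [eps cc]] := cycle_coordinatesP (@cycleP R I) (@root_edgeP R I).
have [K [hK hmax]] := wrap_solver_correct alpha cc F0_ns hE hL sFu sFm ct_ge0.
have [t run le] := runP (input_of ct sE sL sF).
by exists (enc (wrap_solver alpha (input_of ct sE sL sF))), t, K; rewrite -enc_input_of.
Qed.
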